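(* Let $1<p<2$, $p'=p/(p-1)$. There exists $\beta_p>0$, independent of $h$, such that $$\sup_{0\ne\boldsymbol{\tau}_h\in\mathrm{RT}_0(\mathcal T_h)}\frac{(\nabla\cdot\boldsymbol{\tau}_h,v_h)}{\|\boldsymbol{\tau}_h\|_{L^{p'}(\Omega)}+\|\nabla\cdot\boldsymbol{\tau}_h\|_{L^2(\Omega)}}\ge\beta_p\|v_h\|_{L^2(\Omega)}\qquad\forall\,v_h\in P_0(\mathcal T_h).$$
   Context: $\Omega\subset\mathbb R^2$ is a bounded, simply connected Lipschitz domain and $\mathcal T_h$ a triangulation of $\Omega$ from a shape-regular family, with $h=\max_{K\in\mathcal T_h}\operatorname{diam}K$. $\mathrm{RT}_0(\mathcal T_h)$ is the space of $\boldsymbol{\tau}_h\in H(\mathrm{div};\Omega)$ with $\boldsymbol{\tau}_h|_K(x)=\mathbf a+bx$, $\mathbf a\in\mathbb R^2$, $b\in\mathbb R$, on each $K\in\mathcal T_h$; $P_0(\mathcal T_h)$ is the space of piecewise constant functions. $(\cdot,\cdot)$ is the $L^2(\Omega)$ inner product. *)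

(* Defs.v *)
From mathcomp Require Import all_boot all_order all_algebra.
From mathcomp Require Import all_classical all_reals all_analysis.
Import Order.TTheory GRing.Theory Num.Theory.
Import numFieldNormedType.Exports.

Set Implicit Arguments.
Unset Strict Implicit.
Unset Printing Implicit Defensive.

Local Open Scope classical_set_scope.
Local Open Scope ring_scope.

Notation plane R := (R * R)%type.

(* The library norm of [R * R] is the max norm; everything metric below
   (diameters, inscribed balls, |tau| in the Lebesgue norms) is Euclidean. *)
Definition dot (R : realType) (x y : plane R) : R := x.1 * y.1 + x.2 * y.2.

Definition enorm (R : realType) (x : plane R) : R := Num.sqrt (dot x x).

(** * Domains *)

Definition path_connected (R : realType) (A : set (plane R)) : Prop :=
  forall x y, A x -> A y ->
    exists g : R -> plane R,
      [/\ {within `[0, 1], continuous g}, g @` `[0, 1] `<=` A,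
          g 0 = x & g 1 = y].

Definition simply_connected (R : realType) (A : set (plane R)) : Prop :=
  path_connected A /\
  forall g : R -> plane R,
    {within `[0, 1], continuous g} -> g @` `[0, 1] `<=` A -> g 0 = g 1 ->
    exists H : R * R -> plane R,
      [/\ {within `[0, 1] `*` `[0, 1], continuous H},
          H @` (`[0, 1] `*` `[0, 1]) `<=` A,
          (forall t, t \in `[0, 1] -> H (0, t) = g t),
          (forall t, t \in `[0, 1] -> H (1, t) = g 0) &
          (forall s, s \in `[0, 1] -> H (s, 0) = g 0 /\ H (s, 1) = g 0)].

(* Near each boundary point, in the Cartesian frame with origin [x0] and
   orthonormal axes [e] and [(- e.2, e.1)], the set is the strict subgraph
   of a Lipschitz function. *)
Definition lipschitz_boundary (R : realType) (A : set (plane R)) : Prop :=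
  forall x0, (closure A `\` interior A) x0 ->
    exists (e : plane R) (r L : R) (psi : R -> R),
      [/\ enorm e = 1, 0 < r, L.-lipschitz psi &
          forall x, enorm (x - x0) < r ->
            (A x <-> dot (x - x0) (- e.2, e.1) < psi (dot (x - x0) e))].

Record bounded_lipschitz_domain (R : realType) (A : set (plane R)) : Prop :=
  BoundedLipschitzDomain {
    domain_nonempty : A !=set0 ;
    domain_open : open A ;
    domain_connected : connected A ;
    domain_bounded : bounded_set A ;
    domain_lipschitz : lipschitz_boundary A }.

(** * Triangulations *)

(* A triangle is given by its three vertices. *)
Notation triangle R := {ffun 'I_3 -> plane R}.

Definition nondegenerate (R : realType) (K : triangle R) : Prop :=
  let u := K (inord 1) - K (inord 0) in
  let v := K (inord 2) - K (inord 0) in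
  u.1 * v.2 - u.2 * v.1 != 0.

(* Convex hull of the vertices with index in [S]; it is empty for [S] empty. *)
Definition face (R : realType) (K : triangle R) (S : {set 'I_3}) :
    set (plane R) :=
  [set x | exists l : 'I_3 -> R,
    [/\ forall i, 0 <= l i, forall i, i \notin S -> l i = 0,
        \sum_i l i = 1 & x = \sum_i l i *: K i]].

Definition hull (R : realType) (K : triangle R) : set (plane R) :=
  face K [set: 'I_3]%SET.

Record triangulation (R : realType) (A : set (plane R))
    (T : seq (triangle R)) : Prop := Triangulation {
  tri_nondegenerate : forall K, K \in T -> nondegenerate K ;
  tri_cover : \bigcup_(K in [set K | K \in T]) hull K = closure A ;
  (* two triangles meet in a common (possibly empty) face *)
  tri_conforming : forall K K', K \in T -> K' \in T ->
    exists S S' : {set 'I_3},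
      hull K `&` hull K' = face K S /\ face K S = face K' S' }.

Definition diam (R : realType) (A : set (plane R)) : R :=
  sup [set d | exists x y, [/\ A x, A y & d = enorm (x - y)]].

Definition indiam (R : realType) (A : set (plane R)) : R :=
  sup [set d | exists x r, [/\ 0 <= r,
    [set y | enorm (y - x) <= r] `<=` A & d = 2 * r]].

Definition shape_regular (R : realType) (F : set (seq (triangle R))) : Prop :=
  exists2 sigma : R, 0 < sigma &
    forall T K, F T -> K \in T -> diam (hull K) <= sigma * indiam (hull K).

(** * Lebesgue spaces *)

Notation leb2 R := (@lebesgue_measure R \x @lebesgue_measure R)%E.

Definition Lpnorm (R : realType) (A : set (plane R)) (p : R)
    (f : plane R -> R) : \bar R :=
  ('N[leb2 R]_(p%:E)[EFin \o (f \_ A)])%E.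

Definition L2 (R : realType) (A : set (plane R)) (f : plane R -> R) : Prop :=
  measurable_fun (A : set (measurableTypeR R * measurableTypeR R)) f /\
  (Lpnorm A 2 f < +oo)%E.

Definition inner (R : realType) (A : set (plane R)) (f g : plane R -> R) : R :=
  \int[leb2 R]_(x in A) (f x * g x).

(** * H(div) *)

Definition partial1 (R : realType) (f : plane R -> R) : plane R -> R :=
  fun x => 'D_((1, 0) : plane R) f x.

Definition partial2 (R : realType) (f : plane R -> R) : plane R -> R :=
  fun x => 'D_((0, 1) : plane R) f x.

Fixpoint Ck (R : realType) (k : nat) (f : plane R -> R) : Prop :=
  continuous f /\
  if k is k'.+1 then
    [/\ forall x, derivable f x (1, 0), forall x, derivable f x (0, 1),
        Ck k' (partial1 f) & Ck k' (partial2 f)]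
  else True.

Definition test_function (R : realType) (A : set (plane R))
    (phi : plane R -> R) : Prop :=
  let supp := closure [set x | phi x != 0] in
  [/\ forall k, Ck k phi, compact supp & supp `<=` A].

Definition weak_div (R : realType) (A : set (plane R))
    (tau : plane R -> plane R) (g : plane R -> R) : Prop :=
  forall phi, test_function A phi ->
    \int[leb2 R]_(x in A) (dot (tau x) (partial1 phi x, partial2 phi x)) =
    - \int[leb2 R]_(x in A) (g x * phi x).

Definition Hdiv (R : realType) (A : set (plane R))
    (tau : plane R -> plane R) : Prop :=
  [/\ L2 A (fun x => (tau x).1), L2 A (fun x => (tau x).2) &
      exists2 g, L2 A g & weak_div A tau g].

(* Meaningful for [tau] in H(div), where the [g] below is unique up to
   almost-everywhere equality on [A]. *)
Definition div (R : realType) (A : set (plane R))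
    (tau : plane R -> plane R) : plane R -> R :=
  get [set g | L2 A g /\ weak_div A tau g].

(** * Finite element spaces *)

(* Elements of H(div) and L^2 have no values on the edges, so the polynomial
   form is imposed on the interiors of the triangles only; imposing it on
   closed triangles would force pointwise continuity across edges. *)
Definition RT0 (R : realType) (A : set (plane R)) (T : seq (triangle R))
    (tau : plane R -> plane R) : Prop :=
  Hdiv A tau /\
  forall K, K \in T -> exists (a : plane R) (b : R),
    forall x, interior (hull K) x -> tau x = a + b *: x.

Definition P0 (R : realType) (A : set (plane R)) (T : seq (triangle R))
    (v : plane R -> R) : Prop :=
  measurable_fun (A : set (measurableTypeR R * measurableTypeR R)) v /\
  forall K, K \in T -> exists c : R,
    forall x, interior (hull K) x -> v x = c.

Definition ae_zero (R : realType) (A : set (plane R))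
    (tau : plane R -> plane R) : Prop :=
  {ae leb2 R, forall x, A x -> tau x = 0}.

(* [fine] is harmless here: both norms are finite for [tau] in RT0. *)
Definition infsup_quotient (R : realType) (A : set (plane R)) (q : R)
    (v : plane R -> R) (tau : plane R -> plane R) : R :=
  inner A (div A tau) v /
  (fine (Lpnorm A q (fun x => enorm (tau x))) + fine (Lpnorm A 2 (div A tau))).

(* Main.v *)
Require Import Defs.
From HB Require Import structures.
From mathcomp Require Import all_boot all_order all_algebra.
From mathcomp Require Import ring lra.
From mathcomp Require Import all_classical all_reals all_analysis.
Import Order.TTheory GRing.Theory Num.Theory.
From mathcomp Require Import measurable_realfun.
Import numFieldNormedType.Exports.
Set Implicit Arguments.
Unset Strict Implicit.
Unset Printing Implicit Defensive.
Local Open Scope classical_set_scope.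
Local Open Scope ring_scope.

(** Write q = p / (p - 1) > 2.  The inequality follows once every piecewise
    constant v is the divergence of some tau in RT0 with
    ||tau||_q <= K ||v||_2 and K independent of the mesh: for this tau the
    quotient is ||v||^2 / (||tau||_q + ||v||) >= ||v|| / (K + 1).

    Such a tau is usually obtained by solving a Poisson problem and
    interpolating its gradient, which needs elliptic regularity.  Here tau is
    given explicitly by its fluxes through the edges.  The field
    (x - y) / (2 pi |x - y|^2) has divergence the Dirac mass at y, and its flux
    through an edge PQ is the angle under which PQ is seen from y, divided by
    2 pi.  Superposing these fields with density v suggests to prescribe the flux
    [flux P Q] = int v(y) a(y) dy, where a(y) is this quotient.  Only
    three properties of a matter: it is antisymmetric in P and Q, the sum over the
    edges of a triangle is 1 for y inside and 0 for y outside, and it is bounded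
    and decays like |Q - P| / |P - y|.  They hold for [subtended], where the
    angle is replaced by a rational function of the direction, with a correction when a
    half-line is crossed ([crossing_sum3], [subtended_le], [subtended_decay]).
    The field of RT0 with these fluxes is [rt_field].

    Divergence.  Green's formula on each triangle ([triangle_flux]) turns the
    integral of tau . grad phi + v phi into a sum over directed edges.  An
    interior edge occurs once in each direction, with opposite fluxes, and a test
    function vanishes on the others, so the sum is zero ([weak_div_rt_field]).  This needs
    the combinatorics of a conforming mesh ([edge_partner], [dir_edges_uniq]) and
    the fact that the open triangles lie in the domain, which is where the
    Lipschitz boundary is used ([interior_closure_lipschitz]).  As the divergence
    of a field is a chosen function, its values are identified through the
    fundamental lemma of the calculus of variations ([du_bois_reymond]).

    Estimate.  For x in a triangle of diameter h the decay of [subtended] gives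
    |flux P Q| <= C h int |v(y)| k(x - y) dy, where the kernel k dominates 1/|x - y|
    up to a factor and is a product of functions of one coordinate ([kernel]).
    Dividing by the height of the triangle, which shape regularity bounds below by
    a multiple of h, one gets |tau(x)| <= C sigma int |v(y)| k(x - y) dy
    ([rt_field_le]).  In the plane this potential maps L^2 of a bounded set into
    L^q for every finite q ([riesz_bound]), because k^b is locally integrable for
    b < 2.  The constant depends on q, on sigma and on a square that contains the
    domain. *)

(** * Measurability and null sets in the plane *)

(** The plane with the measurable structure that [leb2] carries, the product of the
    Borel structures of the line; the one inferred on the bare product is another
    term. *)
Notation mplane R := (measurableTypeR R * measurableTypeR R)%type.

Definition box (R : realType) (a b c d : R) : set (mplane R) :=
  `]a, b[%classic `*` `]c, d[%classic.

Definition cbox (R : realType) (a b c d : R) : set (plane R) :=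
  `[a, b]%classic `*` `[c, d]%classic.

Lemma measurable_box (R : realType) (a b c d : R) : measurable (box a b c d).
Proof. by apply: measurableX; exact: measurable_itv. Qed.

Lemma box_cbox (R : realType) (a b c d : R) : box a b c d `<=` cbox a b c d.
Proof.
move=> x; rewrite /box/cbox/= !in_itv/= => -[/andP[? ?] /andP[? ?]].
by rewrite !ltW.
Qed.

Definition rat_box (R : realType) (q : (rat * rat) * (rat * rat)) : set (mplane R) :=
  box (ratr q.1.1) (ratr q.1.2) (ratr q.2.1) (ratr q.2.2).

Definition rat_cbox (R : realType) (q : (rat * rat) * (rat * rat)) : set (plane R) :=
  cbox (ratr q.1.1) (ratr q.1.2) (ratr q.2.1) (ratr q.2.2).

Arguments rat_box : clear implicits.
Arguments rat_cbox : clear implicits.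

(** A countable base made of boxes whose closures stay in the open set: it gives
    the measurability of open sets, and reduces local statements about almost
    every point to countably many boxes. *)
Lemma open_rat_box (R : realType) (A : set (plane R)) (x : plane R) :
  open A -> A x -> exists q, rat_box R q x /\ rat_cbox R q `<=` A.
Proof.
move=> oA Ax.
have /nbhs_ballP[e /= e0 ballA] : nbhs x A by exact: open_nbhs_nbhs.
have l y : y - e < y by rewrite ltrBlDr ltrDl.
have r y : y < y + e by rewrite ltrDl.
have [q1 q1P] := rat_in_itvoo (l x.1).
have [q2 q2P] := rat_in_itvoo (r x.1).
have [q3 q3P] := rat_in_itvoo (l x.2).
have [q4 q4P] := rat_in_itvoo (r x.2).
move: q1P q2P q3P q4P; rewrite !in_itv/=.
move=> /andP[a1 b1] /andP[a2 b2] /andP[a3 b3] /andP[a4 b4].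
exists ((q1, q2), (q3, q4)); split; first by rewrite /rat_box/box /= !in_itv/= b1 a2 b3 a4.
move=> y; rewrite /rat_cbox/cbox/= !in_itv/= => -[/andP[y1 y2] /andP[y3 y4]].
by apply: ballA; split; rewrite /ball/= ltr_norml; lra.
Qed.

Lemma open_plane_measurable (R : realType) (A : set (plane R)) :
  open A -> measurable (A : set (mplane R)).
Proof.
move=> oA.
rewrite (_ : A = \bigcup_(q in [set q | rat_cbox R q `<=` A]) rat_box R q); last first.
  apply/seteqP; split=> [x Ax|x [q /= qA]]; last by move=> /box_cbox/qA.
  by have [q [qx qA]] := open_rat_box oA Ax; exists q.
rewrite bigcup_mkcond; apply: countable_bigcupT_measurable => // q.
by case: ifPn => // _; exact: measurable_box.
Qed.

Lemma continuous_plane_measurable (R : realType) (f : plane R -> R) :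
  continuous f -> measurable_fun (setT : set (mplane R)) f.
Proof.
move=> cf; apply: (measurability _ (RGenOpens.measurableE R)) => //.
move=> _ [_ [a [b ->]] <-]; rewrite setTI.
by apply: open_plane_measurable; apply: open_comp => //; exact: interval_open.
Qed.

Lemma measurable_swap (R : realType) :
  measurable_fun setT (fun x : mplane R => (x.2, x.1) : mplane R).
Proof.
by apply: measurable_fun_pair; [exact: measurable_snd|exact: measurable_fst].
Qed.

Lemma ge0_integral_swap (R : realType) (f : mplane R -> \bar R) :
  measurable_fun setT f -> (forall x, 0 <= f x)%E ->
  (\int[leb2 R]_x f (x.2, x.1) = \int[leb2 R]_x f x)%E.
Proof.
move=> mf f0; have ms := measurableT_comp mf (@measurable_swap R).
by rewrite fubini_tonelli1// fubini_tonelli2.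
Qed.

Lemma Rintegral_swap (R : realType) (f : mplane R -> R) :
  measurable_fun setT f ->
  \int[leb2 R]_x f (x.2, x.1) = \int[leb2 R]_x f x.
Proof.
move=> /measurable_EFinP mf; rewrite /Rintegral integralE [in RHS]integralE.
congr (fine (_ - _))%E.
- rewrite -[RHS](ge0_integral_swap (measurable_funepos mf))//.
  by apply: eq_integral => x _; rewrite !funeposE.
- rewrite -[RHS](ge0_integral_swap (measurable_funeneg mf))//.
  by apply: eq_integral => x _; rewrite !funenegE.
Qed.

Lemma measurable_linear_plane (R : realType) (a b : R) :
  measurable_fun (setT : set (mplane R)) (fun x => a * x.1 + b * x.2).
Proof.
by apply: measurable_funD; apply: measurable_funM.
Qed.

Lemma measurable_line (R : realType) (a b c : R) :
  measurable [set x : mplane R | a * x.1 + b * x.2 = c].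
Proof.
rewrite -[X in measurable X]setTI.
exact: (measurable_linear_plane a b measurableT (measurable_set1 c)).
Qed.

Lemma measure_integral_indic d (T : measurableType d) (R : realType)
    (mu : {measure set T -> \bar R}) (A : set T) :
  measurable A -> mu A = (\int[mu]_x (\1_A x)%:E)%E.
Proof. by move=> mA; rewrite integral_indic// setIT. Qed.

Lemma line_null (R : realType) (a b c : R) : (a, b) != (0, 0) ->
  leb2 R [set x : mplane R | a * x.1 + b * x.2 = c] = 0%E.
Proof.
have nv a' b' : b' != 0 -> leb2 R [set x : mplane R | a' * x.1 + b' * x.2 = c] = 0%E.
  move=> b0; rewrite /product_measure1 integral0_eq// => x _ /=.
  rewrite (_ : xsection _ _ = [set (c - a' * x) / b']) ?lebesgue_measure_set1//.
  apply/seteqP; split=> y; rewrite /xsection/= inE/=.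
    by move=> <-; rewrite addrAC subrr add0r mulrC mulKf.
  by move=> ->; rewrite mulrCA divff// mulr1 addrC subrK.
have [->|b0 _] := eqVneq b 0; last exact: nv.
rewrite xpair_eqE eqxx andbT => a0.
have mL a' b' := @measurable_line R a' b' c.
rewrite measure_integral_indic// -ge0_integral_swap//; last first.
  by apply/measurable_EFinP.
rewrite -[RHS](nv 0 a a0) measure_integral_indic//; apply: eq_integral => x _ /=.
rewrite !indicE; congr (_ %:R%:E); congr (nat_of_bool _).
by apply/idP/idP; rewrite !inE/= addrC.
Qed.

(** * A rational substitute for the angle subtended by a segment *)

(** Twice the signed area of the triangle with vertices 0, [a] and [b]. *)
Definition crs (R : realType) (a b : plane R) : R := a.1 * b.2 - a.2 * b.1.

Definition l1norm (R : realType) (a : plane R) : R := `|a.1| + `|a.2|.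

(** How often the segment from [a] to [b] crosses the half-line of negative
    abscissas, counted positively when the crossing is counterclockwise.  The
    horizontal axis is attributed to the upper half-plane. *)
Definition crossing (R : realType) (a b : plane R) : R :=
  if [&& 0 <= a.2, b.2 < 0 & 0 < crs a b] then 1 else
  if [&& a.2 < 0, 0 <= b.2 & crs a b < 0] then -1 else 0.

(** Substitute for the argument of [a] divided by 2 pi: it increases from -1/2 to
    1/2 with the direction, with its jump on the half-line of negative
    abscissas. *)
Definition pseudo_angle (R : realType) (a : plane R) : R :=
  (if 0 <= a.2 then 1 else -1) * (1 - a.1 / l1norm a) / 4.

(** The crossing number undoes the jump of the pseudo-angle: the result varies
    continuously as long as the segment from [a] to [b] avoids the origin. *)
Definition subtended (R : realType) (a b : plane R) : R :=
  pseudo_angle b - pseudo_angle a + crossing a b.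

Lemma crsC (R : realType) (a b : plane R) : crs b a = - crs a b.
Proof. by rewrite /crs; ring. Qed.

Lemma crossingC (R : realType) (a b : plane R) : crossing b a = - crossing a b.
Proof.
rewrite /crossing crsC oppr_gt0 oppr_lt0.
by case: (leP 0 a.2); case: (leP 0 b.2); case: (ltP 0 (crs a b)); case: (ltP (crs a b) 0);
  rewrite /= ?opprK ?oppr0 //; lra.
Qed.

Lemma subtendedC (R : realType) (a b : plane R) : subtended b a = - subtended a b.
Proof. by rewrite /subtended crossingC; ring. Qed.

(** The pseudo-angles telescope around a triangle, which leaves a winding
    number. *)
Lemma subtended_sum3 (R : realType) (a b c : plane R) :
  subtended a b + subtended b c + subtended c a =
  crossing a b + crossing b c + crossing c a.
Proof. by rewrite /subtended; ring. Qed.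

(** Winding number around the origin of a counterclockwise triangle: the
    hypothesis on the sum of the signed areas is that orientation. *)
Lemma crossing_sum3 (R : realType) (a b c : plane R) :
  0 < crs a b + crs b c + crs c a ->
  crs a b != 0 -> crs b c != 0 -> crs c a != 0 ->
  crossing a b + crossing b c + crossing c a =
  if [&& 0 < crs a b, 0 < crs b c & 0 < crs c a] then 1 else 0.
Proof.
move=> D0 x0 y0 z0.
have E : crs b c * a.2 + crs c a * b.2 + crs a b * c.2 = 0 by rewrite /crs; ring.
have Z : a.2 = 0 -> b.2 = 0 -> crs a b = 0 by rewrite /crs => -> ->; ring.
rewrite /crossing; move: D0 x0 y0 z0 E Z.
move: (crs a b) (crs b c) (crs c a) (a.2) (b.2) (c.2) => x y z a2 b2 c2.
case: (ltgtP x 0) => // x0; case: (ltgtP y 0) => // y0; case: (ltgtP z 0) => // z0;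
  move=> D0 _ _ _ E Z; case: (leP 0 a2) => a0; case: (leP 0 b2) => b0; case: (leP 0 c2) => c0; rewrite /=;
  try lra; try nra.
Qed.

Lemma l1norm_ge0 (R : realType) (a : plane R) : 0 <= l1norm a.
Proof. by rewrite addr_ge0. Qed.

Lemma pseudo_angle_le (R : realType) (a : plane R) : `|pseudo_angle a| <= 1 / 2.
Proof.
have : `|a.1 / l1norm a| <= 1.
  have [->|N0] := eqVneq (l1norm a) 0; first by rewrite invr0 mulr0 normr0.
  rewrite normrM normfV (ger0_norm (l1norm_ge0 a)) ler_pdivrMr ?mul1r ?lerDl//.
  by rewrite lt_def N0 l1norm_ge0.
rewrite ler_norml => /andP[? ?]; rewrite /pseudo_angle ler_norml.
by case: ifP => _; lra.
Qed.

Lemma subtended_le (R : realType) (a b : plane R) : `|subtended a b| <= 2.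
Proof.
have := pseudo_angle_le a; have := pseudo_angle_le b.
rewrite !ler_norml /subtended /crossing => /andP[? ?] /andP[? ?].
by case: ifP => _; [|case: ifP => _]; lra.
Qed.

(** Off the half-line of negative abscissas the pseudo-angle varies by at most a
    multiple of |b - a| / |a|, and the crossing number compensates its jump there.
    Thanks to the l1-norm every case is piecewise linear after multiplication by
    that norm. *)
Lemma subtended_decay (R : realType) (a b : plane R) :
  l1norm a * `|subtended a b| <= 2 * l1norm (b - a).
Proof.
have [na0|/negPf nb0] := eqVneq (l1norm a) 0.
  by rewrite na0 mul0r mulr_ge0// l1norm_ge0.
have na_gt0 : 0 < l1norm a by rewrite lt_def nb0 l1norm_ge0.
have [nb00|nb1] := eqVneq (l1norm b) 0.
  have b1 : b.1 = 0 by apply/normr0_eq0; have := normr_ge0 b.1; have := normr_ge0 b.2; move: nb00; rewrite /l1norm; lra.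
  have b2 : b.2 = 0 by apply/normr0_eq0; have := normr_ge0 b.1; have := normr_ge0 b.2; move: nb00; rewrite /l1norm; lra.
  have -> : l1norm (b - a) = l1norm a.
    by rewrite /l1norm/= b1 b2 !add0r !normrN.
  by rewrite mulrC ler_wpM2r ?l1norm_ge0// subtended_le.
have nb_gt0 : 0 < l1norm b by rewrite lt_def nb1 l1norm_ge0.
rewrite -[X in X * _](ger0_norm (l1norm_ge0 a)) -normrM.
have [ua ub] : a.1 / l1norm a * l1norm a = a.1 /\ b.1 / l1norm b * l1norm b = b.1.
  by rewrite !divfK// gt_eqF.
rewrite /subtended /pseudo_angle /crossing.
move: ua ub; set u := _ / _; set w := b.1 / _; move=> ua ub.
have D1 : l1norm (b - a) = `|b.1 - a.1| + `|b.2 - a.2| by [].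
move: D1; set D := l1norm (b - a); move=> D1.
have Na : l1norm a = `|a.1| + `|a.2| by [].
have Nb : l1norm b = `|b.1| + `|b.2| by [].
move: D1 Na Nb ua ub na_gt0 nb_gt0; rewrite /crs; clearbody u w D.
move: (l1norm a) (l1norm b) => na nb.
move: a.1 a.2 b.1 b.2 => a1 a2 b1 b2 {a b nb0 nb1} D1 Na Nb ua ub na_gt0 nb_gt0.
have w1 : `|w| <= 1.
  rewrite -(ler_pM2r nb_gt0) mul1r -{1}(ger0_norm (ltW nb_gt0)) -normrM ub Nb.
  by rewrite lerDl.
have D_ge : `|b1 - a1| <= D /\ `|b2 - a2| <= D by split; rewrite D1 ?lerDl ?lerDr.
have nab : `|na - nb| <= D.
  have h1 := ler_dist_dist b1 a1; have h2 := ler_dist_dist b2 a2.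
  rewrite ler_norml in h1; rewrite ler_norml in h2.
  move: h1 h2 => /andP[? ?] /andP[? ?]; rewrite ler_norml Na Nb D1.
  by apply/andP; split; lra.
have : `|na * w| <= na by rewrite normrM (gtr0_norm na_gt0) ger_pMr.
have : `|na * w - b1| <= D.
  rewrite -ub mulrC -mulrBr normrM (le_trans _ nab)//.
  by rewrite ler_piMl.
have -> : na * w = w * na by rewrite mulrC.
move: nab D_ge ua; rewrite mulrC; set e := w * na => nab D_ge ua eb e1.
have key k1 k2 k3 : na * (k1 * (1 - w) / 4 - k2 * (1 - u) / 4 + k3) =
    k1 * (na - e) / 4 - k2 * (na - a1) / 4 + k3 * na.
  by rewrite -ua /e; field.
have D4 s1 s2 : `|s1| <= 1 -> `|s2| <= 1 -> s1 * (b1 - a1) + s2 * (b2 - a2) <= D.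
  move=> s11 s21; rewrite D1 lerD// (le_trans (ler_norm _))// normrM ler_piMl//.
move: D_ge nab eb e1; rewrite !ler_norml => -[/andP[? ?] /andP[? ?]].
move=> /andP[? ?] /andP[? ?] /andP[? ?].
have n1 : `|1 : R| <= 1 by rewrite normr1.
have m1 : `|- 1 : R| <= 1 by rewrite normrN1.
have := D4 _ _ n1 n1; have := D4 _ _ n1 m1; have := D4 _ _ m1 n1; have := D4 _ _ m1 m1.
have sgn (p1 p2 q1 q2 : R) : 0 <= p2 -> q2 < 0 ->
   (p1 < 0 -> q1 < 0 -> 0 < p1 * q2 - p2 * q1) /\
   (0 <= p1 -> 0 <= q1 -> p1 * q2 - p2 * q1 <= 0) by split; nra.
have abs1 (x : R) : (0 <= x /\ `|x| = x) \/ (x < 0 /\ `|x| = - x).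
  by case: (leP 0 x) => h; [left; rewrite ger0_norm|right; rewrite ltr0_norm].
clear D4 n1 m1 D1 w1 ub.
case: (leP 0 a2) => a20; case: (leP 0 b2) => b20 ? ? ? ? /=;
  rewrite ?andbF/=; rewrite ?(ger0_norm a20) ?(ltr0_norm a20) ?(ger0_norm b20) ?(ltr0_norm b20) in Na Nb *.
- by rewrite key; lra.
- have [s1 s2] := sgn a1 _ b1 _ a20 b20.
  by case: (abs1 a1) (abs1 b1) => -[? ea] [] [? eb]; rewrite ?ea ?eb in Na Nb;
    case: ltP => X; rewrite key; lra.
- have [s1 s2] := sgn b1 _ a1 _ b20 a20.
  by case: (abs1 a1) (abs1 b1) => -[? ea] [] [? eb]; rewrite ?ea ?eb in Na Nb;
    case: ltP => X; rewrite key; lra.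
- by rewrite key; lra.
Qed.

(** * Integration over bounded sets of the plane *)

Definition square (R : realType) (N : R) : set (mplane R) := `[- N, N]%classic `*` `[- N, N]%classic.

Lemma measurable_square (R : realType) (N : R) : measurable (square N).
Proof. by apply: measurableX; exact: measurable_itv. Qed.

Lemma square_lty (R : realType) (N : R) : (leb2 R (square N) < +oo)%E.
Proof.
rewrite [X in (X < _)%E]product_measure1E; [|exact: measurable_itv..].
have E : (lebesgue_measure (`[(- N)%R, N]%classic : set R) < +oo)%E.
  by rewrite lebesgue_measure_itv/=; case: ifP => _; rewrite ?ltry.
by apply: lte_mul_pinfty => //; rewrite ge0_fin_numE.
Qed.

Lemma subset_square_lty (R : realType) (N : R) (E : set (mplane R)) :
  measurable E -> E `<=` square N -> (leb2 R E < +oo)%E.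
Proof.
move=> mE EN; rewrite (le_lt_trans _ (square_lty N))// le_measure// inE//.
exact: measurable_square.
Qed.

Lemma bounded_integrable (R : realType) (N M : R) (E : set (mplane R)) (f : plane R -> R) :
  measurable E -> E `<=` square N ->
  measurable_fun E (f : mplane R -> R) -> (forall x, E x -> `|f x| <= M) ->
  (leb2 R).-integrable E (EFin \o f).
Proof.
move=> mE EN mf fM; apply: measurable_bounded_integrable => //.
  exact: subset_square_lty EN.
exists M; split; first exact: num_real.
by move=> m Mm x Ex /=; rewrite (le_trans (fM _ Ex))// ltW.
Qed.

Lemma continuous_square_bounded (R : realType) (N : R) (f : plane R -> R) :
  continuous f -> exists M, forall x, square N x -> `|f x| <= M.
Proof.
move=> cf.
have : compact (f @` square N).
  apply: continuous_compact; first exact: continuous_subspaceT.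
  by apply: compact_setX; exact: segment_compact.
move=> /compact_bounded[M [_ +]] => /(_ (M + 1)).
rewrite ltrDl ltr01 => /(_ isT) fM.
by exists (M + 1) => x Ex; apply: fM; exists x.
Qed.

Lemma continuous_integrable (R : realType) (N : R) (E : set (mplane R)) (f : plane R -> R) :
  measurable E -> E `<=` square N -> continuous f ->
  (leb2 R).-integrable E (EFin \o f).
Proof.
move=> mE EN cf; have [M fM] := continuous_square_bounded N cf.
apply: (@bounded_integrable _ N M) => //; last by move=> x /EN; exact: fM.
apply: measurable_funTS; exact: continuous_plane_measurable.
Qed.

Lemma integral_affine (R : realType) (a b : R) (g : R -> R) :
  a < b -> continuous g ->
  \int[lebesgue_measure]_(x in `[a, b]) g x =
  \int[lebesgue_measure]_(s in `[0, 1]) ((b - a) * g (a + s * (b - a))).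
Proof.
move=> ab cg; pose h (s : R) := a + s * (b - a).
have h0 : h 0 = a by rewrite /h mul0r addr0.
have h1 : h 1 = b by rewrite /h mul1r addrC subrK.
have dh (x : R) : is_derive x (1 : R) h (b - a).
  rewrite /h; apply: is_derive_eq; rewrite /GRing.scale/=; ring.
have h' : (h^`() = cst (b - a))%classic.
  by apply/funext => x; rewrite derive1E (@derive_val _ _ _ _ _ _ _ (dh x)).
have ch : continuous h by move=> x; apply/differentiable_continuous/derivable1_diffP.
rewrite /Rintegral; congr fine.
rewrite -{1}h0 -{1}h1 integration_by_substitution_increasing//.
- by apply: eq_integral => x _ /=; rewrite h' /= fctE/= mulrC.
- by move=> x y _ _ xy; rewrite /h ltrD2l ltr_pM2r// subr_gt0.
- by move=> x _; rewrite h'; exact: cst_continuous.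
- by rewrite h'; exact: is_cvg_cst.
- by rewrite h'; exact: is_cvg_cst.
- split => //.
  + exact: cvg_at_right_filter (ch _).
  + exact: cvg_at_left_filter (ch _).
- exact: continuous_subspaceT.
Qed.

Lemma FTC2_is_derive (R : realType) (G g : R -> R) (a b : R) :
  a <= b -> continuous g -> (forall x, a <= x <= b -> is_derive x (1 : R) G (g x)) ->
  (\int[lebesgue_measure]_(x in `[a, b]) (g x)%:E = (G b - G a)%:E)%E.
Proof.
move=> + cg dG; rewrite le_eqVlt => /predU1P[ab|ab].
  by rewrite ab set_itv1 integral_set1 subrr.
have cG x : a <= x <= b -> {for x, continuous G}.
  by move=> /dG[dGx _]; apply/differentiable_continuous/derivable1_diffP.
have ooP x : x \in `]a, b[ -> a <= x <= b by rewrite in_itv/= => /andP[/ltW -> /ltW ->].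
rewrite (@continuous_FTC2 _ g G)//.
- exact: continuous_subspaceT.
- split.
  + by move=> x /ooP/dG[].
  + by apply: cvg_at_right_filter (cG _ _); rewrite lexx ltW.
  + by apply: cvg_at_left_filter (cG _ _); rewrite lexx ltW.
- by move=> x /ooP/dG d; rewrite derive1E (@derive_val _ _ _ _ _ _ _ d).
Qed.

Lemma FTC2_is_derive_oo (R : realType) (G g : R -> R) (a b : R) :
  a <= b -> continuous g -> (forall x, a <= x <= b -> is_derive x (1 : R) G (g x)) ->
  (\int[lebesgue_measure]_(x in `]a, b[) (g x)%:E = (G b - G a)%:E)%E.
Proof.
move=> ab cg dG; rewrite -(FTC2_is_derive ab cg dG).
have mg (A : set R) : measurable A -> measurable_fun A (EFin \o g).
  by move=> mA; apply/measurable_EFinP; apply: measurable_funTS; exact: continuous_measurable_fun.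
rewrite (@integral_itv_bndo_bndc _ _ _ (EFin \o g)) ?(@integral_itv_obnd_cbnd _ _ _ (EFin \o g))//;
  exact: mg.
Qed.

Lemma measurable_gt0_plane (R : realType) (g : plane R -> R) :
  continuous g -> measurable [set y : mplane R | 0 < g y].
Proof.
move=> cg; apply: open_plane_measurable.
by apply: (@open_comp _ _ g [set z | 0 < z]) => //; exact: open_gt.
Qed.

Lemma measurable_ge0_plane (R : realType) (g : plane R -> R) :
  continuous g -> measurable [set y : mplane R | 0 <= g y].
Proof.
move=> cg; rewrite (_ : mkset _ = ~` [set y | 0 < - g y]).
  apply: measurableC; apply: measurable_gt0_plane => y; exact/continuousN/cg.
apply/seteqP; split => y /=; rewrite oppr_gt0; last by move/negP; rewrite -leNgt.
by move=> gy; apply/negP; rewrite -leNgt.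
Qed.

Lemma crs_subE (R : realType) (P Q y : plane R) :
  crs (P - y) (Q - y) = crs P Q + (y.2 * (Q.1 - P.1) - y.1 * (Q.2 - P.2)).
Proof. by rewrite /crs/=; ring. Qed.

Lemma continuous_coord1 (R : realType) : continuous (fun y : plane R => y.1).
Proof. by move=> y; exact: cvg_fst. Qed.

Lemma continuous_coord2 (R : realType) : continuous (fun y : plane R => y.2).
Proof. by move=> y; exact: cvg_snd. Qed.

Lemma continuous_crs_sub (R : realType) (P Q : plane R) :
  continuous (fun y : plane R => crs (P - y) (Q - y)).
Proof.
rewrite (_ : (fun _ => _) =
  (fun y : plane R => crs P Q + (y.2 * (Q.1 - P.1) - y.1 * (Q.2 - P.2)))); last first.
  by apply/funext => y; exact: crs_subE.
move=> y; apply: cvgD; first exact: cvg_cst.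
by apply: cvgB; apply: cvgM; try exact: cvg_cst; [exact: cvg_snd|exact: cvg_fst].
Qed.

Definition edge_mean (R : realType) (F : plane R -> R) (P Q : plane R) : R :=
  \int[lebesgue_measure]_(s in `[0, 1]) F (P + s *: (Q - P)).

Lemma continuous_edge (R : realType) (F : plane R -> R) (P Q : plane R) :
  continuous F -> continuous (fun s : R => F (P + s *: (Q - P))).
Proof.
move=> cF s; apply: (@continuous_comp _ _ _ (fun s : R => P + s *: (Q - P)) F); last exact: cF.
apply: continuousD; first exact: cst_continuous.
by apply: continuousZl => //; exact: cvg_id.
Qed.

Lemma edge_meanC (R : realType) (F : plane R -> R) (P Q : plane R) :
  continuous F -> edge_mean F Q P = edge_mean F P Q.
Proof.
move=> cF; rewrite /edge_mean [RHS]Rintegration_by_substitution_onem ?lexx ?ler01//; last first.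
  by apply: continuous_subspaceT; exact: continuous_edge.
rewrite /unstable.onem subrr; apply: eq_Rintegral => s _; congr F.
by rewrite scalerBl scale1r addrA addrCA subrr addr0 -scalerN opprB.
Qed.

(** * Green's formula on a triangle *)

Lemma continuous_pair (R : realType) (f g : R -> R) :
  continuous f -> continuous g -> continuous (fun s => (f s, g s) : plane R).
Proof. by move=> cf cg s; apply: (cvg_pair (cf s) (cg s)). Qed.

Lemma integrable_edge (R : realType) (F : plane R -> R) (P Q : plane R) :
  continuous F ->
  (@lebesgue_measure R).-integrable `[0, 1] (EFin \o (fun s => F (P + s *: (Q - P)))).
Proof.
move=> cF; apply: continuous_compact_integrable; first exact: segment_compact.
by apply: continuous_subspaceT; exact: continuous_edge.
Qed.

(** Points to the right of the edge, up to the abscissa [M]; it is empty unless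
    the edge goes downwards.  A half-open range of ordinates is taken so that
    the regions of consecutive edges match the convention of [crossing]. *)
Definition right_region (R : realType) (M : R) (P Q : plane R) : set (mplane R) :=
  [set y | [/\ Q.2 < y.2, y.2 <= P.2, 0 < crs (P - y) (Q - y) & y.1 < M]].

Lemma measurable_right_region (R : realType) (M : R) (P Q : plane R) :
  measurable (right_region M P Q).
Proof.
rewrite (_ : right_region M P Q =
    [set y | 0 < y.2 - Q.2] `&` [set y | 0 <= P.2 - y.2] `&`
    [set y | 0 < crs (P - y) (Q - y)] `&` [set y | 0 < M - y.1]); last first.
  apply/seteqP; split => y; rewrite /right_region/= !subr_gt0 subr_ge0.
    by move=> [].
  by move=> [[[]]].
apply: measurableI; [apply: measurableI; [apply: measurableI|]|].
- apply: (@measurable_gt0_plane _ (fun y : plane R => y.2 - Q.2)) => y.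
  by apply: cvgB; [exact: cvg_snd|exact: cvg_cst].
- apply: (@measurable_ge0_plane _ (fun y : plane R => P.2 - y.2)) => y.
  by apply: cvgB; [exact: cvg_cst|exact: cvg_snd].
- apply: measurable_gt0_plane; exact: continuous_crs_sub.
- apply: (@measurable_gt0_plane _ (fun y : plane R => M - y.1)) => y.
  by apply: cvgB; [exact: cvg_cst|exact: cvg_fst].
Qed.

Lemma right_region_bounded (R : realType) (M : R) (P Q : plane R) :
  right_region M P Q `<=` square (`|M| + l1norm P + l1norm Q).
Proof.
move=> y [Qy yP ]; rewrite /crs/= /square/= !in_itv/= /l1norm => cy yM.
have absle (x : R) : [/\ x <= `|x|, - x <= `|x| & 0 <= `|x|].
  by rewrite ler_norm normr_ge0 -normrN ler_norm.
have [] := absle M; have [] := absle P.1; have [] := absle P.2.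
have [] := absle Q.1; have [] := absle Q.2.
have : P.1 < y.1 \/ Q.1 < y.1.
  case: (ltP P.1 y.1) => h1; first by left.
  case: (ltP Q.1 y.1) => h2; first by right.
  by exfalso; nra.
by move=> [] *; split; apply/andP; split; lra.
Qed.

(** Integrate first along horizontal segments from the edge to the vertical line
    of abscissa [M], where [F] vanishes: only the value on the edge remains. *)
Lemma edge_integral (R : realType) (F dF : plane R -> R) (M : R) (P Q : plane R) :
  Q.2 < P.2 -> P.1 <= M -> Q.1 <= M -> continuous F -> continuous dF ->
  (forall x, is_derive x.1 (1 : R) (fun s => F (s, x.2)) (dF x)) ->
  (forall s, F (M, s) = 0) ->
  \int[leb2 R]_(y in right_region M P Q) dF y = (Q.2 - P.2) * edge_mean F P Q.
Proof.
move=> QP PM QM cF cdF dF1 FM.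
have mE := measurable_right_region M P Q.
have iE : (leb2 R).-integrable (right_region M P Q) (EFin \o dF).
  by apply: continuous_integrable => //; exact: right_region_bounded.
pose xe (s : R) : R := Q.1 + (s - Q.2) / (P.2 - Q.2) * (P.1 - Q.1).
have d0 : 0 < P.2 - Q.2 by rewrite subr_gt0.
have cxe : continuous xe.
  move=> s; apply: cvgD; first exact: cvg_cst.
  apply: cvgM; last exact: cvg_cst.
  apply: cvgM; last exact: cvg_cst.
  by apply: cvgB; [exact: cvg_id|exact: cvg_cst].
have inner (s : R) : fubini_G lebesgue_measure ((EFin \o dF) \_ (right_region M P Q)) s =
   ((EFin \o (fun s => - F (xe s, s))) \_ `]Q.2, P.2]%classic) s.
  rewrite /fubini_G patchE; case: ifPn => sQP; last first.
    apply: integral0_eq => r _; rewrite patchE ifN//; apply: contra sQP.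
    by rewrite !inE/= in_itv/= => -[/= -> ->].
  move: sQP; rewrite inE/= in_itv/= => /andP[Qs sP].
  have xeM : xe s <= M.
    have h0 : 0 <= (s - Q.2) / (P.2 - Q.2) by rewrite divr_ge0 ?subr_ge0// ltW.
    have h1 : (s - Q.2) / (P.2 - Q.2) <= 1 by rewrite ler_pdivrMr// mul1r lerD2r.
    by rewrite /xe; move: h0 h1; set k := _ / _; nra.
  transitivity (\int[lebesgue_measure]_(r in `]xe s, M[) (dF (r, s))%:E)%E.
    rewrite [RHS]integral_mkcond; apply: eq_integral => r _.
    rewrite !patchE; congr (if _ then _ else _); apply/idP/idP.
      rewrite !inE/= in_itv/= => -[/= _ _ ce ->]; rewrite andbT.
      move: ce; rewrite /crs/= /xe => ce.
      rewrite -subr_gt0 -(pmulr_lgt0 _ d0).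
      rewrite [X in 0 < X](_ : _ = (P.1 - r) * (Q.2 - s) - (P.2 - s) * (Q.1 - r))//.
      by field; rewrite gt_eqF.
    rewrite !inE/= in_itv/= => /andP[ce rM]; split => //=.
    move: ce; rewrite /crs/= /xe -subr_gt0 -(pmulr_lgt0 _ d0).
    rewrite [X in 0 < X](_ : _ = (P.1 - r) * (Q.2 - s) - (P.2 - s) * (Q.1 - r))//.
    by field; rewrite gt_eqF.
  have d1 (r : R) : is_derive r (1 : R) (fun r => F (r, s)) (dF (r, s)) := dF1 (r, s).
  rewrite (FTC2_is_derive_oo xeM _ (fun r _ => d1 r)).
  - by rewrite FM sub0r.
  - move=> r; apply: (@continuous_comp _ _ _ (fun r : R => (r, s)) dF); last exact: cdF.
    by apply: continuous_pair => [x|x]; [exact: cvg_id|exact: cvg_cst].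
have cG : continuous (fun s => - F (xe s, s)).
  move=> s; apply: cvgN; apply: (@continuous_comp _ _ _ (fun s : R => (xe s, s)) F); last exact: cF.
  by apply: continuous_pair => // x; exact: cvg_id.
rewrite {1}/Rintegral integral_mkcond -integral21_prod_meas1; last first.
  by rewrite -integrable_mkcond.
under eq_integral do rewrite inner.
rewrite -integral_mkcond integral_itv_obnd_cbnd; last first.
  by apply/measurable_EFinP; apply: measurable_funTS; exact: continuous_measurable_fun.
rewrite -/(Rintegral _ _ _) integral_affine//.
rewrite -edge_meanC// /edge_mean -RintegralZl//; last first.
  apply: continuous_compact_integrable; first exact: segment_compact.
  by apply: continuous_subspaceT; exact: continuous_edge.
apply: eq_Rintegral => t _; rewrite mulrN -mulNr opprB; congr (_ * F _).
by rewrite /xe addrAC subrr add0r mulfK ?gt_eqF.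
Qed.

(** Taking both directions of the edge removes the assumption that it goes
    downwards. *)
Lemma signed_edge_integral (R : realType) (F dF : plane R -> R) (M : R) (P Q : plane R) :
  P.1 <= M -> Q.1 <= M -> continuous F -> continuous dF ->
  (forall x, is_derive x.1 (1 : R) (fun s => F (s, x.2)) (dF x)) ->
  (forall s, F (M, s) = 0) ->
  \int[leb2 R]_y (dF y * (\1_(right_region M P Q) y - \1_(right_region M Q P) y)) =
  (Q.2 - P.2) * edge_mean F P Q.
Proof.
move=> PM QM cF cdF dF1 FM.
have iE P' Q' : (leb2 R).-integrable setT (EFin \o (dF \_ (right_region M P' Q'))).
  rewrite -restrict_EFin -integrable_mkcond; last exact: measurable_right_region.
  apply: continuous_integrable => //; last exact: right_region_bounded.
  exact: measurable_right_region.
transitivity (\int[leb2 R]_(y in right_region M P Q) dF y -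
              \int[leb2 R]_(y in right_region M Q P) dF y).
  rewrite !(@Rintegral_mkcond _ _ _ (leb2 R) (right_region _ _ _)) -RintegralB//.
  apply: eq_Rintegral => y _; rewrite /patch !indicE.
  have -> : (point : R) = 0 by [].
  by case: (y \in _); case: (y \in _); rewrite /=; ring.
have empty P' Q' : P'.2 <= Q'.2 -> \int[leb2 R]_(y in right_region M P' Q') dF y = 0.
  move=> PQ; rewrite (_ : right_region _ _ _ = set0) ?Rintegral_set0//.
  by apply/seteqP; split => // y [Qy yP]; move: (lt_le_trans Qy yP); rewrite ltNge PQ.
case: (ltgtP P.2 Q.2) => PQ.
- by rewrite empty ?ltW// (edge_integral PQ)// edge_meanC//; ring.
- by rewrite (empty Q P) ?ltW// (edge_integral PQ)// subr0.
- by rewrite !empty ?PQ//; ring.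
Qed.

Lemma mem_right_region (R : realType) (M : R) (P Q y : plane R) : y.1 < M ->
  (y \in right_region M P Q) =
  [&& 0 <= (P - y).2, (Q - y).2 < 0 & 0 < crs (P - y) (Q - y)].
Proof.
move=> yM; rewrite /= subr_ge0 subr_lt0; apply/idP/and3P => [|[h1 h2 h3]].
  by rewrite inE => -[].
by rewrite inE.
Qed.

(** A point lies to the right of the edge when the half-line to its left crosses
    the edge. *)
Lemma right_region_crossing (R : realType) (M : R) (P Q y : plane R) : y.1 < M ->
  \1_(right_region M P Q) y - \1_(right_region M Q P) y = crossing (P - y) (Q - y).
Proof.
move=> yM; rewrite /crossing !indicE !mem_right_region// [crs (Q - y) _]crsC oppr_gt0.
move: (P - y) (Q - y) => a b.
by case: (leP 0 a.2); case: (leP 0 b.2); case: (ltP 0 (crs a b)); case: (ltP (crs a b) 0);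
  rewrite /= ?subr0 ?sub0r ?subrr.
Qed.

Lemma crs_neq0_ae (R : realType) (P Q : plane R) : P != Q ->
  {ae leb2 R, forall y, crs (P - y) (Q - y) != 0}.
Proof.
move=> PQ; exists [set y : mplane R | (Q.2 - P.2) * y.1 + (P.1 - Q.1) * y.2 = crs P Q].
split; first exact: measurable_line.
  apply: line_null; apply: contra PQ; rewrite xpair_eqE !subr_eq0 => /andP[/eqP e1 /eqP e2].
  by apply/eqP; rewrite [P]surjective_pairing [Q]surjective_pairing e1 e2.
move=> y /= /negP; rewrite negbK => /eqP; rewrite crs_subE; lra.
Qed.

Definition open_triangle (R : realType) (P Q W : plane R) : set (mplane R) :=
  [set y | [/\ 0 < crs (P - y) (Q - y), 0 < crs (Q - y) (W - y) & 0 < crs (W - y) (P - y)]].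

Lemma crs_sum3 (R : realType) (P Q W y : plane R) :
  crs (P - y) (Q - y) + crs (Q - y) (W - y) + crs (W - y) (P - y) = crs (Q - P) (W - P).
Proof. by rewrite /crs/=; ring. Qed.

Lemma open_triangle_lt (R : realType) (M : R) (P Q W y : plane R) :
  P.1 <= M -> Q.1 <= M -> W.1 <= M -> open_triangle P Q W y -> y.1 < M.
Proof.
move=> PM QM WM [c1 c2 c3]; rewrite ltNge; apply/negP => My.
have E : crs (Q - y) (W - y) * (P.1 - y.1) + crs (W - y) (P - y) * (Q.1 - y.1)
       + crs (P - y) (Q - y) * (W.1 - y.1) = 0 by rewrite /crs/=; ring.
have h c z : 0 < c -> z <= M -> c * (z - y.1) <= 0.
  by move=> c0 zM; rewrite pmulr_rle0// subr_le0 (le_trans zM).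
have := h _ _ c2 PM; have := h _ _ c3 QM; have := h _ _ c1 WM => h1 h2 h3.
have /eqP : crs (Q - y) (W - y) * (P.1 - y.1) = 0 by lra.
have /eqP : crs (W - y) (P - y) * (Q.1 - y.1) = 0 by lra.
rewrite !mulf_eq0 (gt_eqF c2) (gt_eqF c3)/= => /eqP Q0 /eqP P0.
by move: c1; rewrite /crs/= P0 Q0 mul0r mulr0 subrr ltxx.
Qed.

Lemma measurable_open_triangle (R : realType) (P Q W : plane R) :
  measurable (open_triangle P Q W).
Proof.
rewrite (_ : open_triangle P Q W = [set y | 0 < crs (P - y) (Q - y)] `&`
    [set y | 0 < crs (Q - y) (W - y)] `&` [set y | 0 < crs (W - y) (P - y)]); last first.
  by apply/seteqP; split => y; [move=> []|move=> [[]]].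
by apply: measurableI; [apply: measurableI|];
  apply: measurable_gt0_plane; exact: continuous_crs_sub.
Qed.

(** Since the signed regions to the right of the three edges add up to the winding
    number, that is, to the indicator function of the triangle, the formula is the
    sum of three edge integrals. *)
Lemma triangle_divergence1 (R : realType) (F dF : plane R -> R) (M : R) (P Q W : plane R) :
  0 < crs (Q - P) (W - P) ->
  P.1 <= M -> Q.1 <= M -> W.1 <= M -> continuous F -> continuous dF ->
  (forall x, is_derive x.1 (1 : R) (fun s => F (s, x.2)) (dF x)) ->
  (forall s, F (M, s) = 0) ->
  \int[leb2 R]_(y in open_triangle P Q W) dF y =
  (Q.2 - P.2) * edge_mean F P Q + (W.2 - Q.2) * edge_mean F Q W
    + (P.2 - W.2) * edge_mean F W P.
Proof.
move=> D0 PM QM WM cF cdF dF1 FM.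
pose H P Q y := dF y * (\1_(right_region M P Q) y - \1_(right_region M Q P) y).
have iE P' Q' : (leb2 R).-integrable setT (EFin \o (H P' Q')).
  pose N := `|M| + l1norm P' + l1norm Q'.
  have mE P1 Q1 := measurable_right_region M P1 Q1.
  have sub : right_region M P' Q' `|` right_region M Q' P' `<=` square N.
    rewrite subUset; split; first exact: right_region_bounded.
    by rewrite /N addrAC; exact: right_region_bounded.
  have -> : EFin \o H P' Q' = (EFin \o H P' Q') \_ (right_region M P' Q' `|` right_region M Q' P').
    apply/funext => y; rewrite patchE; case: ifPn => //; rewrite notin_setE/= => /not_orP[n1 n2].
    by rewrite /H !indicE !memNset// subrr mulr0.
  rewrite -integrable_mkcond; last exact: measurableU.
  have [K HK] := continuous_square_bounded N cdF.
  apply: (@bounded_integrable _ N K) => //; first exact: measurableU.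
    apply: measurable_funTS; apply: measurable_funM; first exact: continuous_plane_measurable.
    by apply: measurable_funB; apply: measurable_indic.
  move=> y /sub yN; rewrite /H normrM (le_trans _ (HK _ yN))// ler_piMr//.
  by rewrite !indicE; do 2 case: (_ \in _); rewrite /= ?subrr ?subr0 ?sub0r ?normrN ?normr1 ?normr0.
have sE P' Q' : P'.1 <= M -> Q'.1 <= M ->
    \int[leb2 R]_y H P' Q' y = (Q'.2 - P'.2) * edge_mean F P' Q'.
  by move=> *; exact: signed_edge_integral.
rewrite -(sE P Q)// -(sE Q W)// -(sE W P)//.
rewrite -RintegralD// -RintegralD//; last exact: (integrableD measurableT (iE P Q) (iE Q W)).
rewrite Rintegral_mkcond /Rintegral; congr fine; apply: ae_eq_integral => //.
- apply/measurable_EFinP.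
  rewrite -measurable_restrictT; last exact: measurable_open_triangle.
  by apply: measurable_funTS; exact: continuous_plane_measurable.
- apply/measurable_EFinP.
  have mH P' Q' : measurable_fun setT (H P' Q' : mplane R -> R).
    by have /measurable_int/measurable_EFinP := iE P' Q'.
  exact: (measurable_funD (measurable_funD (mH P Q) (mH Q W)) (mH W P)).
have PQ : P != Q by apply: contraTN D0 => /eqP ->; rewrite subrr /crs/= !mul0r subrr ltxx.
have WP : W != P by apply: contraTN D0 => /eqP ->; rewrite subrr /crs/= !mulr0 subrr ltxx.
have QW : Q != W by apply: contraTN D0 => /eqP ->; rewrite /crs/= mulrC subrr ltxx.
move: (crs_neq0_ae PQ) (crs_neq0_ae QW) (crs_neq0_ae WP).
apply: (@filterS3 _ _ (ae_filter_ringOfSetsType (leb2 R))) => y c1 c2 c3 _; congr EFin.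
have [yM|My] := ltP y.1 M; last first.
  rewrite patchE memNset; last first.
    by move=> /(open_triangle_lt PM QM WM); rewrite ltNge My.
  have nr P' Q' : y \in right_region M P' Q' = false.
    by apply: memNset => -[_ _ _]; rewrite ltNge My.
  by rewrite /H !indicE !nr subrr !mulr0 !addr0.
rewrite /H !right_region_crossing// -!mulrDr crossing_sum3 ?crs_sum3//.
rewrite patchE; case: ifPn => yT.
  by move: yT; rewrite inE => -[-> -> ->]; rewrite mulr1.
case: ifP => //; last by rewrite mulr0.
by move=> /and3P[? ? ?]; move/negP: yT; case; rewrite inE.
Qed.

Definition swap (R : realType) (x : plane R) : plane R := (x.2, x.1).

Lemma edge_mean_swap (R : realType) (F : plane R -> R) (P Q : plane R) :
  edge_mean (F \o @swap R) (swap P) (swap Q) = edge_mean F P Q.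
Proof. by []. Qed.

Lemma continuous_swap (R : realType) : continuous (@swap R).
Proof. by move=> x; exact: (cvg_pair (@continuous_coord2 R x) (@continuous_coord1 R x)). Qed.

Lemma open_triangle_swap (R : realType) (P Q W y : plane R) :
  open_triangle (swap P) (swap W) (swap Q) (swap y) <-> open_triangle P Q W y.
Proof.
have E a b : crs (swap a - swap y) (swap b - swap y) = crs (b - y) (a - y).
  by rewrite /crs/=; ring.
by rewrite /open_triangle/= !E; split => -[].
Qed.

(** Obtained from the other coordinate by the reflection [swap], which reverses the
    orientation of triangles. *)
Lemma triangle_divergence2 (R : realType) (F dF : plane R -> R) (M : R) (P Q W : plane R) :
  0 < crs (Q - P) (W - P) ->
  P.2 <= M -> Q.2 <= M -> W.2 <= M -> continuous F -> continuous dF ->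
  (forall x, is_derive x.2 (1 : R) (fun s => F (x.1, s)) (dF x)) ->
  (forall s, F (s, M) = 0) ->
  \int[leb2 R]_(y in open_triangle P Q W) dF y =
  - ((Q.1 - P.1) * edge_mean F P Q + (W.1 - Q.1) * edge_mean F Q W
    + (P.1 - W.1) * edge_mean F W P).
Proof.
move=> D0 PM QM WM cF cdF dF2 FM.
have csw (G : plane R -> R) : continuous G -> continuous (G \o @swap R).
  by move=> cG x; apply: continuous_comp; [exact: continuous_swap|exact: cG].
have := @triangle_divergence1 R (F \o @swap R) (dF \o @swap R) M (swap P) (swap W) (swap Q).
have -> : crs (swap W - swap P) (swap Q - swap P) = crs (Q - P) (W - P).
  by rewrite /crs/=; ring.
move=> /(_ D0 PM WM QM (csw _ cF) (csw _ cdF)).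
move=> /(_ (fun x => dF2 (x.2, x.1))) => /(_ FM) E.
rewrite Rintegral_mkcond -Rintegral_swap; last first.
  rewrite -measurable_restrictT; last exact: measurable_open_triangle.
  by apply: measurable_funTS; exact: continuous_plane_measurable.
transitivity (\int[leb2 R]_(y in open_triangle (swap P) (swap W) (swap Q)) (dF \o @swap R) y).
  rewrite [RHS]Rintegral_mkcond; apply: eq_Rintegral => y _; rewrite !patchE.
  congr (if _ then _ else _); apply/idP/idP; rewrite !inE => /open_triangle_swap//.
rewrite E !edge_mean_swap (edge_meanC P W)// (edge_meanC W Q)// (edge_meanC Q P)//.
by rewrite /swap/=; ring.
Qed.

Lemma edge_mean_affine (R : realType) (c : R) (P Q : plane R) :
  edge_mean (fun x => x.1 - c) P Q = (P.1 + Q.1) / 2 - c.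
Proof.
have cF : continuous (fun x : plane R => x.1 - c).
  by move=> x; apply: cvgB; [exact: cvg_fst|exact: cvg_cst].
have iF P' Q' := integrable_edge P' Q' cF.
have : edge_mean (fun x => x.1 - c) P Q + edge_mean (fun x => x.1 - c) Q P = P.1 + Q.1 - 2 * c.
  rewrite /edge_mean -RintegralD//.
  under eq_Rintegral.
    move=> s _; rewrite (_ : _ + _ = P.1 + Q.1 - 2 * c); last by rewrite /=/GRing.scale/=; ring.
    over.
  rewrite Rintegral_cst//= lebesgue_measure_itv/= lte_fin ltr01 /= subr0 mulr1//.
rewrite edge_meanC//; lra.
Qed.

(** Divergence formula for [x.1 - M], whose derivative is 1. *)
Lemma open_triangle_area (R : realType) (P Q W : plane R) :
  0 < crs (Q - P) (W - P) ->
  fine (leb2 R (open_triangle P Q W)) = crs (Q - P) (W - P) / 2.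
Proof.
move=> D0; pose M := Num.max P.1 (Num.max Q.1 W.1).
have cF : continuous (fun x : plane R => x.1 - M).
  by move=> x; apply: cvgB; [exact: cvg_fst|exact: cvg_cst].
have dF (x : plane R) : is_derive x.1 (1 : R) (fun s => (s, x.2).1 - M) (cst 1 x).
  by apply: is_derive_eq; rewrite subr0.
have FM (s : R) : (M, s).1 - M = 0 by rewrite /= subrr.
have := @triangle_divergence1 R (fun x => x.1 - M) (cst 1) M P Q W D0.
rewrite !le_max !lexx !orbT => /(_ isT isT isT cF (@cst_continuous _ _ _) dF FM).
rewrite Rintegral_cst ?mul1r; last exact: measurable_open_triangle.
by move=> ->; rewrite !edge_mean_affine /crs/=; field.
Qed.

Lemma is_derive_partial1 (R : realType) (f : plane R -> R) (x : plane R) :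
  derivable f x (1, 0) ->
  is_derive x.1 (1 : R) (fun s => f (s, x.2)) (partial1 f x).
Proof.
have E : (fun h : R => h^-1 *: (((fun s => f (s, x.2)) \o shift x.1) (h *: (1 : R)) - f x)) =
    (fun h : R => h^-1 *: ((f \o shift x) (h *: ((1, 0) : plane R)) - f x)).
  apply/funext => h /=; congr (_ *: (f _ - _)); rewrite /shift/=.
  by rewrite [in RHS](surjective_pairing x)/=; congr pair; rewrite /= scaler0 add0r.
case: x E => x1 x2 /= E dx; split; first by rewrite /derivable E.
by rewrite /partial1 /derive -E.
Qed.

Lemma is_derive_partial2 (R : realType) (f : plane R -> R) (x : plane R) :
  derivable f x (0, 1) ->
  is_derive x.2 (1 : R) (fun s => f (x.1, s)) (partial2 f x).
Proof.
have E : (fun h : R => h^-1 *: (((fun s => f (x.1, s)) \o shift x.2) (h *: (1 : R)) - f x)) =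
    (fun h : R => h^-1 *: ((f \o shift x) (h *: ((0, 1) : plane R)) - f x)).
  apply/funext => h /=; congr (_ *: (f _ - _)); rewrite /shift/=.
  by rewrite [in RHS](surjective_pairing x)/=; congr pair; rewrite /= scaler0 add0r.
case: x E => x1 x2 /= E dx; split; first by rewrite /derivable E.
by rewrite /partial2 /derive -E.
Qed.

(** The part of compact support that the divergence formulas use: they integrate
    along half-lines towards the right and upwards, so the function has to vanish
    on the corresponding sides of the square. *)
Record compact_C1 (R : realType) (N : R) (phi : plane R -> R) : Prop := {
  cC1_cont : continuous phi ;
  cC1_der1 : forall x, derivable phi x (1, 0) ;
  cC1_der2 : forall x, derivable phi x (0, 1) ;
  cC1_cont1 : continuous (partial1 phi) ;
  cC1_cont2 : continuous (partial2 phi) ;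
  cC1_right : forall s, phi (N, s) = 0 ;
  cC1_top : forall s, phi (s, N) = 0 }.

Lemma open_triangle_square (R : realType) (N : R) (P Q W : plane R) :
  square N P -> square N Q -> square N W -> open_triangle P Q W `<=` square N.
Proof.
move=> [/= +  +] [/= + +] [/= + +] y yT; rewrite !in_itv/=.
move=> /andP[p1 p2] /andP[p3 p4] /andP[q1 q2] /andP[q3 q4] /andP[w1 w2] /andP[w3 w4].
have yT' := (open_triangle_swap _ _ _ _).2 yT.
have opp (P' Q' W' y' : plane R) : open_triangle P' Q' W' y' -> open_triangle (- P') (- Q') (- W') (- y').
  have E a c : crs (- a - - y') (- c - - y') = crs (a - y') (c - y') by rewrite /crs/=; ring.
  by rewrite /open_triangle/= !E.
have r1 := ltW (open_triangle_lt p2 q2 w2 yT).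
have /ltW r2 := @open_triangle_lt R N (swap P) (swap W) (swap Q) _ p4 w4 q4 yT'.
have Nl z : - N <= z -> - z <= N by rewrite lerNl.
have /ltW l1 := @open_triangle_lt R N (- P) (- Q) (- W) _ (Nl _ p1) (Nl _ q1) (Nl _ w1) (opp _ _ _ _ yT).
have /ltW l2 := @open_triangle_lt R N (- swap P) (- swap W) (- swap Q) _ (Nl _ p3) (Nl _ w3) (Nl _ q3) (opp _ _ _ _ yT').
split; rewrite /= in_itv/= ?r1 ?r2 andbT lerNl.
  exact: l1.
exact: l2.
Qed.

(** Divergence theorem for [phi] times the affine field: [crs (tau P) (Q - P)] is
    the outward flux density of that field times the length of the edge, and it
    is constant along the edge, as [crs (b *: (Q - P)) (Q - P) = 0]. *)
Lemma triangle_flux (R : realType) (N : R) (phi : plane R -> R) (a : plane R) (b : R)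
    (P Q W : plane R) :
  compact_C1 N phi -> 0 < crs (Q - P) (W - P) ->
  square N P -> square N Q -> square N W ->
  \int[leb2 R]_(y in open_triangle P Q W)
     (dot (a + b *: y) (partial1 phi y, partial2 phi y) + 2 * b * phi y) =
  crs (a + b *: P) (Q - P) * edge_mean phi P Q +
  crs (a + b *: Q) (W - Q) * edge_mean phi Q W +
  crs (a + b *: W) (P - W) * edge_mean phi W P.
Proof.
move=> [cphi d1 d2 c1 c2 pN1 pN2] D0 PN QN WN.
have mT := measurable_open_triangle P Q W.
have TN := open_triangle_square PN QN WN.
move: PN QN WN => [/itvP PN1 /itvP PN2] [/itvP QN1 /itvP QN2] [/itvP WN1 /itvP WN2].
pose F1 (y : plane R) := (a.1 + b * y.1) * phi y.
pose F2 (y : plane R) := (a.2 + b * y.2) * phi y.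
pose dF1 (y : plane R) := b * phi y + (a.1 + b * y.1) * partial1 phi y.
pose dF2 (y : plane R) := b * phi y + (a.2 + b * y.2) * partial2 phi y.
have ca1 : continuous (fun y : plane R => a.1 + b * y.1).
  by move=> y; apply: cvgD; [exact: cvg_cst|apply: cvgM; [exact: cvg_cst|exact: cvg_fst]].
have ca2 : continuous (fun y : plane R => a.2 + b * y.2).
  by move=> y; apply: cvgD; [exact: cvg_cst|apply: cvgM; [exact: cvg_cst|exact: cvg_snd]].
have cF1 : continuous F1 by move=> y; apply: cvgM; [exact: ca1|exact: cphi].
have cF2 : continuous F2 by move=> y; apply: cvgM; [exact: ca2|exact: cphi].
have cdF1 : continuous dF1.
  move=> y; apply: cvgD; last by apply: cvgM; [exact: ca1|exact: c1].
  by apply: cvgM; [exact: cvg_cst|exact: cphi].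
have cdF2 : continuous dF2.
  move=> y; apply: cvgD; last by apply: cvgM; [exact: ca2|exact: c2].
  by apply: cvgM; [exact: cvg_cst|exact: cphi].
have e1 (x : plane R) : is_derive x.1 (1 : R) (fun s => F1 (s, x.2)) (dF1 x).
  have := is_derive_partial1 (d1 x) => d.
  by apply: is_derive_eq; rewrite /dF1 /GRing.scale/= -surjective_pairing; ring.
have e2 (x : plane R) : is_derive x.2 (1 : R) (fun s => F2 (x.1, s)) (dF2 x).
  have := is_derive_partial2 (d2 x) => d.
  by apply: is_derive_eq; rewrite /dF2 /GRing.scale/= -surjective_pairing; ring.
have i1 := continuous_integrable mT TN cdF1.
have i2 := continuous_integrable mT TN cdF2.
transitivity (\int[leb2 R]_(y in open_triangle P Q W) dF1 y +
              \int[leb2 R]_(y in open_triangle P Q W) dF2 y).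
  rewrite -RintegralD//; apply: eq_Rintegral => y _.
  by rewrite /dF1 /dF2 /dot/= /GRing.scale/=; ring.
rewrite (@triangle_divergence1 _ F1 dF1 N) ?PN1 ?QN1 ?WN1//; last by move=> s; rewrite /F1 pN1 mulr0.
rewrite (@triangle_divergence2 _ F2 dF2 N) ?PN2 ?QN2 ?WN2//; last by move=> s; rewrite /F2 pN2 mulr0.
have edge P' Q' : crs (a + b *: P') (Q' - P') * edge_mean phi P' Q' =
    (Q'.2 - P'.2) * edge_mean F1 P' Q' - (Q'.1 - P'.1) * edge_mean F2 P' Q'.
  rewrite /edge_mean -!RintegralZl//; try exact: integrable_edge.
  rewrite -RintegralB//.
  - apply: eq_Rintegral => s _; rewrite /F1 /F2 /crs/= /GRing.scale/=; ring.
  - apply: (@integrable_edge _ (fun y => (Q'.2 - P'.2) * F1 y)).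
    by move=> y; apply: cvgM; [exact: cvg_cst|exact: cF1].
  - apply: (@integrable_edge _ (fun y => (Q'.1 - P'.1) * F2 y)).
    by move=> y; apply: cvgM; [exact: cvg_cst|exact: cF2].
by rewrite !edge; ring.
Qed.

(** * Geometry of a triangle *)

(** geometry of a single triangle *)
Definition closed_triangle (R : realType) (P Q W : plane R) : set (plane R) :=
  [set y | [/\ 0 <= crs (P - y) (Q - y), 0 <= crs (Q - y) (W - y) & 0 <= crs (W - y) (P - y)]].

Lemma plane_eq (R : realType) (x y : plane R) : x.1 = y.1 -> x.2 = y.2 -> x = y.
Proof. by case: x y => [? ?] [? ?] /= -> ->. Qed.

Lemma closed_triangleP (R : realType) (P Q W y : plane R) :
  0 < crs (Q - P) (W - P) ->
  closed_triangle P Q W y <-> exists l : R * R * R,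
    [/\ 0 <= l.1.1, 0 <= l.1.2, 0 <= l.2, l.1.1 + l.1.2 + l.2 = 1 &
        y = l.1.1 *: P + l.1.2 *: Q + l.2 *: W].
Proof.
move=> D0; split=> [[c1 c2 c3]|[[[p q] w] /= [p0 q0 w0 s1 ->]]].
  exists (crs (Q - y) (W - y) / crs (Q - P) (W - P), crs (W - y) (P - y) / crs (Q - P) (W - P),
     crs (P - y) (Q - y) / crs (Q - P) (W - P)) => /=; split.
  - by rewrite divr_ge0// ltW.
  - by rewrite divr_ge0// ltW.
  - by rewrite divr_ge0// ltW.
  - rewrite -!mulrDl (crs_sum3 Q W P) (_ : crs (W - Q) (P - Q) = crs (Q - P) (W - P)).
      by rewrite divff// gt_eqF.
    by rewrite /crs/=; ring.
  - move: D0 => /lt0r_neq0; rewrite /crs/= => D0.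
    by apply: plane_eq; rewrite /= /GRing.scale/=; field.
have -> : p = 1 - q - w by lra.
have p0' : 0 <= 1 - q - w by lra.
have h (k e : R) : 0 <= k -> e = k * crs (Q - P) (W - P) -> 0 <= e.
  by move=> k0 ->; rewrite mulr_ge0// ltW.
split.
- by apply: (h w) => //; rewrite /crs/= /GRing.scale/=; ring.
- by apply: (h (1 - q - w)) => //; rewrite /crs/= /GRing.scale/=; ring.
- by apply: (h q) => //; rewrite /crs/= /GRing.scale/=; ring.
Qed.

Lemma crs_sub_affine (R : realType) (P Q x z : plane R) (e : R) :
  crs (P - (x + e *: (z - x))) (Q - (x + e *: (z - x))) =
  (1 - e) * crs (P - x) (Q - x) + e * crs (P - z) (Q - z).
Proof. by rewrite /crs/= /GRing.scale/=; ring. Qed.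

Lemma closed_triangle_sub (R : realType) (P Q W P' Q' W' : plane R) :
  0 < crs (Q - P) (W - P) ->
  closed_triangle P' Q' W' P -> closed_triangle P' Q' W' Q -> closed_triangle P' Q' W' W ->
  closed_triangle P Q W `<=` closed_triangle P' Q' W'.
Proof.
move=> D0 [p1 p2 p3] [q1 q2 q3] [w1 w2 w3] y /(closed_triangleP _ D0)[[[p q] w] /= [p0 q0 w0 s1 ->]].
have h (A B : plane R) : 0 <= crs (A - P) (B - P) -> 0 <= crs (A - Q) (B - Q) ->
    0 <= crs (A - W) (B - W) ->
    0 <= crs (A - (p *: P + q *: Q + w *: W)) (B - (p *: P + q *: Q + w *: W)).
  move=> hp hq hw; have -> : crs (A - (p *: P + q *: Q + w *: W)) (B - (p *: P + q *: Q + w *: W)) =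
     p * crs (A - P) (B - P) + q * crs (A - Q) (B - Q) + w * crs (A - W) (B - W).
    have -> : p = 1 - q - w by lra.
    by rewrite /crs/= /GRing.scale/=; ring.
  by rewrite !addr_ge0// mulr_ge0.
by split; apply: h.
Qed.

Lemma vertices_closed_triangle (R : realType) (P Q W : plane R) :
  0 < crs (Q - P) (W - P) ->
  [/\ closed_triangle P Q W P, closed_triangle P Q W Q & closed_triangle P Q W W].
Proof.
move=> /ltW D0; split; rewrite /closed_triangle/= !subrr.
- by split; rewrite ?/crs/= ?mulr0 ?mul0r ?subrr//; move: D0; rewrite /crs/=; lra.
- by split; rewrite ?/crs/= ?mulr0 ?mul0r ?subrr//; move: D0; rewrite /crs/=; lra.
- by split; rewrite ?/crs/= ?mulr0 ?mul0r ?subrr//; move: D0; rewrite /crs/=; lra.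
Qed.

Lemma interior_closed_triangle (R : realType) (P Q W : plane R) :
  0 < crs (Q - P) (W - P) ->
  interior (closed_triangle P Q W) = open_triangle P Q W.
Proof.
move=> D0; apply/seteqP; split => [y yI|y yT].
  (* a point of an edge can be pushed outside along the opposite vertex *)
  have push (A : plane R) : exists2 e : R, 0 < e & closed_triangle P Q W (y + e *: (y - A)).
    have c : continuous (fun e : R => y + e *: (y - A)).
      by move=> e; apply: cvgD; [exact: cvg_cst|apply: cvgZl; exact: cvg_id].
    have : nbhs (0 : R) [set e | closed_triangle P Q W (y + e *: (y - A))].
      by have := c 0; apply; rewrite scale0r addr0.
    move=> /nbhs_ballP[d /= d0 H]; exists (d / 2); first by rewrite divr_gt0.
    by apply: H; rewrite /ball/= sub0r normrN gtr0_norm ?divr_gt0// ltr_pdivrMr// ltr_pMr// ltr1n.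
  have [yc1 yc2 yc3] := interior_subset yI.
  have h (A B C : plane R) : crs (A - C) (B - C) = crs (Q - P) (W - P) ->
      (forall z, closed_triangle P Q W z -> 0 <= crs (A - z) (B - z)) -> 0 < crs (A - y) (B - y).
    move=> AC pos; have [e e0 /pos] := push C.
    have -> : y + e *: (y - C) = y + (- e) *: (C - y) by rewrite scaleNr -scalerN opprB.
    rewrite crs_sub_affine AC opprK => k.
    have : 0 < (1 + e) * crs (A - y) (B - y) by rewrite (lt_le_trans (mulr_gt0 e0 D0))//; lra.
    by rewrite pmulr_rgt0// addr_gt0.
  split; [apply: (h _ _ W)|apply: (h _ _ P)|apply: (h _ _ Q)]; try by [move=> z []];
    by rewrite /crs/=; ring.
have o : open (open_triangle P Q W : set (plane R)).
  rewrite (_ : open_triangle P Q W = [set y | 0 < crs (P - y) (Q - y)] `&`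
    [set y | 0 < crs (Q - y) (W - y)] `&` [set y | 0 < crs (W - y) (P - y)]); last first.
    by apply/seteqP; split => z; [move=> []|move=> [[]]].
  have oc A B : open [set y : plane R | 0 < crs (A - y) (B - y)].
    by apply: (@open_comp _ _ (fun y : plane R => crs (A - y) (B - y)) [set z | 0 < z]);
     [move=> ? _; exact: continuous_crs_sub|exact: open_gt].
  by do 2 apply: openI => //.
have sub : open_triangle P Q W `<=` closed_triangle P Q W.
  by move=> z [? ? ?]; split; exact: ltW.
by apply: (interiorS sub); move/interior_id: o => ->.
Qed.

Notation tri R := (plane R * plane R * plane R)%type.

Definition ccw (R : realType) (t : tri R) : Prop :=
  0 < crs (t.1.2 - t.1.1) (t.2 - t.1.1).

Definition cltri (R : realType) (t : tri R) : set (plane R) :=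
  closed_triangle t.1.1 t.1.2 t.2.

Definition optri (R : realType) (t : tri R) : set (mplane R) :=
  open_triangle t.1.1 t.1.2 t.2.

Definition verts (R : realType) (t : tri R) : seq (plane R) := [:: t.1.1; t.1.2; t.2].

Definition rots (R : realType) (t : tri R) : seq (tri R) :=
  [:: t; (t.1.2, t.2, t.1.1); (t.2, t.1.1, t.1.2)].

Definition oriented (R : realType) (K : triangle R) : tri R :=
  if 0 < crs (K (inord 1) - K (inord 0)) (K (inord 2) - K (inord 0))
  then (K (inord 0), K (inord 1), K (inord 2))
  else (K (inord 0), K (inord 2), K (inord 1)).

Lemma ord3E (V : nmodType) (f : 'I_3 -> V) :
  \sum_i f i = f (inord 0) + f (inord 1) + f (inord 2).
Proof.
rewrite !big_ord_recr big_ord0 /= add0r; congr (f _ + f _ + f _); apply/val_inj;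
  by rewrite /= inordK.
Qed.

Lemma ord3P (P : 'I_3 -> Prop) : P (inord 0) -> P (inord 1) -> P (inord 2) -> forall i, P i.
Proof.
move=> p0 p1 p2 [[|[|[|//]]] Hi].
- by rewrite (_ : Ordinal Hi = inord 0)//; apply/val_inj; rewrite /= inordK.
- by rewrite (_ : Ordinal Hi = inord 1)//; apply/val_inj; rewrite /= inordK.
- by rewrite (_ : Ordinal Hi = inord 2)//; apply/val_inj; rewrite /= inordK.
Qed.

Lemma nondegenerateE (R : realType) (K : triangle R) : Defs.nondegenerate K <->
  crs (K (inord 1) - K (inord 0)) (K (inord 2) - K (inord 0)) != 0.
Proof. by []. Qed.

Lemma oriented_ccw (R : realType) (K : triangle R) : Defs.nondegenerate K -> ccw (oriented K).
Proof.
rewrite nondegenerateE /ccw /oriented; case: ifPn => // D0 /= D1.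
by rewrite crsC oppr_gt0 lt_neqAle D1 leNgt.
Qed.

Lemma verts_oriented (R : realType) (K : triangle R) (P : plane R) :
  reflect (exists i : 'I_3, P = K i) (P \in verts (oriented K)).
Proof.
apply: (iffP idP) => [|[i ->]].
  rewrite /oriented; case: ifP => _; rewrite !inE => /or3P[] /eqP ->; by eexists.
rewrite /oriented; elim/ord3P: i; case: ifP => _; by rewrite !inE eqxx ?orbT.
Qed.

(** Barycentric coordinates with respect to a nondegenerate triangle are unique,
    as the three values of [crs] at a point determine them. *)
Lemma bary_inj (R : realType) (K : triangle R) (l m : 'I_3 -> R) :
  Defs.nondegenerate K -> \sum_i l i = \sum_i m i ->
  \sum_i l i *: K i = \sum_i m i *: K i -> l =1 m.
Proof.
rewrite nondegenerateE !ord3E.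
set P := K (inord 0); set Q := K (inord 1); set W := K (inord 2).
move=> D0 s E; set D := crs _ _ in D0.
have e1 : l (inord 1) = m (inord 1).
  apply: (mulIf D0); apply/eqP; rewrite -subr_eq0; apply/eqP.
  transitivity (crs (l (inord 0) *: P + l (inord 1) *: Q + l (inord 2) *: W - 
     (m (inord 0) *: P + m (inord 1) *: Q + m (inord 2) *: W)) (W - P)); last first.
    by rewrite E subrr /crs/= !mul0r subrr.
  have -> : l (inord 0) = m (inord 0) + m (inord 1) + m (inord 2) - l (inord 1) - l (inord 2) by lra.
  by rewrite /D /crs/= /GRing.scale/=; ring.
have e2 : l (inord 2) = m (inord 2).
  apply: (mulIf D0); apply/eqP; rewrite -subr_eq0; apply/eqP.
  transitivity (crs (Q - P) (l (inord 0) *: P + l (inord 1) *: Q + l (inord 2) *: W - 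
     (m (inord 0) *: P + m (inord 1) *: Q + m (inord 2) *: W))); last first.
    by rewrite E subrr /crs/= !mulr0 subrr.
  have -> : l (inord 0) = m (inord 0) + m (inord 1) + m (inord 2) - l (inord 1) - l (inord 2) by lra.
  by rewrite /D /crs/= /GRing.scale/=; ring.
by apply: ord3P => //; lra.
Qed.

Lemma hull_cltri (R : realType) (K : triangle R) :
  Defs.nondegenerate K -> hull K = cltri (oriented K).
Proof.
move=> nK; have D0 := oriented_ccw nK; apply/seteqP; split => [y [l [l0 _ l1 ->]]|y].
  apply/closed_triangleP => //; rewrite !ord3E /oriented in l1 *; case: ifP => _ /=.
    by exists (l (inord 0), l (inord 1), l (inord 2)); split; rewrite //= -l1.
  exists (l (inord 0), l (inord 2), l (inord 1)) => /=; split => //.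
    by rewrite addrAC.
  by rewrite addrAC.
move=> /closed_triangleP => /(_ D0)[[[p q] w] /= [p0 q0 w0 s1 ->]].
rewrite /oriented; case: ifP => _ /=.
  exists (fun i : 'I_3 => nth 0 [:: p; q; w] i); rewrite !ord3E /= !inordK//=.
  by split => //; [apply: ord3P; rewrite inordK|move=> i; rewrite inE].
exists (fun i : 'I_3 => nth 0 [:: p; w; q] i); rewrite !ord3E /= !inordK//=.
by split => //; [apply: ord3P; rewrite inordK|move=> i; rewrite inE|rewrite addrAC|rewrite addrAC].
Qed.

Lemma vertex_face (R : realType) (K : triangle R) (S : {set 'I_3}) (i : 'I_3) :
  i \in S -> face K S (K i).
Proof.
move=> iS; exists (fun j => (j == i)%:R); split => //.
- by move=> j jS; case: eqP jS => // ->; rewrite iS.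
- by rewrite (bigD1 i)//= eqxx big1 ?addr0// => j /negPf ->.
- by rewrite (bigD1 i)//= eqxx scale1r big1 ?addr0// => j /negPf ->; rewrite scale0r.
Qed.

(** A vertex of a face is an extreme point, hence a vertex of any other description
    of that face: write it as a convex combination of vertices [K' j], expand
    these in the vertices of [K], and compare barycentric coordinates. *)
Lemma face_vertex (R : realType) (K K' : triangle R) (S S' : {set 'I_3}) (i : 'I_3) :
  Defs.nondegenerate K -> face K S = face K' S' -> i \in S -> exists j : 'I_3, K i = K' j.
Proof.
move=> nK SS' iS; have := vertex_face K iS; rewrite SS' => -[m [m0 mS m1 Ki]].
have /choice[n nP] : forall j, exists n : 'I_3 -> R,
    [/\ forall k, 0 <= n k, \sum_k n k = 1 & 0 < m j -> K' j = \sum_k n k *: K k].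
  move=> j; have [mj|mj] := ltP 0 (m j).
    have jS : j \in S' by apply: contraTT mj => /mS ->; rewrite ltxx.
    by have := vertex_face K' jS; rewrite -SS' => -[n [n0 _ n1 E]]; exists n.
  exists (fun k => (k == i)%:R); split => //.
  by rewrite (bigD1 i)//= eqxx big1 ?addr0// => k /negPf ->.
have mE j : m j *: K' j = \sum_k (m j * n j k) *: K k.
  have [_ _ nE] := nP j.
  have := m0 j; rewrite le_eqVlt => /predU1P[<-|mj].
    by rewrite scale0r big1// => k _; rewrite mul0r scale0r.
  by rewrite nE// scaler_sumr; apply: eq_bigr => k _; rewrite scalerA.
have E : (fun k => (k == i)%:R) =1 (fun k => \sum_j m j * n j k).
  apply: (bary_inj nK).
    transitivity (\sum_j m j).
      by rewrite m1 (bigD1 i)//= eqxx big1 ?addr0// => k /negPf ->.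
    rewrite exchange_big/=; apply: eq_bigr => j _; rewrite -mulr_sumr.
    by have [_ -> _] := nP j; rewrite mulr1.
  transitivity (K i).
    by rewrite (bigD1 i)//= eqxx scale1r big1 ?addr0// => j /negPf ->; rewrite scale0r.
  rewrite Ki; under eq_bigr do rewrite mE.
  rewrite exchange_big/=; apply: eq_bigr => k _.
  by rewrite scaler_suml.
have [j mj] : exists j, 0 < m j.
  apply/not_existsP => H; have : \sum_j m j <= 0.
    by apply: sumr_le0 => j _; rewrite leNgt; apply/negP/H.
  by rewrite m1 ler10.
exists j; have [n0 n1 ->//] := nP j.
have z k : k != i -> n j k = 0.
  move=> ki; have /eqP := E k; rewrite (negPf ki) eq_sym psumr_eq0.
    by move=> /allP/(_ j); rewrite mem_index_enum mulf_eq0 gt_eqF//= => /(_ isT)/eqP.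
  by move=> j' _; rewrite mulr_ge0//; have [] := nP j'.
rewrite (bigD1 i)//= big1 ?addr0 => [|k /z ->]; last by rewrite scale0r.
by move: n1; rewrite (bigD1 i)//= big1 ?addr0 => [->|k /z//]; rewrite scale1r.
Qed.

(** * Conforming meshes of oriented triangles *)

(** A triangulation in terms of ordered triples, so that edges are directed.
    Conformity takes the following pointwise form: if a common point of two
    triangles has a positive barycentric coordinate at a vertex of the first, then
    this vertex belongs to the second. *)
Record ccw_mesh (R : realType) (A : set (plane R)) (L : seq (tri R)) : Prop := {
  mesh_ccw : forall t, t \in L -> ccw t ;
  mesh_conf : forall t t' P Q W y, t \in L -> t' \in L -> (P, Q, W) \in rots t ->
    cltri t y -> cltri t' y -> 0 < crs (Q - y) (W - y) -> P \in verts t' ;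
  mesh_uniq : forall t t', t \in L -> t' \in L -> {subset verts t <= verts t'} -> t = t' ;
  mesh_uniq_seq : uniq L ;
  mesh_cover : forall y, closure A y -> exists2 t, t \in L & cltri t y }.

Lemma ccw_uniq (R : realType) (t : tri R) : ccw t -> uniq (verts t).
Proof.
rewrite /ccw /verts; case: t => -[P Q] W /= D0; rewrite !inE negb_or !andbT -andbA.
apply/and3P; split; apply: contraTneq D0 => ->.
- by rewrite subrr /crs/= !mul0r subrr ltxx.
- by rewrite subrr /crs/= !mulr0 subrr ltxx.
- by rewrite /crs mulrC subrr ltxx.
Qed.

Lemma subset_verts (R : realType) (t t' : tri R) : ccw t -> ccw t' ->
  {subset verts t <= verts t'} -> {subset verts t' <= verts t}.
Proof. by move=> /ccw_uniq u _ s x; rewrite -(uniq_min_size u s _).2. Qed.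

Lemma cltri_verts (R : realType) (t t' : tri R) : ccw t -> ccw t' ->
  {subset verts t <= verts t'} -> cltri t `<=` cltri t'.
Proof.
move=> ct ct' s.
have v x : x \in verts t -> cltri t' x.
  have [h1 h2 h3] := vertices_closed_triangle ct'.
  by move=> /s; rewrite !inE => /or3P[] /eqP ->.
by apply: closed_triangle_sub => //; apply: v; rewrite !inE eqxx ?orbT.
Qed.

(** The point lies in a common face, so the vertices at which it has a positive
    coordinate span that face, and they are vertices of the other triangle too. *)
Lemma conforming_vertex (R : realType) (K K' : triangle R) (S S' : {set 'I_3})
    (P Q W y : plane R) :
  Defs.nondegenerate K -> Defs.nondegenerate K' ->
  hull K `&` hull K' = face K S -> face K S = face K' S' ->
  (P, Q, W) \in rots (oriented K) -> cltri (oriented K) y -> cltri (oriented K') y ->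
  0 < crs (Q - y) (W - y) -> P \in verts (oriented K').
Proof.
move=> nK nK' KK' SS' rPQW; rewrite -!hull_cltri// => yK yK' c0.
have : face K S y by rewrite -KK'.
move=> [l [_ lS]]; rewrite !ord3E => l1 Ey.
suff [i iS ->] : exists2 i : 'I_3, i \in S & P = K i.
  by have [j ->] := face_vertex nK SS' iS; apply/verts_oriented; exists j.
have hl : l (inord 0) = 1 - l (inord 1) - l (inord 2) by lra.
have E0 : crs (K (inord 1) - y) (K (inord 2) - y) = l (inord 0) *
    crs (K (inord 1) - K (inord 0)) (K (inord 2) - K (inord 0)).
  by rewrite Ey hl /crs/= /GRing.scale/=; ring.
have E1 : crs (K (inord 2) - y) (K (inord 0) - y) = l (inord 1) *
    crs (K (inord 1) - K (inord 0)) (K (inord 2) - K (inord 0)).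
  by rewrite Ey hl /crs/= /GRing.scale/=; ring.
have E2 : crs (K (inord 0) - y) (K (inord 1) - y) = l (inord 2) *
    crs (K (inord 1) - K (inord 0)) (K (inord 2) - K (inord 0)).
  by rewrite Ey hl /crs/= /GRing.scale/=; ring.
have key i d : crs (Q - y) (W - y) = l i * d -> i \in S.
  by move=> E; apply: contraTT c0 => /lS; rewrite E => ->; rewrite mul0r ltxx.
move: rPQW; rewrite /oriented; case: ifP => _; rewrite !inE /= => /or3P[] /eqP[-> eQ eW].
- by exists (inord 0) => //; apply: key; rewrite eQ eW; exact: E0.
- by exists (inord 1) => //; apply: key; rewrite eQ eW; exact: E1.
- by exists (inord 2) => //; apply: key; rewrite eQ eW; exact: E2.
- by exists (inord 0) => //; apply: key; rewrite eQ eW crsC E0 -mulrN.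
- by exists (inord 2) => //; apply: key; rewrite eQ eW crsC E2 -mulrN.
- by exists (inord 1) => //; apply: key; rewrite eQ eW crsC E1 -mulrN.
Qed.

Definition verts_sub (R : realType) (t t' : tri R) : bool :=
  all (mem (verts t')) (verts t).

Lemma verts_subP (R : realType) (t t' : tri R) :
  reflect {subset verts t <= verts t'} (verts_sub t t').
Proof. exact: allP. Qed.

(** One representative for each set of vertices: a triangulation may list a
    triangle several times, with its vertices in different orders, and the sums
    over edges have to count it once. *)
Fixpoint mesh_reps (R : realType) (T : seq (triangle R)) : seq (tri R) :=
  if T is K :: T' then
    let L := mesh_reps T' in
    if has (fun t => verts_sub t (oriented K)) L then L
    else oriented K :: L
  else [::].

Lemma mesh_reps_sub (R : realType) (T : seq (triangle R)) t :
  t \in mesh_reps T -> exists2 K, K \in T & t = oriented K.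
Proof.
elim: T => //= K T IH; case: ifP => _; last rewrite inE => /predU1P[->|].
- by move=> /IH[K' K'T ->]; exists K' => //; rewrite inE K'T orbT.
- by exists K; rewrite ?mem_head.
- by move=> /IH[K' K'T ->]; exists K' => //; rewrite inE K'T orbT.
Qed.

Lemma mesh_reps_cover (R : realType) (T : seq (triangle R)) K :
  (forall K, K \in T -> Defs.nondegenerate K) -> K \in T ->
  exists2 t, t \in mesh_reps T & cltri t = hull K.
Proof.
elim: T => //= K' T IH nT; rewrite inE => /predU1P[->|KT]; last first.
  have [|t tL E] := IH _ KT; first by move=> K1 K1T; apply: nT; rewrite inE K1T orbT.
  by exists t => //; case: ifP => _ //; rewrite inE tL orbT.
have nK' : Defs.nondegenerate K' by apply: nT; rewrite mem_head.
rewrite hull_cltri//; case: ifPn => [/hasP[t tL ts]|_]; last first.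
  by exists (oriented K'); rewrite ?mem_head.
have ct : ccw t.
  have [K1 K1T ->] := mesh_reps_sub tL; apply: oriented_ccw.
  by apply: nT; rewrite inE K1T orbT.
have cK := oriented_ccw nK'.
have /verts_subP s := ts.
exists t => //; apply/seteqP; split; apply: cltri_verts => //.
exact: subset_verts.
Qed.

Lemma mesh_reps_mesh (R : realType) (A : set (plane R)) (T : seq (triangle R)) :
  triangulation A T -> ccw_mesh A (mesh_reps T).
Proof.
move=> [nT cT fT].
have cL t : t \in mesh_reps T -> ccw t.
  by move=> /mesh_reps_sub[K KT ->]; exact/oriented_ccw/nT.
split => //.
- move=> t t' P Q W y /mesh_reps_sub[K KT ->] /mesh_reps_sub[K' K'T ->].
  have [S [S' [h1 h2]]] := fT K K' KT K'T.
  exact: (conforming_vertex (nT _ KT) (nT _ K'T) h1 h2).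
- elim: T nT cL {cT fT} => //= K T IH nT.
  set L := mesh_reps T in IH *; set o := oriented K.
  have nT' K' : K' \in T -> Defs.nondegenerate K' by move=> K'T; apply: nT; rewrite inE K'T orbT.
  case: ifPn => [_ cL|/hasPn H cL]; first exact: IH.
  have cL' t : t \in L -> ccw t by move=> tL; apply: cL; rewrite inE tL orbT.
  have co : ccw o by apply: cL; rewrite mem_head.
  move=> t t'; rewrite !inE => /predU1P[->|tL] /predU1P[->|t'L] //.
  + move=> s; have /negP := H _ t'L; case; apply/verts_subP.
    exact: (subset_verts co (cL' _ t'L) s).
  + by move=> s; have := H _ tL => /negP; case; apply/verts_subP.
  + exact: IH.
- elim: T nT {cT fT cL} => //= K T IH nT.
  have nT' K' : K' \in T -> Defs.nondegenerate K' by move=> K'T; apply: nT; rewrite inE K'T orbT.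
  case: ifPn => [_|/hasPn H]; first exact: IH.
  rewrite /= IH// andbT; apply/negP => /H/negP; apply; exact/verts_subP.
- move=> y; rewrite -cT => -[K /= KT yK].
  by have [t tL E] := mesh_reps_cover nT KT; exists t => //; rewrite E.
Qed.

Lemma rots_ccw (R : realType) (t r : tri R) : ccw t -> r \in rots t -> ccw r.
Proof.
by rewrite /ccw !inE => ct /or3P[] /eqP ->//=; move: ct; congr (0 < _);
  rewrite /crs/=; ring.
Qed.

Lemma rots_cltri (R : realType) (t r : tri R) : r \in rots t -> cltri r = cltri t.
Proof.
rewrite /cltri/closed_triangle !inE => /or3P[] /eqP ->//=; apply/seteqP; split => y /= -[];
  by split.
Qed.

Lemma rots_optri (R : realType) (t r : tri R) : r \in rots t -> optri r = optri t.
Proof.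
rewrite /optri/open_triangle !inE => /or3P[] /eqP ->//=; apply/seteqP; split => y /= -[];
  by split.
Qed.

Lemma optri_cltri (R : realType) (t : tri R) : optri t `<=` cltri t.
Proof. by move=> y [c1 c2 c3]; split; exact: ltW. Qed.

Lemma two_vertices (R : realType) (t : tri R) (P Q : plane R) :
  P != Q -> P \in verts t -> Q \in verts t ->
  exists W, (P, Q, W) \in rots t \/ (Q, P, W) \in rots t.
Proof.
case: t => -[A B] C PQ; rewrite !inE /=.
move=> /or3P[] /eqP eP /or3P[] /eqP eQ; subst P Q; rewrite ?eqxx// in PQ *.
all: try by [exists C; left; rewrite !inE eqxx ?orbT | exists C; right; rewrite !inE eqxx ?orbT
 | exists A; left; rewrite !inE eqxx ?orbT| exists A; right; rewrite !inE eqxx ?orbT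
 | exists B; left; rewrite !inE eqxx ?orbT| exists B; right; rewrite !inE eqxx ?orbT].
Qed.

Lemma crs_edge_point (R : realType) (P Q W : plane R) (s : R) (x := P + s *: (Q - P)) :
  [/\ crs (P - x) (Q - x) = 0, crs (Q - x) (W - x) = (1 - s) * crs (Q - P) (W - P),
      crs (W - x) (P - x) = s * crs (Q - P) (W - P) &
      forall e, crs (P - (x + e *: (W - x))) (Q - (x + e *: (W - x))) =
        e * crs (Q - P) (W - P)].
Proof.
rewrite /x; split => [|||e].
- by rewrite /crs/= /GRing.scale/=; ring.
- by rewrite /crs/= /GRing.scale/=; ring.
- by rewrite /crs/= /GRing.scale/=; ring.
- by rewrite /crs/= /GRing.scale/=; ring.
Qed.

Definition tri_edges (R : realType) (t : tri R) : seq (plane R * plane R) :=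
  [seq r.1 | r <- rots t].
Arguments tri_edges : simpl never.

Section mesh.
Context (R : realType) (A : set (plane R)) (L : seq (tri R)) (mL : ccw_mesh A L).

(** An interior point has three positive barycentric coordinates, so all the
    vertices are shared. *)
Lemma open_closed_eq t t' y : t \in L -> t' \in L -> optri t y -> cltri t' y -> t = t'.
Proof.
move=> tL t'L yt yt'; apply: (mesh_uniq mL) => // x.
have yc := optri_cltri yt.
case: t tL yt yc => -[P Q] W tL [/= c1 c2 c3] yc; have -> : (x \in verts (P, Q, W)) = [|| x == P, x == Q | x == W] by rewrite !inE.
move=> /or3P[] /eqP ->.
- by apply: (mesh_conf mL tL t'L _ yc yt' c2); rewrite !inE eqxx.
- by apply: (mesh_conf mL tL t'L _ yc yt' c3); rewrite !inE eqxx orbT.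
- by apply: (mesh_conf mL tL t'L _ yc yt' c1); rewrite !inE eqxx !orbT.
Qed.

(** Two triangles on the same side of an edge overlap near its midpoint. *)
Lemma edge_owner_uniq t t' (P Q W W' : plane R) : t \in L -> t' \in L ->
  (P, Q, W) \in rots t -> (P, Q, W') \in rots t' -> t = t'.
Proof.
move=> tL t'L r r'; have := rots_ccw (mesh_ccw mL tL) r; have := rots_ccw (mesh_ccw mL t'L) r'.
rewrite /ccw/=; set D' := crs _ (W' - P); set D := crs _ (W - P) => D'0 D0.
(* move from the midpoint of the edge towards W, which stays in the first
   triangle; a step e small against D' stays in the second one *)
pose M := Q - (2^-1 : R) *: (Q - P).
pose k1 := crs (Q - W) (W' - W); pose k2 := crs (W' - W) (P - W).
pose e := D' / (4 * (D' + `|k1| + `|k2|)).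
have d0 : 0 < 4 * (D' + `|k1| + `|k2|) by rewrite mulr_gt0// ltr_wpDr// ltr_wpDr.
have e0 : 0 < e by rewrite divr_gt0.
have eE : e * (4 * (D' + `|k1| + `|k2|)) = D' by rewrite /e divfK// gt_eqF.
have ek1 : - (e * `|k1|) <= e * k1 by rewrite -mulrN ler_pM2l// lerNl -normrN ler_norm.
have ek2 : - (e * `|k2|) <= e * k2 by rewrite -mulrN ler_pM2l// lerNl -normrN ler_norm.
have h1 : 0 <= e * `|k1| by rewrite mulr_ge0// ltW.
have h2 : 0 <= e * `|k2| by rewrite mulr_ge0// ltW.
have h3 : 0 < e * D' by rewrite mulr_gt0.
have eD : e * D' * 4 + e * `|k1| * 4 + e * `|k2| * 4 = D' by rewrite -[RHS]eE; ring.
have e1 : e < 1 by rewrite -(ltr_pM2r D'0); lra.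
clearbody e; have eD2 : 0 < (1 - e) / 2 * D by rewrite mulr_gt0// divr_gt0// subr_gt0.
pose z := M + e *: (W - M).
apply: (@open_closed_eq t t' z) => //.
  rewrite -(rots_optri r); split; rewrite /= crs_sub_affine.
  - rewrite (_ : _ + _ = e * D) ?mulr_gt0//.
    by rewrite /M /D /crs/= /GRing.scale/=; field.
  - rewrite (_ : _ + _ = (1 - e) / 2 * D)//.
    by rewrite /M /D /crs/= /GRing.scale/=; field.
  - rewrite (_ : _ + _ = (1 - e) / 2 * D)//.
    by rewrite /M /D /crs/= /GRing.scale/=; field.
rewrite -(rots_cltri r'); split; rewrite /= crs_sub_affine.
- rewrite (_ : _ + _ = e * D) ?mulr_ge0 ?ltW//.
  by rewrite /M /D /crs/= /GRing.scale/=; field.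
- rewrite (_ : _ + _ = (1 - e) / 2 * D' + e * k1); first by lra.
  by rewrite /M /D' /k1 /crs/= /GRing.scale/=; field.
- rewrite (_ : _ + _ = (1 - e) / 2 * D' + e * k2); first by lra.
  by rewrite /M /D' /k2 /crs/= /GRing.scale/=; field.
Qed.

(** The points just across the edge are in the open set [A], hence covered by the
    mesh.  As the mesh is finite, a single triangle contains such points
    arbitrarily close to the edge, so it contains the point of the edge as well.
    By conformity it contains [P] and [Q], and it has the edge in the opposite
    direction because it reaches the other side. *)
Lemma edge_partner t (P Q W : plane R) (s : R) : open A -> t \in L -> (P, Q, W) \in rots t ->
  0 < s < 1 -> A (P + s *: (Q - P)) ->
  exists t' W', t' \in L /\ (Q, P, W') \in rots t'.
Proof.
move=> oA tL r /andP[s0 s1]; have := crs_edge_point P Q W s; set x := P + _ => -[x1 x2 x3 x4] Ax.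
have D0 := rots_ccw (mesh_ccw mL tL) r; rewrite /ccw/= in D0.
pose z (e : R) := x + e *: (x - W).
have zE e : z e = x + (- e) *: (W - x) by rewrite /z scaleNr -scalerN opprB.
have cz : continuous z.
  by move=> e; apply: cvgD; [exact: cvg_cst|apply: cvgZl; exact: cvg_id].
have [d d0 Hd] : exists2 d : R, 0 < d & forall e, 0 < e < d -> A (z e).
  have : nbhs (0 : R) [set e | A (z e)].
    have := cz 0; apply; rewrite /z scale0r addr0; exact: open_nbhs_nbhs.
  move=> /nbhs_ballP[d /= d0 H]; exists d => // e /andP[e0 ed].
  by apply: H; rewrite /ball/= sub0r normrN gtr0_norm.
have [t' t'L near] : exists2 t', t' \in L &
    forall d, 0 < d -> exists2 e, 0 < e < d & cltri t' (z e).
  apply: contrapT => /forall2NP-H'.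
  have {H'} H t' : t' \in L -> ~ (forall d, 0 < d -> exists2 e, 0 < e < d & cltri t' (z e)).
    by move=> t'L; have [] := H' t'.
  have [d' d'0 Hd'] : exists2 d', 0 < d' & forall e, 0 < e < d' ->
      forall t', t' \in L -> ~ cltri t' (z e).
    elim: (L) H => [|t1 L' IH] H; first by exists 1.
    have [|d1 d10 H1] := IH; first by move=> t' t'L'; apply: H; rewrite inE t'L' orbT.
    have /existsNP[d2 /not_implyP[d20 H2]] := H t1 (mem_head _ _).
    exists (Num.min d1 d2); first by rewrite lt_min d10.
    move=> e /andP[e0]; rewrite lt_min => /andP[ed1 ed2] t'; rewrite inE => /predU1P[->|t'L'].
      by move=> h; apply: H2; exists e; rewrite ?e0.
    by apply: H1 => //; rewrite e0.
  pose e := Num.min d d' / 2.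
  have m0 : 0 < Num.min d d' by rewrite lt_min d0.
  have em : e < Num.min d d' by rewrite /e; lra.
  have e0 : 0 < e by rewrite /e; lra.
  move: em; rewrite lt_min => /andP[ed ed'].
  have /subset_closure/(mesh_cover mL)[t' t'L] : A (z e) by apply: Hd; rewrite e0.
  by apply: Hd' => //; rewrite e0.
have xt' : cltri t' x.
  have lim (B C : plane R) : (forall y, cltri t' y -> 0 <= crs (B - y) (C - y)) ->
      0 <= crs (B - x) (C - x).
    move=> pos; rewrite leNgt; apply/negP => neg.
    pose g := crs (B - x) (C - x); pose h := crs (B - W) (C - W).
    have dh : 0 < - g / (1 + `|h| + `|g|) by rewrite divr_gt0 ?oppr_gt0// !ltr_wpDr.
    have [e /andP[e0 ed] /pos] := near _ dh.
    rewrite zE crs_sub_affine -/g -/h opprK.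
    have : e * (1 + `|h| + `|g|) < - g by rewrite -ltr_pdivlMr// !ltr_wpDr.
    have : - (e * h) <= e * `|h| by rewrite -mulrN ler_pM2l// -normrN ler_norm.
    have : 0 <= e * `|g| by rewrite mulr_ge0// ltW.
    have : e * g < 0 by rewrite pmulr_rlt0.
    rewrite -/g in neg; lra.
  by split; apply: lim => y [].
have [e /andP[e0 _] ze] := near _ ltr01.
(* if t' had the edge in the direction from P to Q, it would not reach the
   other side of it *)
have zneg : crs (P - z e) (Q - z e) < 0 by rewrite zE x4 mulNr oppr_lt0 mulr_gt0.
have x2_gt0 : 0 < crs (Q - x) (W - x) by rewrite x2 mulr_gt0// subr_gt0.
have x3_gt0 : 0 < crs (W - x) (P - x) by rewrite x3 mulr_gt0.
have xt : cltri t x.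
  by rewrite -(rots_cltri r); split; rewrite /= ?x1// ltW.
have rot2 : (Q, W, P) \in rots t.
  move: r; case: (t) => -[a b] c; rewrite !inE => /or3P[] /eqP[-> -> ->];
    by rewrite eqxx ?orbT.
have Pt' : P \in verts t' by exact: (mesh_conf mL tL t'L r xt xt' x2_gt0).
have Qt' : Q \in verts t' by exact: (mesh_conf mL tL t'L rot2 xt xt' x3_gt0).
have PQ : P != Q.
  by apply: contraTneq D0 => ->; rewrite subrr /crs/= !mul0r subrr ltxx.
have [W' [r'|r']] := two_vertices PQ Pt' Qt'; last by exists t', W'.
move: ze; rewrite -(rots_cltri r') => -[/= ze _ _].
by move: zneg; rewrite ltNge ze.
Qed.

Definition dir_edges : seq (plane R * plane R) :=
  flatten [seq tri_edges t | t <- L].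

Lemma dir_edgesP e : reflect (exists t W, t \in L /\ (e, W) \in rots t) (e \in dir_edges).
Proof.
apply: (iffP flatten_mapP) => [[t tL /mapP[[e' W] r ->]]|[t [W [tL r]]]].
  by exists t, W.
by exists t => //; apply/mapP; exists (e, W).
Qed.

Lemma dir_edges_uniq : uniq dir_edges.
Proof.
suff H L' : uniq L' -> {subset L' <= L} ->
    uniq (flatten [seq tri_edges t | t <- L']).
  exact: (H _ (mesh_uniq_seq mL)).
elim: L' => // t L' IH /andP[tL' uL'] sub.
rewrite [flatten _](_ : _ = tri_edges t ++ flatten [seq tri_edges t | t <- L'])//.
rewrite cat_uniq IH//; last by move=> x xL'; apply: sub; rewrite inE xL' orbT.
have tL : t \in L by apply: sub; rewrite mem_head.
rewrite andbT; apply/andP; split.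
  have := ccw_uniq (mesh_ccw mL tL); case: (t) => -[a b] c /=; rewrite !inE negb_or !andbT.
  rewrite /tri_edges/= !xpair_eqE => /andP[/andP[ab ac] bc].
  by rewrite /= (negPf ab) (negPf ac) (negPf bc).
apply/hasPn => e /flatten_mapP[t' t'L' /mapP[[[P' Q'] W'] r' ->]].
apply/negP => /mapP[[[P Q] W] r /= [eP eQ]]; subst P' Q'.
have t'L : t' \in L by apply: sub; rewrite inE t'L' orbT.
by have E := edge_owner_uniq tL t'L r r'; rewrite E t'L' in tL'.
Qed.

End mesh.

(** Terms cancel in pairs. *)
Lemma antisym_sum0 (R : realType) (I : eqType) (E : seq (I * I)) (G : I -> I -> R) :
  uniq E -> (forall P Q, G Q P = - G P Q) ->
  (forall P Q, (P, Q) \in E -> G P Q != 0 -> (Q, P) \in E) ->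
  \sum_(e <- E) G e.1 e.2 = 0.
Proof.
move=> uE anti pair; pose E' := [seq e <- E | G e.1 e.2 != 0].
have -> : \sum_(e <- E) G e.1 e.2 = \sum_(e <- E') G e.1 e.2.
  rewrite big_filter [RHS]big_mkcond/=; apply: eq_bigr => e _.
  by case: eqP => // ->.
have uE' : uniq E' by exact: filter_uniq.
have ps : perm_eq E' [seq (e.2, e.1) | e <- E'].
  apply: uniq_perm => //; first by rewrite map_inj_uniq// => -[a b] [c d] [-> ->].
  have h P Q : (P, Q) \in E' -> (Q, P) \in E'.
    rewrite !mem_filter/= => /andP[G0 PQ].
    by rewrite anti oppr_eq0 G0 (pair P Q).
  move=> [P Q]; apply/idP/mapP => [/h QP|[[a b] ab [-> ->]]]; last exact: h.
  by exists (Q, P).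
have : \sum_(e <- E') G e.1 e.2 = - \sum_(e <- E') G e.1 e.2.
  rewrite {1}(perm_big _ ps) big_map -sumrN/=.
  by apply: eq_bigr => e _; rewrite anti.
lra.
Qed.

(** * Lipschitz boundaries and shape regularity *)

(** A Lipschitz domain lies on one side of its boundary: at a boundary point of the
    interior of the closure, the points straight above the graph would be limits
    of points of [A], which are all below the graph. *)
Lemma interior_closure_lipschitz (R : realType) (A : set (plane R)) :
  open A -> lipschitz_boundary A -> interior (closure A) `<=` A.
Proof.
move=> oA lA x xI; apply: contrapT => nAx.
have /lA[e [r [k [psi [e1 r0 lpsi Hx]]]]] : (closure A `\` interior A) x.
  split; first exact: interior_subset.
  by move/interior_id: oA => ->.
pose n : plane R := (- e.2, e.1).
have ee : e.1 * e.1 + e.2 * e.2 = 1.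
  have : enorm e ^+ 2 = 1 by rewrite e1 expr1n.
  by rewrite sqr_sqrtr// /dot addr_ge0// -expr2 sqr_ge0.
have e00 : enorm (0 : plane R) = 0 by rewrite /enorm /dot/= mul0r addr0 sqrtr0.
have psi0 : psi 0 <= 0.
  rewrite leNgt; apply/negP => h; apply: nAx; apply/Hx; rewrite subrr ?e00//.
  by rewrite /dot/= !mul0r addr0.
have psiL s : psi s <= `|k| * `|s|.
  have /= := lpsi (s, 0) (conj I I); rewrite subr0 => h.
  have h1 := le_trans (ler_norm _) h.
  have : k * `|s| <= `|k| * `|s| by rewrite ler_wpM2r// ler_norm.
  lra.
have cdot (w : plane R) : continuous (fun y : plane R => dot (y - x) w).
  move=> y; apply: cvgD; apply: cvgM; try exact: cvg_cst.
    by apply: cvgB; [exact: cvg_fst|exact: cvg_cst].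
  by apply: cvgB; [exact: cvg_snd|exact: cvg_cst].
have cen : continuous (fun y : plane R => enorm (y - x)).
  move=> y; apply: (@continuous_comp _ _ _ (fun y : plane R => dot (y - x) (y - x)) Num.sqrt); last exact: sqrt_continuous.
  apply: cvgD; apply: cvgM; apply: cvgB; try exact: cvg_cst; (exact: cvg_fst || exact: cvg_snd).
pose z (d : R) : plane R := x + d *: n.
have zn d : dot (z d - x) n = d.
  by rewrite /dot/= /GRing.scale/= -[RHS]mulr1 -ee; ring.
have ze d : dot (z d - x) e = 0 by rewrite /dot/= /GRing.scale/=; ring.
have zr d : enorm (z d - x) = `|d|.
  rewrite /enorm (_ : dot _ _ = d ^+ 2) ?sqrtr_sqr// /dot/= /GRing.scale/=.
  by rewrite -[d ^+ 2]mulr1 -ee; ring.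
have [d [d0 dr dI]] : exists d, [/\ 0 < d, d < r & closure A (z d)].
  have cz : continuous z.
    by move=> y; apply: cvgD; [exact: cvg_cst|apply: cvgZl; exact: cvg_id].
  have : nbhs (0 : R) [set d | closure A (z d)].
    by have := cz 0; apply; rewrite /z scale0r addr0.
  move=> /nbhs_ballP[d /= d0 H]; exists (Num.min d r / 2).
  have m0 : 0 < Num.min d r by rewrite lt_min d0.
  have md : Num.min d r <= d by rewrite ge_min lexx.
  have mr : Num.min d r <= r by rewrite ge_min lexx orbT.
  split; [lra|lra|].
  by apply: H; rewrite /ball/= sub0r normrN gtr0_norm; lra.
(* near z d the graph lies below half the height of z d, as psi 0 <= 0 and
   psi is Lipschitz *)
pose B : set (plane R) := [set y | [/\ enorm (y - x) < r, d / 2 < dot (y - x) n &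
   `|dot (y - x) e| < d / (2 * (1 + `|k|))]].
have nB : nbhs (z d) B.
  have k0 : 0 < 2 * (1 + `|k|) by rewrite mulr_gt0// ltr_wpDr.
  have : \forall y \near z d, enorm (y - x) < r /\ d / 2 < dot (y - x) n /\
     `|dot (y - x) e| < d / (2 * (1 + `|k|)).
    near=> y; split; [|split]; near: y.
    - by apply: (cvgr_lt _ (cen (z d))); rewrite zr gtr0_norm.
    - by apply: (cvgr_gt _ (cdot n (z d))); rewrite zn; lra.
    - have cn : continuous (fun y : plane R => `|dot (y - x) e|).
        by move=> y; apply: cvg_norm; exact: cdot.
      by apply: (cvgr_lt _ (cn (z d))); rewrite ze normr0 divr_gt0.
  by apply: filterS => y [? []].
have [y [Ay [yr yn ye]]] := dI _ nB.
have /Hx := yr => -[/(_ Ay) + _].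
have k0 : 0 < 2 * (1 + `|k|) by rewrite mulr_gt0// ltr_wpDr.
move: ye; rewrite ltr_pdivlMr// => ye.
have := psiL (dot (y - x) e); have := normr_ge0 (dot (y - x) e).
by rewrite -/n; lra.
Unshelve. all: by end_near.
Qed.

Lemma cltri_square (R : realType) (N : R) (t : tri R) : ccw t ->
  (forall P, P \in verts t -> square N P) -> cltri t `<=` square N.
Proof.
move=> ct; case: t ct => -[P Q] W ct H y.
have [[/itvP P1 /itvP P2] [/itvP Q1 /itvP Q2] [/itvP W1 /itvP W2]] :
  [/\ square N P, square N Q & square N W].
  by split; apply: H; rewrite !inE /= eqxx ?orbT.
move=> /(closed_triangleP _ ct)[[[p q] w] /= [p0 q0 w0 s1 ->]].
have h (a b c : R) : - N <= a -> a <= N -> - N <= b -> b <= N -> - N <= c -> c <= N ->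
   p * a + q * b + w * c \in `[- N, N].
  move=> a1 a2 b1 b2 c1 c2; rewrite in_itv/= -[X in X <= _ <= _]mulr1 -[X in _ <= _ <= X]mulr1 -s1.
  rewrite !mulrDr !(mulrC _ p) !(mulrC _ q) !(mulrC _ w).
  by rewrite !lerD ?ler_wpM2l.
by split; apply: h; rewrite ?P1 ?P2 ?Q1 ?Q2 ?W1 ?W2.
Qed.

Lemma l1norm_le_enorm (R : realType) (x : plane R) : l1norm x <= 2 * enorm x.
Proof.
have h (a b : R) : `|a| <= Num.sqrt (a * a + b * b).
  by rewrite -sqrtr_sqr ler_wsqrtr// expr2 lerDl -expr2 sqr_ge0.
have := h x.1 x.2; have := h x.2 x.1; rewrite addrC /l1norm /enorm /dot; lra.
Qed.

Lemma enorm_le_l1norm (R : realType) (x : plane R) : enorm x <= l1norm x.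
Proof.
rewrite /enorm -[leRHS](ger0_norm (l1norm_ge0 x)) -sqrtr_sqr ler_wsqrtr//.
rewrite /dot /l1norm sqrrD -!expr2 !real_normK ?num_real// lerD2r lerDl.
by rewrite mulrn_wge0// mulr_ge0.
Qed.

Lemma square_verts (R : realType) (t : tri R) : exists N : R, forall P, P \in verts t -> square N P.
Proof.
exists (l1norm t.1.1 + l1norm t.1.2 + l1norm t.2) => P.
have sq (x : plane R) : x.1 \in `[- l1norm x, l1norm x] /\ x.2 \in `[- l1norm x, l1norm x].
  by rewrite !in_itv/= -!ler_norml /l1norm lerDl lerDr.
have := l1norm_ge0 t.1.1; have := l1norm_ge0 t.1.2; have := l1norm_ge0 t.2.
rewrite !inE => ? ? ? /or3P[] /eqP ->; [case: (sq t.1.1)|case: (sq t.1.2)|case: (sq t.2)];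
  rewrite !in_itv/= => /andP[? ?] /andP[? ?]; split; rewrite /= in_itv/=; apply/andP; split; lra.
Qed.

Lemma rots_area (R : realType) (t r : tri R) : r \in rots t ->
  crs (r.1.2 - r.1.1) (r.2 - r.1.1) = crs (t.1.2 - t.1.1) (t.2 - t.1.1).
Proof. by rewrite !inE => /or3P[] /eqP ->; rewrite /crs/=; ring. Qed.

Lemma edge_le_diam (R : realType) (t : tri R) (P Q : plane R) : ccw t ->
  cltri t P -> cltri t Q -> enorm (P - Q) <= diam (cltri t).
Proof.
move=> ct tP tQ; apply: ub_le_sup; last by exists P, Q.
have [N HN] := square_verts t.
exists (4 * N) => d [x [y [xt yt ->]]]; apply: (le_trans (enorm_le_l1norm _)).
have [/itvP x1 /itvP x2] := cltri_square ct HN xt.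
have [/itvP y1 /itvP y2] := cltri_square ct HN yt.
have h (a b : R) : - N <= a -> a <= N -> - N <= b -> b <= N -> `|a - b| <= 2 * N.
  by move=> *; rewrite ler_norml; apply/andP; split; lra.
have := h x.1 y.1; have := h x.2 y.2; rewrite x1 x2 y1 y2 !x1 !x2 !y1 !y2.
move=> /(_ isT isT isT isT) ? /(_ isT isT isT isT) ?.
by rewrite /l1norm/=; lra.
Qed.

(** A disk in a triangle spans, orthogonally to an edge, at most the height on that
    edge, and the height is twice the area over the length of the edge. *)
Lemma indiam_edge (R : realType) (t : tri R) (P Q W : plane R) : ccw t ->
  (P, Q, W) \in rots t ->
  indiam (cltri t) * enorm (Q - P) <= crs (Q - P) (W - P).
Proof.
move=> ct r; have cr := rots_ccw ct r; rewrite /ccw/= in cr.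
have PQ0 : 0 < dot (Q - P) (Q - P).
  rewrite lt_neqAle addr_ge0 -?expr2 ?sqr_ge0// andbT eq_sym /dot -!expr2 paddr_eq0 ?sqr_ge0//.
  rewrite !sqrf_eq0; apply: contraTN cr => /andP[/eqP e1 /eqP e2].
  by rewrite /crs e1 e2 !mul0r subrr ltxx.
have e0 : 0 < enorm (Q - P) by rewrite sqrtr_gt0.
have ee : enorm (Q - P) * enorm (Q - P) = dot (Q - P) (Q - P).
  by rewrite -expr2 sqr_sqrtr// ltW.
rewrite -ler_pdivlMr//; apply: ge_sup.
  have [tP _ _] := vertices_closed_triangle ct.
  exists 0; exists t.1.1, 0; split; rewrite ?mulr0// => y /= y0.
  suff -> : y = t.1.1 by [].
  have := le_trans (l1norm_le_enorm _) (ler_wpM2l (ler0n _ 2) y0).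
  rewrite mulr0 /l1norm => h.
  have h1 : `|(y - t.1.1).1| <= 0 by have := normr_ge0 (y - t.1.1).2; lra.
  have h2 : `|(y - t.1.1).2| <= 0 by have := normr_ge0 (y - t.1.1).1; lra.
  move: h1 h2; rewrite !normr_le0 /= !subr_eq0 => /eqP ? /eqP ?.
  exact: plane_eq.
move=> _ [x [rho [rho0 sub ->]]]; rewrite ler_pdivlMr//.
(* unit normal of the edge: the two ends of the diameter of the disk along n
   differ in height by that diameter *)
pose n : plane R := ((P - Q).2 / enorm (Q - P), (Q - P).1 / enorm (Q - P)).
have nn : dot n n = 1.
  rewrite /dot/= mulrACA -invfM [X in _ + X]mulrACA -invfM -mulrDl ee.
  rewrite [X in X / _](_ : _ = dot (Q - P) (Q - P)) ?divff ?gt_eqF//.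
  by rewrite /dot/=; ring.
have bd (s : R) : `|s| <= rho -> cltri t (x + s *: n).
  move=> sr; apply: sub => /=; rewrite addrAC subrr add0r.
  rewrite /enorm (_ : dot _ _ = s ^+ 2) ?sqrtr_sqr//.
  by rewrite -[RHS]mulr1 -nn /dot/= /GRing.scale/=; ring.
have [+ _ _] : cltri (P, Q, W) (x + (- rho) *: n).
  by rewrite (rots_cltri r); apply: bd; rewrite normrN ger0_norm.
have [_ + +] : cltri (P, Q, W) (x + rho *: n).
  by rewrite (rots_cltri r); apply: bd; rewrite ger0_norm.
move=> /= h2 h3 h1; have := crs_sum3 P Q W (x + rho *: n).
have : crs (P - (x + rho *: n)) (Q - (x + rho *: n)) -
       crs (P - (x + (- rho) *: n)) (Q - (x + (- rho) *: n)) = 2 * rho * enorm (Q - P).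
  transitivity (2 * rho * (dot (Q - P) (Q - P) / enorm (Q - P))).
    by rewrite !crs_subE /n /dot/= /GRing.scale/=; ring.
  by rewrite -ee mulfK// gt_eqF.
lra.
Qed.

(** One length is at most the diameter, so at most sigma times the inner diameter,
    and the other length times the inner diameter is at most twice the area.  The
    factor 4 pays for passing from the Euclidean norm to the l1-norm. *)
Lemma shape_regular_edges (R : realType) (sigma : R) (t : tri R) (P Q W P' Q' W' : plane R) :
  0 < sigma -> ccw t -> diam (cltri t) <= sigma * indiam (cltri t) ->
  (P, Q, W) \in rots t -> (P', Q', W') \in rots t ->
  l1norm (Q - P) * l1norm (Q' - P') <= 4 * sigma * crs (t.1.2 - t.1.1) (t.2 - t.1.1).
Proof.
move=> s0 ct reg r r'; have cr := rots_ccw ct r.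
have [+ + _] := vertices_closed_triangle cr; rewrite -/(cltri _) (rots_cltri r) => tP tQ.
have h1 := le_trans (edge_le_diam ct tQ tP) reg.
have h2 := indiam_edge ct r'.
have ED : crs (Q' - P') (W' - P') = crs (t.1.2 - t.1.1) (t.2 - t.1.1).
  exact: (rots_area r').
rewrite ED in h2.
have e0 (x : plane R) : 0 <= enorm x by exact: sqrtr_ge0.
have l0 (x : plane R) : 0 <= l1norm x by exact: l1norm_ge0.
apply: le_trans (ler_pM (l0 _) (l0 _) (l1norm_le_enorm _) (l1norm_le_enorm _)) _.
rewrite mulrACA -(natrM _ 2 2) -mulrA ler_pM2l//.
apply: le_trans (ler_wpM2r (e0 _) h1) _.
by rewrite -mulrA ler_pM2l.
Qed.

(** * Smooth bump functions *)

(** Smooth functions vanishing on a half-line, namely p(1/x) exp(-1/x) for x > 0: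
    this family is stable under differentiation. *)
Definition flat (R : realType) (p : {poly R}) (x : R) : R :=
  if 0 < x then p.[x^-1] * expR (- x^-1) else 0.

Definition flat_deriv (R : realType) (p : {poly R}) : {poly R} := 'X^2 * (p - p^`()).

Lemma poly_le_expR (R : realType) (p : {poly R}) :
  exists C, 0 <= C /\ forall u, 0 <= u -> `|p.[u]| <= C * expR u.
Proof.
exists (\sum_(i < size p) `|p`_i| * (i`!)%:R); split.
  by apply: sumr_ge0 => i _; rewrite mulr_ge0.
move=> u u0; rewrite horner_coef mulr_suml (le_trans (ler_norm_sum _ _ _))// ler_sum// => i _.
rewrite normrM -mulrA ler_wpM2l// ger0_norm ?exprn_ge0//.
case: (nat_of_ord i) => [|n]; first by rewrite expr0 mul1r -[leLHS]expR0 ler_expR.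
have f0 : 0 < (n.+1)`!%:R :> R by rewrite ltr0n fact_gt0.
by rewrite mulrC -ler_pdivrMr// (le_trans _ (expR_ge1Dxn n u0))// lerDr.
Qed.

(** Applied to 'X * p, this linear bound gives the derivative at 0. *)
Lemma flat_le (R : realType) (p : {poly R}) :
  exists C, 0 <= C /\ forall x, `|flat p x| <= C * `|x|.
Proof.
have [C [C0 HC]] := poly_le_expR ('X * p); exists C; split => // x.
rewrite /flat; case: ltP => x0; last by rewrite normr0 mulr_ge0.
have u0 : 0 <= x^-1 by rewrite invr_ge0 ltW.
have := HC _ u0; rewrite hornerM hornerX normrM (ger0_norm u0) ler_pdivrMl// => h.
rewrite normrM (ger0_norm (expR_ge0 _)) (ger0_norm (ltW x0)) expRN.
by rewrite ler_pdivrMr ?expR_gt0// (le_trans h)// mulrA (mulrC x).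
Qed.

Lemma is_derive_flat (R : realType) (p : {poly R}) (x : R) :
  is_derive x (1 : R) (flat p) (flat (flat_deriv p) x).
Proof.
have [x0|x0|->] := ltgtP x 0.
- apply: (@near_eq_is_derive _ _ _ (cst 0)).
    near=> y; rewrite /flat/= ifF//; apply/negbTE; rewrite -leNgt ltW//.
    by near: y; exact: lt_nbhsl.
  by rewrite /flat ltNge (ltW x0)/=; exact: is_derive_cst.
- have xn0 : x != 0 by rewrite gt_eqF.
  have dV : is_derive x (1 : R) (fun y : R => y^-1) (- x ^- 2).
    have d := @is_deriveV R id x 1 1 xn0 (is_derive_id _ _).
    by apply: (is_derive_eq d); rewrite /GRing.scale/= mulr1.
  have dp : is_derive x (1 : R) (fun y : R => p.[y^-1]) (p^`().[x^-1] * (- x ^- 2)).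
    have := @is_derive1_comp _ (horner p) (fun y : R => y^-1) x _ _ (is_derive_poly p _) dV.
    by [].
  have de : is_derive x (1 : R) (fun y : R => expR (- y^-1)) (expR (- x^-1) * x ^- 2).
    have dN : is_derive x (1 : R) (fun y : R => - y^-1) (x ^- 2).
      by apply: is_derive_eq; rewrite opprK.
    have := @is_derive1_comp _ expR (fun y : R => - y^-1) x _ _ (is_derive_expR _) dN.
    by [].
  have H : is_derive x (1 : R) (fun y : R => p.[y^-1] * expR (- y^-1)) (flat (flat_deriv p) x).
    apply: is_derive_eq; rewrite /flat x0 /flat_deriv hornerM hornerXn hornerD hornerN.
    by rewrite /GRing.scale/=; field.
  apply: near_eq_is_derive H; near=> y; rewrite /flat/= ifT//.
  by near: y; exact: lt_nbhsr.
- rewrite {2}/flat ltxx.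
  have [C [C0 HC]] := flat_le ('X * p).
  have lim0 : h^-1 *: (((flat p) \o shift 0) (h *: (1 : R)) - flat p 0) @[h --> (0:R)^'] --> (0 : R).
    apply/cvgrPdist_le => /= e e0.
    near=> h; rewrite sub0r normrN /shift/= addr0 /GRing.scale/= mulr1.
    have -> : flat p 0 = 0 by rewrite /flat ltxx.
    rewrite subr0.
    have h0 : h != 0 by near: h; exact: nbhs_dnbhs_neq.
    have -> : h^-1 * flat p h = flat ('X * p) h.
      by rewrite /flat; case: ifP; rewrite ?mulr0// hornerM hornerX mulrA.
    apply: (le_trans (HC _)).
    have : `|h| <= e / (C + 1).
      near: h; apply: nbhs_dnbhs.
      have := @cvgr0_norm_le R R R (nbhs 0) _ id (@cvg_id _ _) (e / (C + 1)).
      by apply; rewrite divr_gt0// ltr_wpDl.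
    rewrite ler_pdivlMr ?ltr_wpDl// mulrC => /(le_trans _); apply.
    by rewrite ler_wpM2r// lerDl.
  split; first by apply/cvg_ex; exists 0.
  exact: cvg_lim lim0.
Unshelve. all: by end_near.
Qed.

Lemma is_derive_continuous (R : realType) (f df : R -> R) :
  (forall x, is_derive x (1 : R) f (df x)) -> continuous f.
Proof.
by move=> d x; apply/differentiable_continuous/derivable1_diffP; have [] := d x.
Qed.

Lemma continuous_flat (R : realType) (p : {poly R}) : continuous (flat p).
Proof. exact/is_derive_continuous/is_derive_flat. Qed.

Lemma Ck_continuous (R : realType) k (f : plane R -> R) : Ck k f -> continuous f.
Proof. by case: k => [|k] []. Qed.

Lemma CkS (R : realType) k (f : plane R -> R) : Ck k.+1 f -> Ck k f.
Proof.
elim: k f => [|k IH] f [cf [d1 d2 C1 C2]]; first by split.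
by split; [exact: cf|split; [exact: d1|exact: d2|exact (IH _ C1)|exact (IH _ C2)]].
Qed.

Lemma CkD (R : realType) k (f g : plane R -> R) : Ck k f -> Ck k g ->
  Ck k (fun x => f x + g x).
Proof.
elim: k f g => [|k IH] f g [cf Hf] [cg Hg].
  by split => // x; apply: cvgD; [exact: cf|exact: cg].
split; first by move=> x; apply: cvgD; [exact: cf|exact: cg].
case: Hf Hg => [f1 f2 pf1 pf2] [g1 g2 pg1 pg2]; split.
- by move=> x; exact: derivableD.
- by move=> x; exact: derivableD.
- rewrite (_ : partial1 _ = fun x => partial1 f x + partial1 g x); first exact (IH _ _ pf1 pg1).
  by apply/funext => x; exact: deriveD.
- rewrite (_ : partial2 _ = fun x => partial2 f x + partial2 g x); first exact (IH _ _ pf2 pg2).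
  by apply/funext => x; exact: deriveD.
Qed.

Lemma CkM (R : realType) k (f g : plane R -> R) : Ck k f -> Ck k g ->
  Ck k (fun x => f x * g x).
Proof.
elim: k f g => [|k IH] f g Cf Cg.
  by split => // x; apply: cvgM; [exact: (Ck_continuous Cf)|exact: (Ck_continuous Cg)].
have Cf' := CkS Cf; have Cg' := CkS Cg.
case: Cf Cg => [cf [f1 f2 pf1 pf2]] [cg [g1 g2 pg1 pg2]].
split; first by move=> x; apply: cvgM; [exact: cf|exact: cg].
split.
- by move=> x; exact: derivableM.
- by move=> x; exact: derivableM.
- rewrite (_ : partial1 _ = fun x => f x * partial1 g x + g x * partial1 f x).
    exact (CkD (IH _ _ Cf' pg1) (IH _ _ Cg' pf1)).
  by apply/funext => x; exact: deriveM.
- rewrite (_ : partial2 _ = fun x => f x * partial2 g x + g x * partial2 f x).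
    exact (CkD (IH _ _ Cf' pg2) (IH _ _ Cg' pf2)).
  by apply/funext => x; exact: deriveM.
Qed.

Lemma Ck_cst0 (R : realType) k : Ck k (fun _ : plane R => 0 : R).
Proof.
have c : continuous (fun _ : plane R => 0 : R) by move=> x; exact: cvg_cst.
elim: k => [|k IH]; first by split.
split; [exact: c|split].
- by move=> x; exact: derivable_cst.
- by move=> x; exact: derivable_cst.
- rewrite (_ : partial1 _ = fun=> 0); first exact IH.
  by apply/funext => x; exact: derive_cst.
- rewrite (_ : partial2 _ = fun=> 0); first exact IH.
  by apply/funext => x; exact: derive_cst.
Qed.

Lemma is_derive_flat_affine (R : realType) (p : {poly R}) (a b s : R) :
  is_derive s (1 : R) (fun s => flat p (a * s + b)) (flat (a *: flat_deriv p) (a * s + b)).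
Proof.
have d : is_derive s (1 : R) (fun s : R => a * s + b) a.
  by apply: is_derive_eq; rewrite addr0 /GRing.scale/= mulr1.
have := @is_derive1_comp _ (flat p) (fun s : R => a * s + b) s _ _ (is_derive_flat p _) d.
move=> h; apply: (is_derive_eq h).
by rewrite /flat; case: ifP => _; rewrite ?hornerZ; ring.
Qed.

(** Induction on [k], for all polynomials at once. *)
Lemma Ck_flat1 (R : realType) k (p : {poly R}) (a b : R) :
  Ck k (fun x : plane R => flat p (a * x.1 + b)).
Proof.
have c (q : {poly R}) : continuous (fun x : plane R => flat q (a * x.1 + b)).
  move=> x; apply: (@continuous_comp _ _ _ (fun x : plane R => a * x.1 + b) (flat q)).
    by apply: cvgD; [apply: cvgM; [exact: cvg_cst|exact: cvg_fst]|exact: cvg_cst].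
  exact: continuous_flat.
elim: k p => [|k IH] p; first by split.
have E1 (x : plane R) : (fun h : R => h^-1 *: (((fun x : plane R => flat p (a * x.1 + b)) \o shift x)
     (h *: ((1, 0) : plane R)) - flat p (a * x.1 + b))) =
    (fun h : R => h^-1 *: (((fun s => flat p (a * s + b)) \o shift x.1) (h *: (1 : R))
       - flat p (a * x.1 + b))).
  by apply/funext.
have E2 (x : plane R) : (fun h : R => h^-1 *: (((fun x : plane R => flat p (a * x.1 + b)) \o shift x)
     (h *: ((0, 1) : plane R)) - flat p (a * x.1 + b))) = (fun h : R => 0).
  by apply/funext => h; rewrite /= scaler0 add0r subrr scaler0.
have d (x : plane R) := is_derive_flat_affine p a b x.1.
split; [exact: c|split].
- by move=> x; rewrite /derivable E1; have [] := d x.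
- by move=> x; rewrite /derivable E2; exact: is_cvg_cst.
- rewrite (_ : partial1 _ = fun x => flat (a *: flat_deriv p) (a * x.1 + b)); first exact (IH _).
  by apply/funext => x; rewrite /partial1 /derive E1; exact: (@derive_val _ _ _ _ _ _ _ (d x)).
- rewrite (_ : partial2 _ = fun=> 0); first exact (Ck_cst0 _ k).
  by apply/funext => x; rewrite /partial2 /derive E2; exact: lim_cst.
Qed.

Lemma Ck_flat2 (R : realType) k (p : {poly R}) (a b : R) :
  Ck k (fun x : plane R => flat p (a * x.2 + b)).
Proof.
have c (q : {poly R}) : continuous (fun x : plane R => flat q (a * x.2 + b)).
  move=> x; apply: (@continuous_comp _ _ _ (fun x : plane R => a * x.2 + b) (flat q)).
    by apply: cvgD; [apply: cvgM; [exact: cvg_cst|exact: cvg_snd]|exact: cvg_cst].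
  exact: continuous_flat.
elim: k p => [|k IH] p; first by split.
have E1 (x : plane R) : (fun h : R => h^-1 *: (((fun x : plane R => flat p (a * x.2 + b)) \o shift x)
     (h *: ((0, 1) : plane R)) - flat p (a * x.2 + b))) =
    (fun h : R => h^-1 *: (((fun s => flat p (a * s + b)) \o shift x.2) (h *: (1 : R))
       - flat p (a * x.2 + b))).
  by apply/funext.
have E2 (x : plane R) : (fun h : R => h^-1 *: (((fun x : plane R => flat p (a * x.2 + b)) \o shift x)
     (h *: ((1, 0) : plane R)) - flat p (a * x.2 + b))) = (fun h : R => 0).
  by apply/funext => h; rewrite /= scaler0 add0r subrr scaler0.
have d (x : plane R) := is_derive_flat_affine p a b x.2.
split; [exact: c|split].
- by move=> x; rewrite /derivable E2; exact: is_cvg_cst.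
- by move=> x; rewrite /derivable E1; have [] := d x.
- rewrite (_ : partial1 _ = fun=> 0); first exact (Ck_cst0 _ k).
  by apply/funext => x; rewrite /partial1 /derive E2; exact: lim_cst.
- rewrite (_ : partial2 _ = fun x => flat (a *: flat_deriv p) (a * x.2 + b)); first exact (IH _).
  by apply/funext => x; rewrite /partial2 /derive E1; exact: (@derive_val _ _ _ _ _ _ _ (d x)).
Qed.

(** The factors tend to 1 where their arguments are positive, so these functions
    tend to the indicator function of the open box. *)
Definition bump (R : realType) (a b c d : R) (n : nat) (x : plane R) : R :=
  flat 1 (n.+1%:R * x.1 + - (n.+1%:R * a)) * flat 1 (- n.+1%:R * x.1 + n.+1%:R * b) *
  (flat 1 (n.+1%:R * x.2 + - (n.+1%:R * c)) * flat 1 (- n.+1%:R * x.2 + n.+1%:R * d)).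

Lemma flat1_bound (R : realType) (x : R) : 0 <= flat 1 x <= 1.
Proof.
rewrite /flat; case: ltP => x0; last by rewrite lexx ler01.
by rewrite hornerC mul1r expR_ge0/= -expR0 ler_expR oppr_le0 invr_ge0 ltW.
Qed.

Lemma flat1_eq0 (R : realType) (x : R) : x <= 0 -> flat 1 x = 0.
Proof. by rewrite /flat ltNge => ->. Qed.

Lemma bump_eq0 (R : realType) (a b c d : R) n x : ~ box a b c d x -> bump a b c d n x = 0.
Proof.
have n0 : 0 < n.+1%:R :> R by rewrite ltr0n.
have h (s e : R) : s <= e -> flat 1 (n.+1%:R * s + - (n.+1%:R * e)) = 0.
  by move=> se; apply: flat1_eq0; rewrite -mulrBr pmulr_rle0// subr_le0.
have h' (s e : R) : e <= s -> flat 1 (- n.+1%:R * s + n.+1%:R * e) = 0.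
  by move=> se; apply: flat1_eq0; rewrite mulNr addrC -mulrBr pmulr_rle0// subr_le0.
rewrite /box/bump/= !in_itv/= => /not_andP[|] /negP; rewrite negb_and -!leNgt => /orP[] e.
- by rewrite (h _ _ e) !mul0r.
- by rewrite (h' _ _ e) mulr0 !mul0r.
- by rewrite (h _ _ e) mul0r mulr0.
- by rewrite (h' _ _ e) !mulr0.
Qed.

Lemma bump_test (R : realType) (A : set (plane R)) (a b c d : R) n :
  cbox a b c d `<=` A -> test_function A (bump a b c d n).
Proof.
move=> QA.
have sub : closure [set x | bump a b c d n x != 0] `<=` cbox a b c d.
  have -> : cbox a b c d = closure (cbox a b c d).
    apply/closure_id; apply: compact_closed; first exact: norm_hausdorff.
    by apply: compact_setX; exact: segment_compact.
  apply: closureS => x /= /eqP bx.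
  have : box a b c d x by apply: contrapT => /(bump_eq0 n).
  rewrite /box/cbox/= !in_itv/= => -[/andP[x1 x2] /andP[x3 x4]].
  by rewrite !ltW.
split.
- by move=> k; apply: CkM; apply: CkM; (exact: Ck_flat1 || exact: Ck_flat2).
- apply: (subclosed_compact (@closed_closure _ _) _ sub).
  by apply: compact_setX; exact: segment_compact.
- exact: subset_trans QA.
Qed.

Lemma bump_bound (R : realType) (a b c d : R) n x : `|bump a b c d n x| <= 1.
Proof.
have h (s : R) : `|flat 1 s| <= 1.
  by have /andP[? ?] := flat1_bound s; rewrite ger0_norm.
by rewrite /bump !normrM !mulr_ile1 ?mulr_ge0.
Qed.

Lemma flat1_cvg (R : realType) (x : R) : 0 < x ->
  (fun n => flat 1 (n.+1%:R * x)) @ \oo --> (1 : R).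
Proof.
move=> x0.
have E : (fun n => flat 1 (n.+1%:R * x)) = (fun n => expR (- (x^-1 * n.+1%:R^-1))).
  by apply/funext => n; rewrite /flat pmulr_rgt0 ?ltr0n// x0 hornerC mul1r invfM mulrC.
have L : (fun n => - (x^-1 * n.+1%:R^-1)) @ \oo --> (0 : R).
  rewrite -[X in _ --> X]oppr0; apply: cvgN; rewrite -[X in _ --> X](mulr0 x^-1).
  by apply: (cvgM (cvg_cst _)); exact: cvg_harmonic.
rewrite E -[X in _ --> X]expR0.
exact: (cvg_comp _ _ L (@continuous_expR R 0)).
Qed.

Lemma bump_cvg (R : realType) (a b c d : R) x : box a b c d x ->
  (fun n => bump a b c d n x) @ \oo --> (1 : R).
Proof.
rewrite /box/= !in_itv/= => -[/andP[x1 x2] /andP[x3 x4]].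
have h (s e : R) : s < e -> (fun n => flat 1 (n.+1%:R * e + - (n.+1%:R * s))) @ \oo --> (1 : R).
  move=> se; under eq_fun do rewrite -mulrBr; apply: flat1_cvg; by rewrite subr_gt0.
have h' (s e : R) : s < e -> (fun n => flat 1 (- n.+1%:R * s + n.+1%:R * e)) @ \oo --> (1 : R).
  move=> se; under eq_fun do rewrite mulNr addrC; exact: h.
have -> : (1 : R) = 1 * 1 * (1 * 1) by rewrite !mul1r.
by apply: cvgM; apply: cvgM; (apply: h => // || apply: h' => //).
Qed.

(** * The fundamental lemma of the calculus of variations *)

(** Dominated convergence along the bump functions of the box. *)
Lemma integral_box0 (R : realType) (A : set (plane R)) (g : plane R -> R) (a b c d : R) :
  measurable (A : set (mplane R)) -> (leb2 R).-integrable A (EFin \o g) ->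
  (forall phi, test_function A phi -> \int[leb2 R]_(x in A) (g x * phi x) = 0) ->
  cbox a b c d `<=` A ->
  (\int[leb2 R]_(x in box a b c d) (g x)%:E = 0)%E.
Proof.
move=> mA ig g0 QA.
have mg : measurable_fun (A : set (mplane R)) g by have /measurable_int/measurable_EFinP := ig.
have mb n : measurable_fun setT (bump a b c d n : mplane R -> R).
  by apply: continuous_plane_measurable; have [/(_ 0) /Ck_continuous] := bump_test n QA.
pose f_ n x : \bar R := (g x * bump a b c d n x)%:E.
pose f x : \bar R := (g x * \1_(box a b c d) x)%:E.
have mf_ n : measurable_fun (A : set (mplane R)) (f_ n).
  apply/measurable_EFinP; apply: measurable_funM => //.
  by apply: measurable_funTS; exact: mb.
have mf : measurable_fun (A : set (mplane R)) f.
  apply/measurable_EFinP; apply: measurable_funM => //.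
  apply: measurable_indic; exact: measurable_box.
have boxA : box a b c d `<=` A by apply: subset_trans QA; exact: box_cbox.
have i_ n : (leb2 R).-integrable A (f_ n).
  apply: (le_integrable mA (mf_ n) _ ig) => x Ax; rewrite /f_/= lee_fin normrM.
  by rewrite ler_piMr// bump_bound.
have := @dominated_convergence _ _ _ (leb2 R) A mA f_ f (abse \o (EFin \o g)) mf_ mf.
case.
- apply: aeW => x Ax; apply/fine_cvgP; split; first by apply: nearW.
  apply: cvgM; first exact: cvg_cst.
  rewrite indicE; case: (asboolP (box a b c d x)) => xb.
    by rewrite mem_set//; exact: bump_cvg.
  by rewrite memNset//; under eq_fun do rewrite bump_eq0//; exact: cvg_cst.
- exact: integrable_abse.
- by apply: aeW => x n Ax; rewrite /f_/= lee_fin normrM ler_piMr// bump_bound.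
move=> _ _; rewrite (_ : [sequence _]_n = cst 0%E); last first.
  apply/funext => n /=; rewrite -[LHS]fineK; last exact: integrable_fin_num (i_ n).
  by rewrite -/(Rintegral _ _ _) g0//; exact: bump_test.
move=> L; have := cvg_unique _ L (cvg_cst _) => /(_ (@ereal_hausdorff _)) E.
rewrite [LHS]integral_mkcond -[RHS]E [RHS]integral_mkcond; apply: eq_integral => x _.
rewrite !patchE /f indicE; case: ifPn => xb.
  by rewrite (mem_set (boxA _ (set_mem xb))) mulr1.
by case: ifP => // _; rewrite mulr0.
Qed.

(** Sets cut out of a slice [D] by a measurable map [h]: by a Dynkin argument it
    suffices to test a pi-system of generators. *)
Lemma integral_dynkin d (T : measurableType d) d' (U : measurableType d') (R : realType)
    (mu : {measure set T -> \bar R}) (g : T -> \bar R) (h : T -> U) (D : set T)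
    (G : set (set U)) :
  @measurable _ U = <<s G >> -> setI_closed G -> measurable_fun setT h ->
  measurable D -> mu.-integrable setT g ->
  (\int[mu]_(x in D) g x = 0)%E ->
  (forall A, G A -> \int[mu]_(x in D `&` h @^-1` A) g x = 0)%E ->
  forall A, measurable A -> (\int[mu]_(x in D `&` h @^-1` A) g x = 0)%E.
Proof.
move=> GE GI mh mD ig D0 G0 A; rewrite GE.
have mhA S : measurable S -> measurable (D `&` h @^-1` S).
  by move=> mS; apply: measurableI => //; rewrite -[X in measurable X]setTI; exact: mh.
have igS S : measurable S -> mu.-integrable S g.
  by move=> mS; exact: integrableS ig.
move: A; apply: (dynkin_induction GE GI) => /=.
- by rewrite preimage_setT setIT.
- exact: G0.
- move=> S mS S0.
  have E : D = (D `&` h @^-1` S) `|` (D `&` h @^-1` (~` S)).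
    by rewrite -setIUr -preimage_setU setUCr preimage_setT setIT.
  move: D0; rewrite {1}E integral_setU//; last 4 first.
  - exact: mhA.
  - by apply: mhA; exact: measurableC.
  - by rewrite -E; have /measurable_int := igS _ mD.
  - by apply/disj_set2P/seteqP; split => x //= [[_ ?] [_]].
  by rewrite S0 add0e.
- move=> F mF tF F0.
  rewrite preimage_bigcup setI_bigcupr integral_bigcup//.
  + by apply: eseries0 => n _ _; exact: F0.
  + apply: trivIset_setIl; apply/trivIsetP => i j _ _ ij.
    have /trivIsetP/(_ i j I I ij) E := tF.
    by rewrite -[LHS]/(h @^-1` (F i `&` F j)) E preimage_set0.
  + by move=> k; exact: mhA.
  + apply: igS; apply: bigcupT_measurable => k; exact: mhA.
Qed.

Lemma boxI (R : realType) (a b c d p q r s : R) :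
  box a b c d `&` box p q r s =
  box (Num.max a p) (Num.min b q) (Num.max c r) (Num.min d s).
Proof.
apply/seteqP; split=> x; rewrite /box/= !in_itv/= !gt_max !lt_min.
  by move=> [[/andP[-> ->] /andP[-> ->]] [/andP[-> ->] /andP[-> ->]]].
by move=> [/andP[/andP[-> ->] /andP[-> ->]] /andP[/andP[-> ->] /andP[-> ->]]].
Qed.

(** The integral vanishes on smaller boxes.  Freeing one side of the box at a time,
    it vanishes on measurable rectangles and then on all measurable subsets. *)
Lemma box_ae0 (R : realType) (A : set (plane R)) (g : plane R -> R) (a b c d : R) :
  measurable (A : set (mplane R)) -> (leb2 R).-integrable A (EFin \o g) ->
  (forall phi, test_function A phi -> \int[leb2 R]_(x in A) (g x * phi x) = 0) ->
  cbox a b c d `<=` A ->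
  {ae leb2 R, forall x, box a b c d x -> g x = 0}.
Proof.
move=> mA ig g0 QA; pose h := (EFin \o g) \_ (box a b c d).
have mQ := measurable_box a b c d.
have ih : (leb2 R).-integrable setT h.
  rewrite /h -integrable_mkcond//; apply: integrableS ig => //.
  by apply: subset_trans QA; exact: box_cbox.
have hE S : (\int[leb2 R]_(x in S) h x = \int[leb2 R]_(x in box a b c d `&` S) (g x)%:E)%E.
  by rewrite setIC integral_mkcondr.
have hbox p q r s : (\int[leb2 R]_(x in box p q r s) h x = 0)%E.
  rewrite hE boxI; apply: (integral_box0 mA ig g0); apply: subset_trans QA => x.
  rewrite /cbox/= !in_itv/= !ge_max !le_min.
  by move=> [/andP[/andP[-> _] /andP[-> _]] /andP[/andP[-> _] /andP[-> _]]].
have GE := RGenOpens.measurableE R.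
have GI : setI_closed (fun B : set R => exists x y : R, B = `]x, y[%classic).
  move=> _ _ [x [y ->]] [x' [y' ->]]; exists (Num.max x x'), (Num.min y y').
  by apply/seteqP; split => z /=; rewrite !in_itv/= gt_max lt_min;
    [move=> [/andP[-> ->] /andP[-> ->]]|move=> /andP[/andP[-> ->] /andP[-> ->]]].
have mI (x y : R) : measurable (`]x, y[%classic : set (measurableTypeR R)) by exact: measurable_itv.
have m1 : measurable_fun setT (fst : mplane R -> measurableTypeR R) by exact: measurable_fst.
have m2 : measurable_fun setT (snd : mplane R -> measurableTypeR R) by exact: measurable_snd.
have mp1 (S : set (measurableTypeR R)) : measurable S -> measurable ((fst : mplane R -> _) @^-1` S).
  by move=> mS; rewrite -[X in measurable X]setTI; exact: m1.
have mp2 (S : set (measurableTypeR R)) : measurable S -> measurable ((snd : mplane R -> _) @^-1` S).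
  by move=> mS; rewrite -[X in measurable X]setTI; exact: m2.
have stage1 r s (S : set (measurableTypeR R)) : measurable S ->
    (\int[leb2 R]_(x in snd @^-1` `]r, s[%classic `&` fst @^-1` S) h x = 0)%E.
  apply: (integral_dynkin GE GI m1 (mp2 _ (mI r s)) ih).
    rewrite hE -(hbox a b r s) hE; congr (\int[_]_(x in _) _)%E.
    apply/seteqP; split => x; rewrite /box/= !in_itv/=.
      by move=> [[-> ->] ->].
    by move=> [[-> ->] [_ ->]].
  move=> _ [x [y ->]]; rewrite -(hbox x y r s); congr (\int[_]_(x in _) _)%E.
  by apply/seteqP; split => z; rewrite /box/=; [move=> [-> ->]|move=> [-> ->]].
have stage2 (S B : set (measurableTypeR R)) : measurable S -> measurable B ->
    (\int[leb2 R]_(x in fst @^-1` S `&` snd @^-1` B) h x = 0)%E.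
  move=> mS; apply: (integral_dynkin GE GI m2 (mp1 _ mS) ih).
    rewrite hE -(stage1 c d S mS) hE; congr (\int[_]_(x in _) _)%E.
    apply/seteqP; split => x; rewrite /box/=.
      by move=> [[-> ->] ?].
    by move=> [[-> ->] [_ ?]].
  by move=> _ [x [y ->]]; rewrite setIC; exact: stage1.
have stage3 (E : set (mplane R)) : measurable E -> (\int[leb2 R]_(x in E) h x = 0)%E.
  move=> mE; rewrite -(setTI E).
  have PE := @measurable_prod_measurableType _ _ (measurableTypeR R) (measurableTypeR R).
  apply: (integral_dynkin (h := id) (D := setT) PE) mE => //.
  - move=> _ _ [S mS [B mB <-]] [S' mS' [B' mB' <-]].
    exists (S `&` S'); first exact: measurableI.
    by exists (B `&` B'); [exact: measurableI|rewrite setXI].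
  - by have := stage2 setT setT measurableT measurableT; rewrite !preimage_setT setIT.
  - by move=> _ [S mS [B mB <-]]; rewrite setTI; exact: stage2.
have [N [mN N0 NS]] : ae_eq (leb2 R) setT h (cst 0%E).
  apply: integral_ae_eq => // E _ mE; rewrite stage3//.
  by rewrite integral0.
exists N; split => // x /= /not_implyP[xQ gx]; apply: NS => /= /(_ I) hx.
by apply: gx; move: hx; rewrite /h patchE mem_set// => -[].
Qed.

(** The boxes of [open_rat_box] are countably many and cover the open set. *)
Theorem du_bois_reymond (R : realType) (A : set (plane R)) (g : plane R -> R) :
  open A -> (leb2 R).-integrable A (EFin \o g) ->
  (forall phi, test_function A phi -> \int[leb2 R]_(x in A) (g x * phi x) = 0) ->
  {ae leb2 R, forall x, A x -> g x = 0}.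
Proof.
move=> oA ig g0; have mA := open_plane_measurable oA.
have : {ae leb2 R, forall x n, if unpickle n is Some q then
    rat_cbox R q `<=` A -> rat_box R q x -> g x = 0 else True}.
  apply: ae_foralln => n; case: (unpickle n) => [q|]; last exact: aeW.
  have [qA|nqA] := pselect (rat_cbox R q `<=` A).
    have [N [mN N0 NS]] := box_ae0 mA ig g0 qA.
    by exists N; split => // x /= /not_implyP[_ h]; apply: NS.
  by apply: aeW => x /nqA.
move=> [N [mN N0 NS]]; exists N; split => // x /= /not_implyP[Ax gx]; apply: NS => /= H.
have [q [qx qA]] := open_rat_box oA Ax.
by have := H (pickle q); rewrite pickleK => /(_ qA qx).
Qed.

(** * A potential of order one maps L^2 into L^q *)

(** Young's inequality for [f x] and the [r - 1]-st power of the mean of [f],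
    integrated against [w]. *)
Lemma weighted_jensen d (T : measurableType d) (R : realType)
    (mu : {measure set T -> \bar R}) (D : set T) (f w : T -> R) (r : R) :
  measurable D -> 1 < r -> (forall x, 0 <= f x) -> (forall x, 0 <= w x) ->
  mu.-integrable D (EFin \o w) -> mu.-integrable D (EFin \o (fun x => f x * w x)) ->
  mu.-integrable D (EFin \o (fun x => f x `^ r * w x)) ->
  0 < \int[mu]_(x in D) w x ->
  (\int[mu]_(x in D) (f x * w x)) `^ r <=
  \int[mu]_(x in D) (f x `^ r * w x) * (\int[mu]_(x in D) w x) `^ (r - 1).
Proof.
move=> mD r1 f0 w0 iw ifw ifrw W0.
set W := \int[mu]_(x in D) w x in W0 *.
set X := \int[mu]_(x in D) (f x * w x); set Y := \int[mu]_(x in D) (f x `^ r * w x).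
have X0 : 0 <= X by apply: Rintegral_ge0 => x _; rewrite mulr_ge0.
pose c := X / W; have c0 : 0 <= c by rewrite divr_ge0// ltW.
have XE : X = c * W by rewrite /c divfK// gt_eqF.
have r0 : 0 < r by rewrite (lt_trans ltr01).
have rm0 : 0 < r - 1 by rewrite subr_gt0.
have conj : r^-1 + (r / (r - 1))^-1 = 1 by rewrite invf_div; field; rewrite gt_eqF.
have young x : f x * w x * c `^ (r - 1) <= f x `^ r * w x / r + w x * (c `^ r * (r - 1) / r).
  have := conjugate_powR (f0 x) (powR_ge0 c (r - 1)) r0 (divr_gt0 r0 rm0) conj.
  rewrite -powRrM [(r - 1) * _]mulrC divfK ?gt_eqF// invf_div => h.
  have := ler_wpM2r (w0 x) h; rewrite mulrDl.
  by rewrite mulrAC [_ / r * w x]mulrAC [_ * ((r - 1) / r) * _]mulrC [c `^ r * _]mulrA.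
have : X * c `^ (r - 1) <= Y / r + W * (c `^ r * (r - 1) / r).
  rewrite /X /Y /W -!RintegralZr// -RintegralD//; last 2 first.
  - by have := integrableZr mD (r^-1) ifrw.
  - by have := integrableZr mD (c `^ r * (r - 1) / r) iw.
  apply: le_Rintegral => //.
  - by have := integrableZr mD (c `^ (r - 1)) ifw.
  - have := integrableD mD (integrableZr mD (r^-1) ifrw) (integrableZr mD (c `^ r * (r - 1) / r) iw).
    by [].
have -> : X * c `^ (r - 1) = W * c `^ r.
  by rewrite XE mulrAC mulrC (mulr_powRB1 c0 r0).
move=> h; have {h} : W * c `^ r <= Y.
  have -> : W * c `^ r = (W * c `^ r - W * (c `^ r * (r - 1) / r)) * r by field; rewrite gt_eqF.
  by rewrite -ler_pdivlMr// lerBlDr.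
move=> h; rewrite XE (powRM _ c0 (ltW W0)).
have -> : c `^ r * W `^ r = W * c `^ r * W `^ (r - 1).
  by rewrite -(mulr_powRB1 (ltW W0) r0); ring.
by apply: ler_wpM2r => //; exact: powR_ge0.
Qed.

(** The primitive of a power with exponent above -1 is bounded near 0, uniformly in
    the regularization [delta]. *)
Lemma kernel1_integral (R : realType) (g N : R) : 0 <= g < 1 -> 0 < N ->
  exists2 M : R, 0 < M & forall delta s : R, 0 < delta <= 1 -> - N <= s <= N ->
    (\int[lebesgue_measure]_(t in `[(- N)%R, N]) ((delta + `|s - t|) `^ (- g))%:E <= M%:E)%E.
Proof.
move=> /andP[g0 g1] N0; have g10 : 0 < 1 - g by rewrite subr_gt0.
exists (2 * ((1 + 2 * N) `^ (1 - g) / (1 - g))).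
  by rewrite mulr_gt0// divr_gt0// powR_gt0// ltr_wpDr// mulr_ge0// ltW.
move=> delta s /andP[d0 d1] /andP[sN Ns].
have cab : continuous (fun t : R => delta + `|s - t|).
  move=> t; apply: cvgD; first exact: cvg_cst.
  by apply: cvg_norm; apply: cvgB; [exact: cvg_cst|exact: cvg_id].
have pos t : 0 < delta + `|s - t| by rewrite ltr_wpDr.
have cp (a x : R) : 0 < x -> {for x, continuous (fun x : R => x `^ a)}.
  move=> x0; apply/differentiable_continuous/derivable1_diffP.
  by apply: derivable_powR; rewrite in_itv/= andbT.
have ck : continuous (fun t : R => (delta + `|s - t|) `^ (- g)).
  move=> t; apply: (@continuous_comp _ _ _ (fun t : R => delta + `|s - t|) (fun x : R => x `^ (- g))).
    exact: cab.
  exact: cp.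
pose G (x : R) := x `^ (1 - g) / (1 - g).
have dG (x : R) : 0 < x -> is_derive x (1 : R) G (x `^ (- g)).
  move=> x0; have d := is_derive1_powR (1 - g) x0; rewrite /G.
  apply: is_derive_eq; rewrite /GRing.scale/= (_ : 1 - g - 1 = - g); last by ring.
  by field; rewrite gt_eqF.
have mk (A : set R) : measurable A ->
    measurable_fun A (EFin \o (fun t : R => (delta + `|s - t|) `^ (- g))).
  by move=> mA; apply/measurable_EFinP; apply: measurable_funTS; exact: continuous_measurable_fun.
have right : (\int[lebesgue_measure]_(t in `[s, N]) ((delta + `|s - t|) `^ (- g))%:E =
    (G (delta + (N - s)) - G delta)%:E)%E.
  have /= := @FTC2_is_derive _ (fun t => G (delta + (t - s))) _ s N Ns ck.
  rewrite subrr addr0; apply => t /andP[st tN].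
  have p : 0 < delta + (t - s) by rewrite ltr_wpDr// subr_ge0.
  have d : is_derive t (1 : R) (fun t : R => delta + (t - s)) 1.
    by apply: is_derive_eq; ring.
  have := @is_derive1_comp _ G (fun t : R => delta + (t - s)) t _ _ (dG _ p) d; rewrite mulr1 => h; apply: (is_derive_eq h).
  by rewrite distrC ger0_norm ?subr_ge0.
have left : (\int[lebesgue_measure]_(t in `[(- N)%R, s]) ((delta + `|s - t|) `^ (- g))%:E =
    (G (delta + (s + N)) - G delta)%:E)%E.
  have /= := @FTC2_is_derive _ (fun t => - G (delta + (s - t))) _ (- N) s sN ck.
  rewrite subrr addr0 !opprK [- _ + _]addrC; apply => t /andP[st tN].
  have p : 0 < delta + (s - t) by rewrite ltr_wpDr// subr_ge0.
  have d : is_derive t (1 : R) (fun t : R => delta + (s - t)) (-1).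
    by apply: is_derive_eq; ring.
  have h := @is_derive1_comp _ G (fun t : R => delta + (s - t)) t _ _ (dG _ p) d.
  have h' := is_deriveN h; apply: (is_derive_eq h').
  by rewrite mulrN1 opprK ger0_norm ?subr_ge0.
have bd (x : R) : 0 <= x <= 2 * N -> G (delta + x) - G delta <= (1 + 2 * N) `^ (1 - g) / (1 - g).
  move=> /andP[x0 x2]; rewrite lerBlDr (@le_trans _ _ ((1 + 2 * N) `^ (1 - g) / (1 - g)))//.
    rewrite ler_pM2r ?invr_gt0//; apply: ge0_ler_powR; rewrite ?nnegrE; [exact: ltW|..].
    - by rewrite addr_ge0// ltW.
    - by rewrite addr_ge0// (le_trans x0).
    - exact: lerD.
  by rewrite lerDl divr_ge0// ?powR_ge0// ltW.
have -> : `[(- N)%R, N]%classic = `[(- N)%R, s]%classic `|` `]s, N]%classic :> set R.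
  by rewrite -itv_bndbnd_setU// bnd_simp.
rewrite ge0_integral_setU//=; last 3 first.
- exact: mk (measurableU _ _ _ _).
- by move=> t _; rewrite lee_fin powR_ge0.
- apply/disj_set2P/seteqP; split => // t /=; rewrite !in_itv/= => -[/andP[_ h] /andP[h' _]].
  by move: h'; rewrite ltNge h.
rewrite left integral_itv_obnd_cbnd; last exact: mk.
rewrite right -EFinD lee_fin mulr2n mulrDl !mul1r lerD// bd//; apply/andP; split; lra.
Qed.

(** Dominates 1/|z| up to a factor, as the arithmetic mean of |z.1| and |z.2|
    dominates the geometric one, but is a product of functions of one coordinate,
    so that its integrals factor.  The regularization [delta] makes it bounded. *)
Definition kernel (R : realType) (delta : R) (z : plane R) : R :=
  (delta + `|z.1|) `^ (- 2^-1) * (delta + `|z.2|) `^ (- 2^-1).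

Lemma kernel_gt0 (R : realType) (delta : R) (z : plane R) : 0 < delta -> 0 < kernel delta z.
Proof. by move=> d0; rewrite mulr_gt0// powR_gt0// ltr_wpDr. Qed.

Lemma kernel_ge0 (R : realType) (delta : R) (z : plane R) : 0 <= kernel delta z.
Proof. by rewrite mulr_ge0// powR_ge0. Qed.

Lemma kernelX (R : realType) (delta b : R) (z : plane R) : 0 < delta ->
  kernel delta z `^ b = (delta + `|z.1|) `^ (- (b / 2)) * (delta + `|z.2|) `^ (- (b / 2)).
Proof.
by move=> d0; rewrite /kernel powRM ?powR_ge0// -!powRrM mulNr [2^-1 * b]mulrC.
Qed.

Lemma kernel_le (R : realType) (delta : R) (z : plane R) : 0 < delta -> kernel delta z <= delta^-1.
Proof.
move=> d0; have h (t : R) : (delta + `|t|) `^ (- 2^-1) <= delta `^ (- 2^-1).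
  have dt : delta <= delta + `|t| by rewrite lerDl.
  rewrite !powRN lef_pV2 ?posrE ?powR_gt0 ?ltr_wpDr//.
  by apply: ge0_ler_powR; rewrite ?nnegrE; [rewrite invr_ge0|exact: ltW|rewrite addr_ge0// ltW|].
apply: (le_trans (ler_pM (powR_ge0 _ _) (powR_ge0 _ _) (h _) (h _))).
rewrite -powRD ?(gt_eqF d0) ?implybT// -opprD (_ : 2^-1 + 2^-1 = 1); last by field.
by rewrite powR_inv1// ltW.
Qed.

Lemma kernel_ge (R : realType) (delta N : R) (x y : plane R) : 0 < delta -> delta <= 1 ->
  square N x -> square N y -> (1 + 2 * N)^-1 <= kernel delta (x - y).
Proof.
move=> d0 d1 [/itvP x1 /itvP x2] [/itvP y1 /itvP y2].
have h (s t : R) : - N <= s -> s <= N -> - N <= t -> t <= N ->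
    (1 + 2 * N) `^ (- 2^-1) <= (delta + `|s - t|) `^ (- 2^-1).
  move=> s1 s2 t1 t2; have N0 : 0 <= N by lra.
  have st : `|s - t| <= 2 * N by rewrite ler_norml; apply/andP; split; lra.
  have p1 : 0 < 1 + 2 * N by lra.
  have p2 : 0 < delta + `|s - t| by rewrite ltr_wpDr.
  rewrite !powRN lef_pV2 ?posrE ?powR_gt0//.
  apply: ge0_ler_powR; rewrite ?nnegrE; [by rewrite invr_ge0|exact: ltW|exact: ltW|].
  exact: lerD.
have N0 : 0 < 1 + 2 * N.
  have h1 : - N <= x.1 by rewrite x1.
  have h2 : x.1 <= N by rewrite x1.
  by clear x1 x2 y1 y2 h; lra.
apply: le_trans (ler_pM (powR_ge0 _ _) (powR_ge0 _ _) (h x.1 y.1 _ _ _ _) (h x.2 y.2 _ _ _ _));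
  rewrite ?x1 ?x2 ?y1 ?y2//.
rewrite -powRD ?(gt_eqF N0) ?implybT// -opprD (_ : 2^-1 + 2^-1 = 1); last by field.
by rewrite powR_inv1// ltW.
Qed.

Lemma measurable_kernel_comp d (T : measurableType d) (R : realType) (delta : R)
    (f g : T -> R) :
  measurable_fun setT f -> measurable_fun setT g ->
  measurable_fun setT (fun t => kernel delta (f t, g t)).
Proof.
move=> mf mg; have h (k : T -> R) : measurable_fun setT k ->
    measurable_fun setT (fun t => (delta + `|k t|) `^ (- 2^-1)).
  move=> mk; apply: (measurableT_comp (measurable_powR _)).
  by apply: measurable_funD => //; exact: measurableT_comp.
by apply: measurable_funM; exact: h.
Qed.

Lemma measurable_kernel_sub (R : realType) (delta : R) (x : plane R) :
  measurable_fun setT (fun y : mplane R => kernel delta (x - y)).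
Proof.
by apply: (@measurable_kernel_comp _ (mplane R) _ _ (fun y => x.1 - y.1) (fun y => x.2 - y.2));
  apply: measurable_funB.
Qed.

Lemma tonelli_square (R : realType) (N : R) (h l : R -> R) :
  measurable_fun setT h -> measurable_fun setT l ->
  (forall t, 0 <= h t) -> (forall t, 0 <= l t) ->
  (\int[leb2 R]_(y in square N) (h y.1 * l y.2)%:E =
   (\int[lebesgue_measure]_(t in `[(- N)%R, N]) (h t)%:E) *
   (\int[lebesgue_measure]_(t in `[(- N)%R, N]) (l t)%:E))%E.
Proof.
move=> mh ml h0 l0; rewrite integral_mkcond.
have mf : measurable_fun setT (fun y : mplane R => (h y.1 * l y.2)%:E).
  apply/measurable_EFinP; apply: measurable_funM.
    exact: (measurableT_comp mh (@measurable_fst _ _ (measurableTypeR R) (measurableTypeR R))).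
  exact: (measurableT_comp ml (@measurable_snd _ _ (measurableTypeR R) (measurableTypeR R))).
rewrite fubini_tonelli1; last 2 first.
- rewrite -measurable_restrictT; last exact: measurable_square.
  exact: measurable_funTS.
- by move=> y; rewrite patchE; case: ifP => _ //; rewrite lee_fin mulr_ge0.
have mI : measurable (`[(- N)%R, N]%classic : set (measurableTypeR R)) by exact: measurable_itv.
pose L := (\int[@lebesgue_measure R]_(t in `[(- N)%R, N]) (l t)%:E)%E; rewrite -/L.
have L0 : (0 <= L)%E by apply: integral_ge0 => t _; rewrite lee_fin.
transitivity (\int[@lebesgue_measure R]_(s in `[(- N)%R, N]) ((h s)%:E * L))%E.
  rewrite [RHS]integral_mkcond; apply: eq_integral => s _.
  rewrite /fubini_F [RHS]patchE; case: ifPn => sI; last first.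
    apply: integral0_eq => t _; rewrite patchE memNset// => -[/= sN _].
    by move/negP: sI; apply; rewrite inE.
  rewrite /L -ge0_integralZl//; last 3 first.
  - by apply/measurable_EFinP; apply: measurable_funTS.
  - by move=> t _; rewrite lee_fin.
  - by rewrite lee_fin.
  rewrite [RHS]integral_mkcond; apply: eq_integral => t _; rewrite !patchE.
  congr (if _ then _ else _); apply/idP/idP; rewrite !inE /square/=.
    by move=> [].
  by move=> tN; split => //; rewrite inE in sI.
rewrite ge0_integralZr//.
- by apply/measurable_EFinP; apply: measurable_funTS.
- by move=> t _; rewrite lee_fin.
Qed.

(** The square of the kernel is the borderline case: each factor is a power with
    exponent - b / 2 > -1. *)
Lemma kernel_powR_integral (R : realType) (b N : R) : 0 <= b < 2 -> 0 < N ->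
  exists2 M : R, 0 < M & forall (delta : R) (x : plane R), 0 < delta <= 1 -> square N x ->
    (\int[leb2 R]_(y in square N) (kernel delta (x - y) `^ b)%:E <= M%:E)%E.
Proof.
move=> /andP[b0 b2] N0.
have [|M M0 HM] := @kernel1_integral R (b / 2) N _ N0; first by apply/andP; split; lra.
exists (M * M); first exact: mulr_gt0.
move=> delta x d01 [/= x1 x2]; have /andP[d0 d1] := d01.
under eq_integral do rewrite kernelX//.
have mk (s : R) : measurable_fun setT (fun t : R => (delta + `|s - t|) `^ (- (b / 2))).
  apply: (measurableT_comp (measurable_powR _)); apply: measurable_funD => //.
  by apply: measurableT_comp => //; exact: measurable_funB.
rewrite (@tonelli_square _ N (fun t => (delta + `|x.1 - t|) `^ (- (b / 2)))
  (fun t => (delta + `|x.2 - t|) `^ (- (b / 2))))//; last 2 first.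
- by move=> t; exact: powR_ge0.
- by move=> t; exact: powR_ge0.
rewrite EFinM; apply: lee_pmul.
- by apply: integral_ge0 => t _; rewrite lee_fin powR_ge0.
- by apply: integral_ge0 => t _; rewrite lee_fin powR_ge0.
- by apply: HM => //; move: x1; rewrite in_itv.
- by apply: HM => //; move: x2; rewrite in_itv.
Qed.

Lemma sigma_finite_leb2 (R : realType) : sigma_finite setT (leb2 R).
Proof.
exists (fun n => square n%:R); last first.
  by move=> n; split; [exact: measurable_square|exact: square_lty].
apply/seteqP; split => // -[x y] _.
have h (t : R) n : (Num.truncn (`|x| + `|y|)).+1 = n -> `|t| <= `|x| + `|y| -> t \in `[- n%:R, n%:R].
  move=> <- tl; rewrite in_itv/= -ler_norml (le_trans tl)// ltW//.
  by rewrite truncnS_gt.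
by exists (Num.truncn (`|x| + `|y|)).+1 => //; split; apply: h; rewrite //= ?lerDl ?lerDr.
Qed.

(** Lebesgue measure of the plane as a sigma-finite measure, the form in which
    the theorem of Fubini and Tonelli applies to it. *)
Definition leb2sf (R : realType) : {sigma_finite_measure set (mplane R) -> \bar R} :=
  HB.pack (leb2 R) (Measure_isSigmaFinite.Build _ _ _ (leb2 R) (@sigma_finite_leb2 R)).

Lemma tonelli_leb2 (R : realType) (f : mplane R * mplane R -> \bar R) :
  measurable_fun setT f -> (forall z, 0 <= f z)%E ->
  (\int[leb2 R]_x \int[leb2 R]_y f (x, y) = \int[leb2 R]_y \int[leb2 R]_x f (x, y))%E.
Proof. exact: (@fubini_tonelli _ _ _ _ R (leb2sf R) (leb2sf R) f). Qed.

Lemma measurable_tonelli_leb2 (R : realType) (f : mplane R * mplane R -> \bar R) :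
  measurable_fun setT f -> (forall z, 0 <= f z)%E ->
  measurable_fun setT (fun y => \int[leb2 R]_x f (x, y))%E.
Proof. exact: (@measurable_fun_fubini_tonelli_G _ _ _ _ R (leb2sf R) f). Qed.

Lemma measurable_kernel_prod (R : realType) (delta : R) :
  measurable_fun setT (fun z : mplane R * mplane R => kernel delta (z.1 - z.2)).
Proof.
have m1 : measurable_fun setT (fst : mplane R * mplane R -> mplane R) by exact: measurable_fst.
have m2 : measurable_fun setT (snd : mplane R * mplane R -> mplane R) by exact: measurable_snd.
have c1 : measurable_fun setT (fst : mplane R -> measurableTypeR R) by exact: measurable_fst.
have c2 : measurable_fun setT (snd : mplane R -> measurableTypeR R) by exact: measurable_snd.
apply: (@measurable_kernel_comp _ _ R delta
  (fun z : mplane R * mplane R => z.1.1 - z.2.1) (fun z : mplane R * mplane R => z.1.2 - z.2.2)).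
- apply: (@measurable_funB _ _ R setT (fun z : mplane R * mplane R => z.1.1)
    (fun z : mplane R * mplane R => z.2.1)).
    exact: (measurableT_comp c1 m1).
  exact: (measurableT_comp c1 m2).
- apply: (@measurable_funB _ _ R setT (fun z : mplane R * mplane R => z.1.2)
    (fun z : mplane R * mplane R => z.2.2)).
    exact: (measurableT_comp c2 m1).
  exact: (measurableT_comp c2 m2).
Qed.

Lemma kernelC (R : realType) (delta : R) (x y : plane R) :
  kernel delta (x - y) = kernel delta (y - x).
Proof. by rewrite /kernel/= distrC [`|x.2 - y.2|]distrC. Qed.

Lemma measurable_kernel_integral (R : realType) (N delta : R) (w : plane R -> R) :
  measurable_fun setT (w : mplane R -> R) -> (forall y, 0 <= w y) ->
  measurable_fun setT
    (fun x : mplane R => \int[leb2 R]_(y in square N) (w y * kernel delta (x - y))%:E)%E.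
Proof.
move=> mw w0; have mS := @measurable_square R N.
pose f (z : mplane R * mplane R) : \bar R :=
  (w z.1 * kernel delta (z.1 - z.2) * \1_(square N) z.1)%:E.
have m1 : measurable_fun setT (fst : mplane R * mplane R -> mplane R) by exact: measurable_fst.
have mi : measurable_fun setT (\1_(square N) : mplane R -> R) by exact: measurable_indic.
have mf : measurable_fun setT f.
  apply/measurable_EFinP; apply: measurable_funM; last exact: (measurableT_comp mi m1).
  by apply: measurable_funM; [exact: (measurableT_comp mw m1)|exact: measurable_kernel_prod].
have f0 z : (0 <= f z)%E by rewrite lee_fin !indicE !mulr_ge0 ?ler0n ?powR_ge0 ?w0.
have := measurable_tonelli_leb2 mf f0; congr (measurable_fun _ _); apply/funext => x.
rewrite [RHS]integral_mkcond; apply: eq_integral => y _; rewrite patchE /f/= indicE kernelC.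
by case: ifP => _; rewrite ?mulr1 ?mulr0.
Qed.

Lemma kernel_double_integral (R : realType) (N : R) : 0 < N ->
  exists2 M : R, 0 < M & forall (delta : R) (w : plane R -> R), 0 < delta <= 1 ->
    measurable_fun setT (w : mplane R -> R) -> (forall y, 0 <= w y) ->
    (\int[leb2 R]_(x in square N) \int[leb2 R]_(y in square N) (kernel delta (x - y) * w y)%:E <=
     M%:E * \int[leb2 R]_(y in square N) (w y)%:E)%E.
Proof.
move=> N0; have [|M M0 HM] := @kernel_powR_integral R 1 N _ N0; first by rewrite ler01 ltr1n.
exists M => // delta w d01 mw w0; have /andP[d0 d1] := d01.
pose f (z : mplane R * mplane R) : \bar R :=
  (kernel delta (z.1 - z.2) * w z.2 * (\1_(square N) z.1 * \1_(square N) z.2))%:E.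
have mS := @measurable_square R N.
have f0 z : (0 <= f z)%E by rewrite lee_fin !indicE !mulr_ge0 ?ler0n ?powR_ge0 ?w0.
have m1 : measurable_fun setT (fst : mplane R * mplane R -> mplane R) by exact: measurable_fst.
have m2 : measurable_fun setT (snd : mplane R * mplane R -> mplane R) by exact: measurable_snd.
have mf : measurable_fun setT f.
  apply/measurable_EFinP; apply: measurable_funM; first apply: measurable_funM.
  - exact: measurable_kernel_prod.
  - exact: (measurableT_comp mw m2).
  - have mi : measurable_fun setT (\1_(square N) : mplane R -> R) by exact: measurable_indic.
    apply: measurable_funM; [exact: (measurableT_comp mi m1)|exact: (measurableT_comp mi m2)].
have LE : (\int[leb2 R]_(x in square N) \int[leb2 R]_(y in square N) (kernel delta (x - y) * w y)%:E =
    \int[leb2 R]_x \int[leb2 R]_y f (x, y))%E.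
  rewrite [LHS]integral_mkcond; apply: eq_integral => x _.
  rewrite patchE; case: ifPn => xS.
    rewrite [LHS]integral_mkcond; apply: eq_integral => y _.
    by rewrite patchE /f/= !indicE xS mul1r; case: ifP => _; rewrite ?mulr1 ?mulr0.
  by rewrite integral0_eq// => y _; rewrite /f/= !indicE (negbTE xS) mul0r mulr0.
rewrite LE tonelli_leb2//.
have RE : (\int[leb2 R]_y \int[leb2 R]_x f (x, y) = \int[leb2 R]_(y in square N)
     \int[leb2 R]_(x in square N) (kernel delta (y - x) * w y)%:E)%E.
  rewrite [RHS]integral_mkcond; apply: eq_integral => y _.
  rewrite patchE; case: ifPn => yS.
    rewrite [RHS]integral_mkcond; apply: eq_integral => x _.
    rewrite patchE /f/= !indicE yS mulr1.
    rewrite kernelC.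
    by case: ifP => _; rewrite ?mulr1 ?mulr0.
  by rewrite integral0_eq// => x _; rewrite /f/= !indicE (negbTE yS) !mulr0.
have mwS : measurable_fun (square N) (fun y : mplane R => (w y)%:E).
  by apply/measurable_EFinP; exact: measurable_funTS.
have Z : (M%:E * \int[leb2 R]_(y in square N) (w y)%:E =
    \int[leb2 R]_(y in square N) (M%:E * (w y)%:E))%E.
  by apply/esym/ge0_integralZl => [||y _|]; rewrite ?lee_fin// ltW.
rewrite RE Z; apply: ge0_le_integral; first exact: mS.
- by move=> y _; apply: integral_ge0 => x _; rewrite lee_fin mulr_ge0// kernel_ge0.
- apply: (eq_measurable_fun (fun y => \int[leb2 R]_x f (x, y))%E); last first.
    exact: measurable_funTS (measurable_tonelli_leb2 mf f0).
  move=> y yS; rewrite [RHS]integral_mkcond; apply: eq_integral => x _.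
  rewrite patchE /f/= !indicE yS mulr1.
  rewrite kernelC.
  by case: ifP => _; rewrite ?mulr1 ?mulr0.
- exact: measurable_funeM.
- move=> y yS.
  have k0 x : (0 <= (kernel delta (y - x))%:E)%E by rewrite lee_fin kernel_ge0.
  have -> : (\int[leb2 R]_(x in square N) (kernel delta (y - x) * w y)%:E =
      (\int[leb2 R]_(x in square N) (kernel delta (y - x))%:E) * (w y)%:E)%E.
    under eq_integral do rewrite EFinM.
    apply: ge0_integralZr; [exact: mS|..].
    + apply/measurable_EFinP; apply: measurable_funTS; exact: measurable_kernel_sub.
    + by move=> x _.
    + by rewrite lee_fin.
  apply: lee_pmul; [by apply: integral_ge0|by rewrite lee_fin| |exact: lexx].
  have -> : (\int[leb2 R]_(x in square N) (kernel delta (y - x))%:E =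
      \int[leb2 R]_(x in square N) (kernel delta (y - x) `^ 1)%:E)%E.
    by apply: eq_integral => x _; rewrite powRr1 ?kernel_ge0.
  exact: HM.
Qed.

Definition riesz (R : realType) (N delta : R) (u : plane R -> R) (x : plane R) : R :=
  \int[leb2 R]_(y in square N) (u y * kernel delta (x - y)).

(** With q = 2 r and a = 1 / r, write the kernel k as k^(a/2) k^(1 - a/2).  The
    Cauchy-Schwarz inequality gives (int u k)^2 <= (int u^2 k^a) (int k^(2 - a)),
    whose last factor is bounded because 2 - a < 2.  Jensen's inequality for the
    measure u^2 dy gives (int u^2 k^a)^r <= (int u^2 k) (int u^2)^(r - 1), and
    integrating in x with int k <= M leaves a multiple of (int u^2)^r. *)
Lemma riesz_bound (R : realType) (N q : R) : 0 < N -> 2 < q ->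
  exists2 C : R, 0 < C & forall (delta B : R) (u : plane R -> R), 0 < delta <= 1 ->
    measurable_fun setT (u : mplane R -> R) -> (forall y, 0 <= u y <= B) ->
    0 < \int[leb2 R]_(y in square N) (u y ^+ 2) ->
    (\int[leb2 R]_(x in square N) ((riesz N delta u x) `^ q)%:E <=
      (C * (\int[leb2 R]_(y in square N) (u y ^+ 2)) `^ (q / 2))%:E)%E.
Proof.
move=> N0 q2; pose r := q / 2; have r1 : 1 < r by rewrite /r; lra.
have r0 : 0 < r by lra.
pose a := r^-1; have a0 : 0 < a by rewrite invr_gt0.
have a1 : a < 1 by rewrite invf_lt1.
have [|M1 M10 HM1] := @kernel_powR_integral R (2 - a) N _ N0; first by apply/andP; split; lra.
have [M2 M20 HM2] := @kernel_double_integral R N N0.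
exists (M1 `^ r * M2); first by rewrite mulr_gt0// powR_gt0.
move=> delta B u d01 mu uB V0; have /andP[d0 d1] := d01.
have mS := @measurable_square R N.
set V := \int[leb2 R]_(y in square N) (u y ^+ 2) in V0 *.
have u0 y : 0 <= u y by have /andP[] := uB y.
have uB' y : u y <= B by have /andP[] := uB y.
have mk x : measurable_fun setT (fun y : mplane R => kernel delta (x - y)).
  exact: measurable_kernel_sub.
have mkp x b : measurable_fun setT (fun y : mplane R => kernel delta (x - y) `^ b).
  exact: (measurableT_comp (measurable_powR b) (mk x)).
have k0 z : 0 < kernel delta z by exact: kernel_gt0.
have kb b z : 0 <= b -> kernel delta z `^ b <= (delta^-1) `^ b.
  move=> b0; apply: ge0_ler_powR; rewrite ?nnegrE//; [exact: ltW|by rewrite invr_ge0 ltW|].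
  exact: kernel_le.
have B0 : 0 <= B by exact: le_trans (u0 0) (uB' 0).
(* everything below is bounded and measurable on a square, hence integrable *)
have intg (n : nat) x b : 0 <= b -> (leb2 R).-integrable (square N)
    (EFin \o (fun y => u y ^+ n * kernel delta (x - y) `^ b)).
  move=> b0; apply: (@bounded_integrable _ N (B ^+ n * (delta^-1) `^ b)) => //.
    apply: measurable_funTS; apply: measurable_funM => //.
    exact: measurable_funX.
  move=> y _; rewrite ger0_norm ?mulr_ge0 ?exprn_ge0 ?powR_ge0//.
  by apply: ler_pM; rewrite ?exprn_ge0 ?powR_ge0// ?kb// lerXn2r ?nnegrE.
have kE z : kernel delta z `^ 1 = kernel delta z by rewrite powRr1// kernel_ge0.
(* a = 1 / r is the exponent of the kernel kept with u^2 *)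
pose J x := \int[leb2 R]_(y in square N) (u y ^+ 2 * kernel delta (x - y) `^ a).
pose K x := \int[leb2 R]_(y in square N) (u y ^+ 2 * kernel delta (x - y)).
have I0 x : 0 <= riesz N delta u x.
  by apply: Rintegral_ge0 => y _; rewrite mulr_ge0// kernel_ge0.
have J0 x : 0 <= J x.
  by apply: Rintegral_ge0 => y _; rewrite mulr_ge0 ?sqr_ge0 ?powR_ge0.
have step1 x : square N x -> riesz N delta u x ^+ 2 <= J x * M1.
  move=> Sx.
  have E1 y : u y * kernel delta (x - y) `^ (a - 1) * kernel delta (x - y) `^ (2 - a) =
      u y ^+ 1 * kernel delta (x - y) `^ 1.
    rewrite expr1 -mulrA -powRD; last by rewrite (gt_eqF (k0 _)) implybT.
    by congr (_ * _ `^ _); ring.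
  have E2 y : (u y * kernel delta (x - y) `^ (a - 1)) `^ 2 * kernel delta (x - y) `^ (2 - a) =
      u y ^+ 2 * kernel delta (x - y) `^ a.
    rewrite powRM ?powR_ge0// -powRrM -(powR_mulrn 2 (u0 y)) -mulrA -powRD; last first.
      by rewrite (gt_eqF (k0 _)) implybT.
    by congr (_ * _ `^ _); ring.
  have iw := intg 0%N x (2 - a) _.
  have iw' : (leb2 R).-integrable (square N) (EFin \o (fun y => kernel delta (x - y) `^ (2 - a))).
    have := intg 0%N x (2 - a); rewrite subr_ge0 (le_trans (ltW a1)) ?ler1n// => /(_ isT).
    by under eq_fun do rewrite expr0 mul1r.
  have W0 : 0 < \int[leb2 R]_(y in square N) (kernel delta (x - y) `^ (2 - a)).
    pose c := (1 + 2 * N)^-1 `^ (2 - a).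
    have c0 : 0 < c by rewrite powR_gt0// invr_gt0; lra.
    apply: (@lt_le_trans _ _ (\int[leb2 R]_(y in square N) (cst c y))).
      rewrite Rintegral_cst//; apply: mulr_gt0 => //; apply: fine_gt0.
      rewrite square_lty andbT [X in (_ < X)%E]product_measure1E; [|exact: measurable_itv..].
      have E : (0 < lebesgue_measure (`[(- N)%R, N]%classic : set R))%E.
        by rewrite lebesgue_measure_itv/= lte_fin ifT ?lte_fin//; lra.
      exact: mule_gt0.
    apply: le_Rintegral => //.
      apply: (@bounded_integrable _ N c) => //.
      by move=> y _; rewrite ger0_norm// ltW.
    move=> y Sy; apply: ge0_ler_powR; rewrite ?nnegrE.
    - by rewrite subr_ge0 (le_trans (ltW a1))// ler1n.
    - by rewrite invr_ge0; lra.
    - exact: ltW.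
    - exact: kernel_ge.
  pose f y := u y * kernel delta (x - y) `^ (a - 1).
  pose w y := kernel delta (x - y) `^ (2 - a).
  have e1 : \int[leb2 R]_(y in square N) (f y * w y) = riesz N delta u x.
    by apply: eq_Rintegral => y _; rewrite E1 expr1 kE.
  have e2 : \int[leb2 R]_(y in square N) (f y `^ 2 * w y) = J x.
    by apply: eq_Rintegral => y _; exact: E2.
  have i1 : (leb2 R).-integrable (square N) (EFin \o (fun y => f y * w y)).
    by under eq_fun do rewrite E1; exact: intg.
  have i2 : (leb2 R).-integrable (square N) (EFin \o (fun y => f y `^ 2 * w y)).
    by under eq_fun do rewrite E2; exact: intg (ltW a0).
  have f0 y : 0 <= f y by rewrite mulr_ge0 ?powR_ge0.
  have w0 y : 0 <= w y by exact: powR_ge0.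
  have := weighted_jensen mS (ltr1n _ 2) f0 w0 iw' i1 i2 W0.
  rewrite e1 e2 (powR_mulrn 2 (I0 x)) => h; apply: (le_trans h).
  rewrite (_ : 2 - 1 = 1); last by ring.
  rewrite powRr1; last exact: ltW.
  apply: ler_wpM2l; first exact: J0.
  rewrite -lee_fin fineK; last exact: (integrable_fin_num mS iw').
  exact: HM1.
have step2 x : J x `^ r <= K x * V `^ (r - 1).
  have E1 y : kernel delta (x - y) `^ a * u y ^+ 2 = u y ^+ 2 * kernel delta (x - y) `^ a.
    by rewrite mulrC.
  have E2 y : (kernel delta (x - y) `^ a) `^ r * u y ^+ 2 = u y ^+ 2 * kernel delta (x - y) `^ 1.
    by rewrite -powRrM mulVf ?gt_eqF// mulrC.
  have iw : (leb2 R).-integrable (square N) (EFin \o (fun y => u y ^+ 2)).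
    have := intg 2%N x 0 (lexx 0).
    by under eq_fun do rewrite powRr0 mulr1.
  pose f y := kernel delta (x - y) `^ a.
  have f0 y : 0 <= f y by exact: powR_ge0.
  have e1 : \int[leb2 R]_(y in square N) (f y * u y ^+ 2) = J x.
    by apply: eq_Rintegral => y _; exact: E1.
  have e2 : \int[leb2 R]_(y in square N) (f y `^ r * u y ^+ 2) = K x.
    by apply: eq_Rintegral => y _; rewrite E2 kE.
  have i1 : (leb2 R).-integrable (square N) (EFin \o (fun y => f y * u y ^+ 2)).
    by under eq_fun do rewrite E1; exact: intg (ltW a0).
  have i2 : (leb2 R).-integrable (square N) (EFin \o (fun y => f y `^ r * u y ^+ 2)).
    by under eq_fun do rewrite E2; exact: intg.
  have := weighted_jensen mS r1 f0 (fun y => sqr_ge0 (u y)) iw i1 i2 V0.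
  by rewrite e1 e2.
have step x : square N x -> riesz N delta u x `^ q <= M1 `^ r * V `^ (r - 1) * K x.
  move=> Sx; have -> : q = 2 * r by rewrite /r; field.
  rewrite powRrM powR_mulrn//.
  apply: (@le_trans _ _ ((J x * M1) `^ r)).
    apply: ge0_ler_powR; rewrite ?nnegrE; [exact: ltW|exact: sqr_ge0| |exact: step1].
    by rewrite mulr_ge0// ltW.
  rewrite (powRM _ (J0 x) (ltW M10)) mulrC -mulrA; apply: ler_wpM2l; first exact: powR_ge0.
  by rewrite mulrC step2.
have iK x : (leb2 R).-integrable (square N) (EFin \o (fun y => u y ^+ 2 * kernel delta (x - y))).
  have := intg 2%N x 1 ler01.
  by under eq_fun do rewrite kE.
have KE x : (K x)%:E = (\int[leb2 R]_(y in square N) (u y ^+ 2 * kernel delta (x - y))%:E)%E.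
  by rewrite fineK; last exact: (integrable_fin_num mS (iK x)).
have IE x : (riesz N delta u x)%:E = (\int[leb2 R]_(y in square N) (u y * kernel delta (x - y))%:E)%E.
  rewrite fineK//; have := intg 1%N x 1 ler01.
  by under eq_fun do rewrite expr1 kE; exact: integrable_fin_num.
have mu2 : measurable_fun setT (fun y : mplane R => u y ^+ 2) by exact: measurable_funX.
have mI : measurable_fun setT (riesz N delta u : mplane R -> R).
  apply/measurable_EFinP; rewrite (_ : _ \o _ = fun x => (riesz N delta u x)%:E)//.
  under eq_fun do rewrite IE; exact: measurable_kernel_integral.
have mK : measurable_fun setT (EFin \o K : mplane R -> \bar R).
  rewrite (_ : _ \o _ = fun x => (K x)%:E)//.
  by under eq_fun do rewrite KE; apply: measurable_kernel_integral => // y; exact: sqr_ge0.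
have c0 : 0 < M1 `^ r * V `^ (r - 1) by rewrite mulr_gt0// powR_gt0.
have K0 x : 0 <= K x by apply: Rintegral_ge0 => y _; rewrite mulr_ge0 ?sqr_ge0 ?kernel_ge0.
apply: (@le_trans _ _ (\int[leb2 R]_(x in square N) ((M1 `^ r * V `^ (r - 1))%:E * (K x)%:E))%E).
  apply: ge0_le_integral; first exact: mS.
  - by move=> x _; rewrite lee_fin powR_ge0.
  - apply/measurable_EFinP; apply: measurable_funTS.
    exact: (measurableT_comp (measurable_powR q) mI).
  - by apply: measurable_funeM; exact: measurable_funTS.
  - by move=> x Sx; rewrite -EFinM lee_fin; exact: step.
have -> : (\int[leb2 R]_(x in square N) ((M1 `^ r * V `^ (r - 1))%:E * (K x)%:E) =
    (M1 `^ r * V `^ (r - 1))%:E * \int[leb2 R]_(x in square N) (K x)%:E)%E.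
  apply: (@ge0_integralZl _ _ _ (leb2 R) _ mS (EFin \o K)).
  - exact: measurable_funTS.
  - by move=> x _; rewrite lee_fin.
  - by rewrite lee_fin ltW.
have h : (\int[leb2 R]_(x in square N) (K x)%:E <= (M2 * V)%:E)%E.
  have := HM2 delta (fun y => u y ^+ 2) d01 mu2 (fun y => sqr_ge0 _).
  have -> : (M2%:E * \int[leb2 R]_(y in square N) (u y ^+ 2)%:E)%E = (M2 * V)%:E.
    rewrite EFinM fineK//; have := intg 2%N 0 0 (lexx 0).
    by under eq_fun do rewrite powRr0 mulr1; exact: integrable_fin_num.
  apply: le_trans; rewrite le_eqVlt; apply/orP; left; apply/eqP; apply: eq_integral => x _.
  by rewrite KE; apply: eq_integral => y _; rewrite mulrC.
apply: (le_trans (lee_wpmul2l _ h)); first by rewrite lee_fin ltW.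
rewrite -EFinM lee_fin -(mulr_powRB1 (ltW V0) r0) le_eqVlt; apply/orP; left; apply/eqP; ring.
Qed.

(** * Fluxes of the potential of a piecewise constant function *)

Definition pwconst (R : realType) (L : seq (tri R)) (val : tri R -> R) (x : plane R) : R :=
  \sum_(t <- L) val t * \1_(optri t) x.

(** Flux through PQ of the superposition, with density the piecewise constant
    function, of the fields whose divergences are Dirac masses. *)
Definition flux (R : realType) (L : seq (tri R)) (val : tri R -> R) (P Q : plane R) : R :=
  \int[leb2 R]_y (pwconst L val y * subtended (P - y) (Q - y)).

Lemma measurable_optri (R : realType) (t : tri R) : measurable (optri t).
Proof. exact: measurable_open_triangle. Qed.

Lemma measurable_pwconst (R : realType) (L : seq (tri R)) (val : tri R -> R) :
  measurable_fun setT (pwconst L val : mplane R -> R).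
Proof.
rewrite /pwconst; elim: L => [|t L IH].
  by under eq_fun do rewrite big_nil; exact: measurable_cst.
under eq_fun do rewrite big_cons; apply: measurable_funD => //.
apply: measurable_funM => //; apply: measurable_indic; exact: measurable_optri.
Qed.

Lemma pwconst_le (R : realType) (L : seq (tri R)) (val : tri R -> R) x :
  `|pwconst L val x| <= \sum_(t <- L) `|val t|.
Proof.
rewrite (le_trans (ler_norm_sum _ _ _))// ler_sum// => t _.
by rewrite normrM ler_piMr// indicE; case: (_ \in _); rewrite ?normr1 ?normr0.
Qed.

Lemma measurable_if_ge0 d (T : measurableType d) (R : realType) (f g h : T -> R) :
  measurable_fun setT f -> measurable_fun setT g -> measurable_fun setT h ->
  measurable_fun setT (fun x => if 0 <= f x then g x else h x).
Proof.
move=> mf mg mh; apply: measurable_fun_ifT => //.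
exact: measurable_fun_ler.
Qed.

Lemma measurable_pseudo_angle (R : realType) (P : plane R) :
  measurable_fun setT (fun y : mplane R => pseudo_angle (P - y)).
Proof.
have m1 : measurable_fun setT (fun y : mplane R => (P - y).1).
  by apply: (@measurable_funB _ (mplane R) R setT (cst P.1) fst).
have m2 : measurable_fun setT (fun y : mplane R => (P - y).2).
  by apply: (@measurable_funB _ (mplane R) R setT (cst P.2) snd).
have mn : measurable_fun setT (fun y : mplane R => l1norm (P - y)).
  by apply: measurable_funD; apply: measurableT_comp.
rewrite /pseudo_angle; apply: measurable_funM => //; apply: measurable_funM.
  by apply: measurable_if_ge0.
apply: measurable_funB => //; apply: measurable_funM => //.
apply: (eq_measurable_fun (fun y : mplane R => l1norm (P - y) `^ (-1))).
  by move=> y _; rewrite powR_inv1// l1norm_ge0.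
exact: (measurableT_comp (measurable_powR (-1)) mn).
Qed.

Lemma measurable_crossing (R : realType) (P Q : plane R) :
  measurable_fun setT (fun y : mplane R => crossing (P - y) (Q - y)).
Proof.
have m2 (P' : plane R) : measurable_fun setT (fun y : mplane R => (P' - y).2).
  by apply: (@measurable_funB _ (mplane R) R setT (cst P'.2) snd).
have mc : measurable_fun setT (fun y : mplane R => crs (P - y) (Q - y)).
  by apply: continuous_plane_measurable; exact: continuous_crs_sub.
rewrite /crossing; apply: measurable_fun_ifT => //.
  apply: measurable_and; first exact: measurable_fun_ler.
  by apply: measurable_and; exact: measurable_fun_ltr.
apply: measurable_fun_ifT => //.
apply: measurable_and; first exact: measurable_fun_ltr.
by apply: measurable_and; [exact: measurable_fun_ler|exact: measurable_fun_ltr].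
Qed.

Lemma measurable_subtended (R : realType) (P Q : plane R) :
  measurable_fun setT (fun y : mplane R => subtended (P - y) (Q - y)).
Proof.
apply: measurable_funD; last exact: measurable_crossing.
by apply: measurable_funB; exact: measurable_pseudo_angle.
Qed.

Section discrete_flux.
Context (R : realType) (A : set (plane R)) (L : seq (tri R)) (mL : ccw_mesh A L).
Context (val : tri R -> R).
Context (N : R) (LN : forall (t : tri R) P, t \in L -> P \in verts t -> square N P).

Local Notation pw := (pwconst L val).

Lemma optri_square (t : tri R) : t \in L -> optri t `<=` square N.
Proof.
move=> tL; apply: open_triangle_square; apply: (LN tL); rewrite !inE eqxx ?orbT//.
Qed.

Lemma pwconst_in (t : tri R) x : t \in L -> optri t x -> pw x = val t.
Proof.
move=> tL tx; rewrite /pwconst (big_rem t)//= indicE mem_set// mulr1 big_seq big1 ?addr0//.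
move=> t' t'L; rewrite indicE memNset ?mulr0// => t'x.
have /(open_closed_eq mL tL) := mem_rem t'L => /(_ _ tx (optri_cltri t'x)) E.
by move: t'L; rewrite -E mem_rem_uniqF// (mesh_uniq_seq mL).
Qed.

Lemma pwconst_out x : ~ square N x -> pw x = 0.
Proof.
move=> nx; rewrite /pwconst big_seq big1// => t tL; rewrite indicE memNset ?mulr0//.
by move=> /(optri_square tL).
Qed.

Lemma integrable_pwconst_mul (f : plane R -> R) (B : R) :
  measurable_fun setT (f : mplane R -> R) -> (forall y, `|f y| <= B) ->
  (leb2 R).-integrable setT (EFin \o (fun y => pw y * f y)).
Proof.
move=> mf fB.
have -> : EFin \o (fun y => pw y * f y) = (EFin \o (fun y => pw y * f y)) \_ (square N).
  apply/funext => y; rewrite patchE; case: ifPn => // /negP; rewrite inE => /pwconst_out.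
  by move=> /= ->; rewrite mul0r.
rewrite -integrable_mkcond; last exact: measurable_square.
apply: (@bounded_integrable _ N ((\sum_(t <- L) `|val t|) * B)) => //.
- exact: measurable_square.
- apply: measurable_funTS; apply: measurable_funM => //; exact: measurable_pwconst.
- by move=> y _; rewrite normrM ler_pM// pwconst_le.
Qed.

Lemma fluxC P Q : flux L val Q P = - flux L val P Q.
Proof.
rewrite /flux -mulN1r -RintegralZl//.
  by apply: eq_Rintegral => y _; rewrite subtendedC mulN1r mulrN.
apply: (integrable_pwconst_mul (B := 2)); first exact: measurable_subtended.
by move=> y; exact: subtended_le.
Qed.

Lemma integral_pwconst_optri (t : tri R) : t \in L ->
  \int[leb2 R]_(y in optri t) pw y = val t * (crs (t.1.2 - t.1.1) (t.2 - t.1.1) / 2).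
Proof.
move=> tL; have ct := mesh_ccw mL tL.
rewrite -(open_triangle_area ct) -Rintegral_cst; last exact: measurable_optri.
by apply: eq_Rintegral => y; rewrite inE => /(pwconst_in tL).
Qed.

(** The fluxes out of a triangle add up to the integral of the function over it,
    because the winding number of its boundary around [y] is the indicator
    function of the triangle, for [y] off the lines carrying the edges. *)
Lemma flux_sum (t : tri R) : t \in L ->
  flux L val t.1.1 t.1.2 + flux L val t.1.2 t.2 + flux L val t.2 t.1.1 =
  val t * (crs (t.1.2 - t.1.1) (t.2 - t.1.1) / 2).
Proof.
move=> tL; rewrite -integral_pwconst_optri//.
have iS P Q : (leb2 R).-integrable setT
    (EFin \o (fun y => pw y * subtended (P - y) (Q - y))).
  apply: (integrable_pwconst_mul (B := 2)); first exact: measurable_subtended.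
  by move=> y; exact: subtended_le.
rewrite /flux -RintegralD// -RintegralD//; last first.
  exact: (integrableD measurableT (iS _ _) (iS _ _)).
rewrite [RHS]Rintegral_mkcond /Rintegral; congr fine; apply: ae_eq_integral => //.
- apply/measurable_EFinP.
  have mS P Q := measurable_funM (measurable_pwconst L val) (@measurable_subtended _ P Q).
  exact: (measurable_funD (measurable_funD (mS _ _) (mS _ _)) (mS _ _)).
- apply/measurable_EFinP; rewrite -measurable_restrictT; last exact: measurable_optri.
  by apply: measurable_funTS; exact: measurable_pwconst.
have ct := mesh_ccw mL tL.
have := ccw_uniq ct; rewrite /= !inE negb_or andbT => /andP[/andP[PQ PW] QW].
have WP : t.2 != t.1.1 by rewrite eq_sym.
move: (crs_neq0_ae PQ) (crs_neq0_ae QW) (crs_neq0_ae WP).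
apply: (@filterS3 _ _ (ae_filter_ringOfSetsType (leb2 R))) => y c1 c2 c3 _; congr EFin.
rewrite -!mulrDr subtended_sum3 crossing_sum3 ?crs_sum3// patchE.
have [yT|yT] := pselect (optri t y).
  by rewrite mem_set//; case: yT => -> -> ->; rewrite mulr1.
rewrite [in RHS]memNset//; case: ifP => [/and3P[? ? ?]|]; last by rewrite mulr0.
by case: yT.
Qed.

End discrete_flux.

(** * The Raviart-Thomas field with prescribed fluxes *)

Section rt_field.
Context (R : realType) (f : plane R -> plane R -> R).

Definition rt_slope (t : tri R) : R :=
  (f t.1.1 t.1.2 + f t.1.2 t.2 + f t.2 t.1.1) / crs (t.1.2 - t.1.1) (t.2 - t.1.1).

Definition rt_shift (t : tri R) : plane R :=
  - (crs (t.1.2 - t.1.1) (t.2 - t.1.1))^-1 *: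
    (f t.1.1 t.1.2 *: t.2 + f t.1.2 t.2 *: t.1.1 + f t.2 t.1.1 *: t.1.2).

(** The field a + b x whose outward fluxes through the edges are given by [f]; the
    shape in [rt_localE], in terms of the vectors from the opposite vertices, is
    the usual one. *)
Definition rt_local (t : tri R) (x : plane R) : plane R := rt_shift t + rt_slope t *: x.

Definition rt_field (L : seq (tri R)) (x : plane R) : plane R :=
  \sum_(t <- L) \1_(optri t) x *: rt_local t x.

Lemma rt_localE (t : tri R) x : rt_local t x =
  (crs (t.1.2 - t.1.1) (t.2 - t.1.1))^-1 *:
   (f t.1.1 t.1.2 *: (x - t.2) + f t.1.2 t.2 *: (x - t.1.1) + f t.2 t.1.1 *: (x - t.1.2)).
Proof.
rewrite /rt_local /rt_shift /rt_slope; move: (crs _ _)^-1 => d.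
by apply: plane_eq; rewrite /= /GRing.scale/=; ring.
Qed.

(** The vector from the opposite vertex has flux [crs (Q - P) (W - P)] through an
    edge, and none through the two edges that end there. *)
Lemma rt_local_flux (t : tri R) : ccw t ->
  [/\ crs (rt_local t t.1.1) (t.1.2 - t.1.1) = f t.1.1 t.1.2,
      crs (rt_local t t.1.2) (t.2 - t.1.2) = f t.1.2 t.2 &
      crs (rt_local t t.2) (t.1.1 - t.2) = f t.2 t.1.1].
Proof.
rewrite /ccw => /lt0r_neq0; rewrite !rt_localE.
move: (f _ _) (f _ _) (f _ _) => p q r; case: t => -[P Q] W /=.
have cZ (k : R) (x y : plane R) : crs (k *: x) y = k * crs x y.
  by rewrite /crs/= /GRing.scale/=; ring.
have cD (x y z : plane R) : crs (x + y) z = crs x z + crs y z.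
  by rewrite /crs/=; ring.
set D := crs _ _ => D0.
have E1 : crs (P - W) (Q - P) = D by rewrite /D /crs/=; ring.
have E2 : crs (Q - P) (W - Q) = D by rewrite /D /crs/=; ring.
have E3 : crs (W - Q) (P - W) = D by rewrite /D /crs/=; ring.
have E0 (x y : plane R) : crs (x - y) (y - x) = 0 by rewrite /crs/=; ring.
have Z (x y : plane R) : crs (x - x) y = 0 by rewrite /crs/=; ring.
split; rewrite cZ !cD !cZ ?E0 ?Z ?E1 ?E2 ?E3 !mulr0 ?addr0 ?add0r mulrC mulfK//.
Qed.

End rt_field.

Lemma RintegralDsum d (T : measurableType d) (R : realType) (mu : {measure set T -> \bar R})
    (I : eqType) (s : seq I) (D : set T) (F : I -> T -> R) :
  measurable D -> (forall i, i \in s -> mu.-integrable D (EFin \o F i)) ->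
  mu.-integrable D (EFin \o (fun x => \sum_(i <- s) F i x)) /\
  \int[mu]_(x in D) (\sum_(i <- s) F i x) = \sum_(i <- s) \int[mu]_(x in D) F i x.
Proof.
move=> mD; elim: s => [|i s IH] iF.
  split; last by rewrite big_nil; under eq_Rintegral do rewrite big_nil; rewrite Rintegral_cst// mul0r.
  by under eq_fun do rewrite big_nil; exact: integrable0.
have [|h1 h2] := IH; first by move=> j js; apply: iF; rewrite inE js orbT.
have hi : mu.-integrable D (EFin \o F i) by apply: iF; rewrite mem_head.
split.
  under eq_fun do rewrite big_cons; exact: (integrableD mD hi h1).
by under eq_Rintegral do rewrite big_cons; rewrite RintegralD// big_cons h2.
Qed.

Lemma test_function_eq0 (R : realType) (A : set (plane R)) (phi : plane R -> R) x :
  test_function A phi -> ~ A x -> phi x = 0.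
Proof.
move=> [_ _ sA] nA; apply/eqP; apply: contrapT => /negP px; apply: nA; apply: sA.
exact: subset_closure.
Qed.

Lemma test_function_C1 (R : realType) (A : set (plane R)) (N : R) (phi : plane R -> R) :
  A `<=` square N -> test_function A phi -> compact_C1 (N + 1) phi.
Proof.
move=> AN tphi; have [/(_ 1%N) [cphi [d1 d2 [c1 _] [c2 _]]] _ _] := tphi.
split => // s; apply: (test_function_eq0 tphi) => /AN[/=]; rewrite !in_itv/=.
  by move=> /andP[_]; rewrite gerDl ler10.
by move=> _ /andP[_]; rewrite gerDl ler10.
Qed.

Lemma edge_mean_neq0 (R : realType) (F : plane R -> R) (P Q : plane R) :
  continuous F -> edge_mean F P Q != 0 -> exists2 s, 0 < s < 1 & F (P + s *: (Q - P)) != 0.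
Proof.
move=> cF; apply: contra_neqP => H.
have E s : 0 < s < 1 -> F (P + s *: (Q - P)) = 0.
  by move=> s01; apply: contrapT => /eqP ns; apply: H; exists s.
have iF := integrable_edge P Q cF.
have mE : measurable (`[0, 1]%classic : set (measurableTypeR R)) by exact: measurable_itv.
have iS (I : set (measurableTypeR R)) : measurable I -> I `<=` `[0, 1]%classic ->
    (@lebesgue_measure R).-integrable I (EFin \o (fun s => F (P + s *: (Q - P)))).
  by move=> mI sub; exact: (integrableS mE mI sub iF).
rewrite /edge_mean -Rintegral_itv_obnd_cbnd; last first.
  by apply: iS => //; exact: subset_itv_oc_cc.
rewrite -Rintegral_itv_bndo_bndc; last by apply: iS => //; exact: subset_itv_oo_cc.
transitivity (\int[@lebesgue_measure R]_(s in `]0, 1[) (cst 0 s : R)).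
  by apply: eq_Rintegral => s; rewrite inE/= in_itv/= => /E.
by rewrite Rintegral_cst// mul0r.
Qed.

Section weak_divergence.
Context (R : realType) (A : set (plane R)) (L : seq (tri R)) (mL : ccw_mesh A L).
Context (val : tri R -> R) (N : R).
Hypothesis oA : open A.
Hypothesis AN : A `<=` square N.
Hypothesis LN : forall (t : tri R) P, t \in L -> P \in verts t -> square N P.
Hypothesis LA : forall t : tri R, t \in L -> optri t `<=` A.

Lemma integral_pieces (h : tri R -> plane R -> R) :
  (forall t, t \in L -> continuous (h t)) ->
  (leb2 R).-integrable A (EFin \o (fun y => \sum_(t <- L) \1_(optri t) y * h t y)) /\
  \int[leb2 R]_(y in A) (\sum_(t <- L) \1_(optri t) y * h t y) =
  \sum_(t <- L) \int[leb2 R]_(y in optri t) h t y.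
Proof.
move=> ch; have mA := open_plane_measurable oA.
have E t : t \in L -> ((fun y => \1_(optri t) y * h t y) \_ A) = (h t) \_ (optri t).
  move=> tL; apply/funext => y; rewrite !patchE indicE.
  have [yt|yt] := pselect (optri t y).
    by rewrite (mem_set yt) (mem_set (LA tL yt)) mul1r.
  by rewrite (memNset yt) mul0r; case: ifP.
have [] := @RintegralDsum _ _ _ (leb2 R) _ L A (fun t y => \1_(optri t) y * h t y) mA.
  move=> t tL; rewrite integrable_mkcond// restrict_EFin E// -restrict_EFin.
  rewrite -integrable_mkcond; last exact: measurable_optri.
  apply: (@continuous_integrable _ N); [exact: measurable_optri| |exact: ch].
  by apply: subset_trans AN; exact: LA.
move=> i1 ->; split => //; rewrite big_seq [RHS]big_seq; apply: eq_bigr => t tL.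
by rewrite [LHS]Rintegral_mkcond E// -Rintegral_mkcond.
Qed.

Lemma dot_rt_field (x g : plane R) f :
  dot (rt_field f L x) g = \sum_(t <- L) \1_(optri t) x * dot (rt_local f t x) g.
Proof.
rewrite /rt_field; elim: (L) => [|t s IH]; first by rewrite !big_nil /dot/= !mul0r addr0.
by rewrite !big_cons -IH /dot/= /GRing.scale/=; ring.
Qed.

(** Green's formula in each triangle produces one term for each directed edge, the
    flux times the mean of the test function.  The slope of the field is half of
    the value of the function, by [flux_sum].  An edge on which the mean does not
    vanish meets [A], so it occurs in the other direction as well, where the flux
    is opposite. *)
Lemma weak_div_rt_field : weak_div A (rt_field (flux L val) L) (pwconst L val).
Proof.
move=> phi tphi; set f := flux L val.
have C := test_function_C1 AN tphi; have [cphi d1 d2 c1 c2 _ _] := C.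
have cD (h k : plane R -> R) : continuous h -> continuous k -> continuous (fun y => h y + k y).
  by move=> ch ck y; apply: cvgD; [exact: ch|exact: ck].
have cM (h k : plane R -> R) : continuous h -> continuous k -> continuous (fun y => h y * k y).
  by move=> ch ck y; apply: cvgM; [exact: ch|exact: ck].
have cC (c : R) : continuous (fun _ : plane R => c) by move=> y; exact: cvg_cst.
have clin t : continuous (fun y => (rt_local f t y).1) /\
    continuous (fun y => (rt_local f t y).2).
  split; (apply: cD; [exact: cC|apply: cM; [exact: cC|]]).
    exact: continuous_coord1.
  exact: continuous_coord2.
pose g1 t y := dot (rt_local f t y) (partial1 phi y, partial2 phi y).
pose g2 t y := val t * phi y.
have cg1 t : continuous (g1 t).
  have [l1 l2] := clin t.
  exact: (cD _ _ (cM _ _ l1 c1) (cM _ _ l2 c2)).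
have cg2 t : continuous (g2 t) := cM _ _ (cC _) cphi.
have [_ E1] := integral_pieces (fun t _ => cg1 t).
have [_ E2] := integral_pieces (fun t _ => cg2 t).
under eq_Rintegral do rewrite dot_rt_field.
rewrite E1.
have -> : \int[leb2 R]_(x in A) (pwconst L val x * phi x) =
    \int[leb2 R]_(x in A) (\sum_(t <- L) \1_(optri t) x * g2 t x).
  apply: eq_Rintegral => x _; rewrite /pwconst mulr_suml; apply: eq_bigr => t _.
  by rewrite /g2; ring.
rewrite E2; apply/eqP; rewrite -addr_eq0; apply/eqP; rewrite -big_split/=.
pose G P Q := f P Q * edge_mean phi P Q.
have local t : t \in L -> \int[leb2 R]_(y in optri t) g1 t y + \int[leb2 R]_(y in optri t) g2 t y =
    \sum_(e <- tri_edges t) G e.1 e.2.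
  move=> tL; have ct := mesh_ccw mL tL; have mt := measurable_optri t.
  have tN := subset_trans (LA tL) AN.
  have i1 := continuous_integrable mt tN (cg1 t).
  have i2 := continuous_integrable mt tN (cg2 t).
  rewrite -RintegralD//.
  have N1 (P : plane R) : P \in verts t -> square (N + 1) P.
    move=> /(LN tL)[]; rewrite /= !in_itv/= => /andP[? ?] /andP[? ?].
    by split; rewrite /= in_itv/=; apply/andP; split; lra.
  have := @triangle_flux R (N + 1) phi (rt_shift f t) (rt_slope f t) _ _ _ C ct.
  have v1 : t.1.1 \in verts t by rewrite !inE eqxx.
  have v2 : t.1.2 \in verts t by rewrite !inE eqxx orbT.
  have v3 : t.2 \in verts t by rewrite !inE eqxx !orbT.
  move=> /(_ (N1 _ v1) (N1 _ v2) (N1 _ v3)).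
  have [-> -> ->] := rt_local_flux f ct.
  have sl : 2 * rt_slope f t = val t.
    rewrite /rt_slope /f (@flux_sum _ _ _ mL val N LN)//; field.
    by rewrite gt_eqF.
  rewrite sl => E; rewrite /tri_edges/= !big_cons big_nil addr0 /G/= addrA -E.
  by apply: eq_Rintegral => y _; rewrite /g1 /g2 /dot/=; ring.
rewrite big_seq (eq_bigr _ local) -big_seq.
transitivity (\sum_(e <- dir_edges L) G e.1 e.2).
  by rewrite /dir_edges big_flatten/= big_map.
apply: antisym_sum0; first exact: (dir_edges_uniq mL).
  by move=> P Q; rewrite /G (edge_meanC P Q cphi) /f (@fluxC _ L val N LN) mulNr.
move=> P Q /dir_edgesP[t [W [tL r]]]; rewrite mulf_eq0 negb_or => /andP[_ /(edge_mean_neq0 cphi)[s s01 ps]].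
have As : A (P + s *: (Q - P)).
  by apply: contrapT => /(test_function_eq0 tphi)/eqP; rewrite (negPf ps).
have [t' [W' [t'L r']]] := edge_partner mL oA tL r s01 As.
by apply/dir_edgesP; exists t', W'.
Qed.

End weak_divergence.

(** * Pointwise bound of the field by the potential *)

Lemma l1normD (R : realType) (a b : plane R) : l1norm (a + b) <= l1norm a + l1norm b.
Proof. by rewrite /l1norm/= addrACA lerD// ler_normD. Qed.

Lemma l1normZ (R : realType) (k : R) (a : plane R) : l1norm (k *: a) = `|k| * l1norm a.
Proof. by rewrite /l1norm/= /GRing.scale/= !normrM mulrDr. Qed.

Lemma l1normB (R : realType) (a b : plane R) : l1norm (a - b) = l1norm (b - a).
Proof. by rewrite /l1norm/= [`|a.1 - _|]distrC [`|a.2 - _|]distrC. Qed.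

Lemma l1norm0 (R : realType) : l1norm (0 : plane R) = 0.
Proof. by rewrite /l1norm/= normr0 addr0. Qed.

Lemma kernel_sqr (R : realType) (delta : R) (z : plane R) : 0 < delta ->
  kernel delta z ^+ 2 * ((delta + `|z.1|) * (delta + `|z.2|)) = 1.
Proof.
move=> d0; rewrite -powR_mulrn ?kernel_ge0// kernelX// divff//.
have h (t : R) : 0 < delta + `|t| by rewrite ltr_wpDr.
by rewrite !powRN !powRr1 ?(ltW (h _))// mulrACA !mulVf ?mulr1// gt_eqF.
Qed.

(** Both delta + |(x - y).1| and delta + |(x - y).2| are at most
    2 h + |P - y|, so their products with the subtended angle are at most
    2 h * 2 + 2 h = 6 h by boundedness and decay.  The kernel is the inverse
    square root of the product of these two quantities. *)
Lemma subtended_le_kernel (R : realType) (P Q x y : plane R) (delta h : R) :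
  0 < delta <= h -> l1norm (x - P) <= h -> l1norm (Q - P) <= h ->
  `|subtended (P - y) (Q - y)| <= 6 * h * kernel delta (x - y).
Proof.
move=> /andP[d0 dh] xP QP; set s := `|_|.
have h0 : 0 < h by exact: lt_le_trans dh.
have s2 : s <= 2 by exact: subtended_le.
have s0 : 0 <= s by exact: normr_ge0.
have := subtended_decay (P - y) (Q - y); rewrite -/s.
have -> : Q - y - (P - y) = Q - P by apply: plane_eq => /=; ring.
move=> dec.
have xy : l1norm (x - y) <= h + l1norm (P - y).
  have -> : x - y = (x - P) + (P - y) by apply: plane_eq => /=; ring.
  by rewrite (le_trans (l1normD _ _))// lerD2r.
have z1 : `|(x - y).1| <= l1norm (x - y) by rewrite lerDl.
have z2 : `|(x - y).2| <= l1norm (x - y) by rewrite lerDr.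
have k := kernel_sqr (x - y) d0; have k0 := kernel_gt0 (x - y) d0.
have a1 := normr_ge0 (x - y).1; have a2 := normr_ge0 (x - y).2.
move: k k0 a1 a2 xy z1 z2 dec.
move: (kernel _ _) `|(x - y).1| `|(x - y).2| (l1norm (x - y)) (l1norm (P - y)) => k u v n m.
move=> k1 k0 u0 v0 xy z1 z2 dec.
have bd (w : R) : w <= n -> (delta + w) * s <= 6 * h.
  move=> wn; have : (delta + w) * s <= (2 * h + m) * s by rewrite ler_wpM2r//; lra.
  move=> /le_trans; apply; rewrite mulrDl.
  have : 2 * h * s <= 2 * h * 2 by rewrite ler_wpM2l//; lra.
  by lra.
have h1 := bd _ z1; have h2 := bd _ z2.
have h12 : (delta + u) * s * ((delta + v) * s) <= 6 * h * (6 * h).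
  by apply: ler_pM => //; apply: mulr_ge0 => //; lra.
rewrite -(ler_pXn2r (n := 2))// ?nnegrE//; last by rewrite !mulr_ge0//; lra.
have -> : s ^+ 2 = k ^+ 2 * ((delta + u) * s * ((delta + v) * s)).
  rewrite (_ : k ^+ 2 * _ = k ^+ 2 * ((delta + u) * (delta + v)) * s ^+ 2); last by ring.
  by rewrite k1 mul1r.
rewrite (_ : (6 * h * k) ^+ 2 = k ^+ 2 * (6 * h * (6 * h))); last by ring.
by rewrite ler_wpM2l// sqr_ge0.
Qed.

Definition perimeter (R : realType) (t : tri R) : R :=
  l1norm (t.1.2 - t.1.1) + l1norm (t.2 - t.1.2) + l1norm (t.1.1 - t.2).

Lemma vert_le_perimeter (R : realType) (t : tri R) (x P : plane R) :
  ccw t -> cltri t x -> P \in verts t -> l1norm (x - P) <= perimeter t.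
Proof.
move=> ct tx.
have E (P' Q' W' : plane R) : (P', Q', W') \in rots t ->
    l1norm (x - P') <= l1norm (Q' - P') + l1norm (W' - Q') + l1norm (P' - W').
  move=> r; have := tx; rewrite -(rots_cltri r) => /(closed_triangleP _ (rots_ccw ct r)).
  move=> [[[p q] w] /= [p0 q0 w0 s1 ->]].
  have -> : p *: P' + q *: Q' + w *: W' - P' = q *: (Q' - P') + w *: (W' - P').
    have -> : p = 1 - q - w by lra.
    by apply: plane_eq; rewrite /= /GRing.scale/=; ring.
  rewrite (le_trans (l1normD _ _))// !l1normZ !ger0_norm// [l1norm (W' - P')]l1normB.
  have := l1norm_ge0 (W' - Q'); have := l1norm_ge0 (P' - W'); have := l1norm_ge0 (Q' - P').
  by nra.
case: t ct tx E => -[A B] C ct tx E; rewrite !inE /perimeter/= => /or3P[] /eqP ->.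
- by rewrite E// inE eqxx.
- by rewrite (le_trans (E B C A _))// ?inE ?eqxx ?orbT//; lra.
- by rewrite (le_trans (E C A B _))// ?inE ?eqxx ?orbT//; lra.
Qed.

Lemma edge_le_perimeter (R : realType) (t : tri R) :
  [/\ l1norm (t.1.2 - t.1.1) <= perimeter t, l1norm (t.2 - t.1.2) <= perimeter t &
      l1norm (t.1.1 - t.2) <= perimeter t].
Proof.
rewrite /perimeter; have := l1norm_ge0 (t.1.2 - t.1.1); have := l1norm_ge0 (t.2 - t.1.2).
by have := l1norm_ge0 (t.1.1 - t.2); split; lra.
Qed.

Lemma perimeter_gt0 (R : realType) (t : tri R) : ccw t -> 0 < perimeter t.
Proof.
move=> ct; have [e1 e2 e3] := edge_le_perimeter t; rewrite lt_neqAle (le_trans (l1norm_ge0 _) e1) andbT.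
apply/negP => /eqP p0; move: e1 e3 ct; rewrite -p0 /ccw /crs /l1norm/=.
move=> e1 e3.
have z (a b : R) : `|a| + `|b| <= 0 -> a = 0 /\ b = 0.
  move=> ab; have := normr_ge0 a; have := normr_ge0 b => ? ?.
  by split; apply/normr0_eq0; lra.
by have [-> ->] := z _ _ e1; rewrite !mul0r subrr ltxx.
Qed.

(** Regularization parameter below the scale of the mesh.  It depends on the mesh,
    but the bounds on the potential are uniform in it. *)
Lemma mesh_size (R : realType) (L : seq (tri R)) : (forall t, t \in L -> ccw t) ->
  exists2 delta : R, 0 < delta <= 1 & forall t, t \in L -> delta <= perimeter t.
Proof.
elim: L => [|t L IH] cL; first by exists 1; rewrite ?ltr01 ?lexx.
have [|d /andP[d0 d1] H] := IH; first by move=> s sL; apply: cL; rewrite inE sL orbT.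
have p0 : 0 < perimeter t by apply: perimeter_gt0; apply: cL; rewrite mem_head.
exists (Num.min d (perimeter t)); first by rewrite lt_min d0 p0 ge_min d1.
move=> s; rewrite inE => /predU1P[->|/H h]; first by rewrite ge_min lexx orbT.
by rewrite ge_min h.
Qed.

(** The field is a sum of three terms flux * (x - opposite vertex) / (2 area), each
    at most perimeter^2 k / (2 area).  The square of the perimeter expands into
    nine products of lengths, each at most 4 sigma times twice the area; hence
    the constant 3 * 36. *)
Lemma rt_local_le (R : realType) (f : plane R -> plane R -> R) (t : tri R) (x : plane R)
    (k sigma : R) : 0 < sigma -> ccw t -> diam (cltri t) <= sigma * indiam (cltri t) ->
  cltri t x -> 0 <= k ->
  `|f t.1.1 t.1.2| <= perimeter t * k -> `|f t.1.2 t.2| <= perimeter t * k ->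
  `|f t.2 t.1.1| <= perimeter t * k -> l1norm (rt_local f t x) <= 108 * sigma * k.
Proof.
move=> s0 ct reg tx k0 f1 f2 f3; rewrite rt_localE l1normZ; have := ct; rewrite /ccw.
set D := crs _ _ => D0; rewrite ger0_norm ?invr_ge0 ?(ltW D0)// ler_pdivrMl//.
have v P := @vert_le_perimeter _ t x P ct tx.
have b (c : R) (P : plane R) : `|c| <= perimeter t * k -> P \in verts t ->
    l1norm (c *: (x - P)) <= perimeter t ^+ 2 * k.
  move=> ck Pt; rewrite l1normZ (_ : perimeter t ^+ 2 * k = perimeter t * k * perimeter t); last by ring.
  by apply: ler_pM => //; [exact: l1norm_ge0|exact: v].
have v1 : t.1.1 \in verts t by rewrite !inE eqxx.
have v2 : t.1.2 \in verts t by rewrite !inE eqxx orbT.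
have v3 : t.2 \in verts t by rewrite !inE eqxx !orbT.
have := b _ _ f1 v3; have := b _ _ f2 v1; have := b _ _ f3 v2.
have p2 : perimeter t ^+ 2 <= 36 * sigma * D.
  have r1 : (t.1.1, t.1.2, t.2) \in rots t by case: (t) => -[? ?] ? /=; rewrite inE eqxx.
  have r2 : (t.1.2, t.2, t.1.1) \in rots t by rewrite !inE eqxx !orbT.
  have r3 : (t.2, t.1.1, t.1.2) \in rots t by rewrite !inE eqxx !orbT.
  have E P Q W P' Q' W' := @shape_regular_edges _ _ t P Q W P' Q' W' s0 ct reg.
  have := E _ _ _ _ _ _ r1 r1; have := E _ _ _ _ _ _ r1 r2; have := E _ _ _ _ _ _ r1 r3.
  have := E _ _ _ _ _ _ r2 r2; have := E _ _ _ _ _ _ r2 r3; have := E _ _ _ _ _ _ r3 r3.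
  by rewrite -/D /perimeter; move: (l1norm _) (l1norm _) (l1norm _) => a c e; nra.
have p3 : perimeter t ^+ 2 * k <= 36 * sigma * D * k by rewrite ler_wpM2r.
move=> h1 h2 h3; rewrite (le_trans (l1normD _ _))//.
have := l1normD (f t.1.1 t.1.2 *: (x - t.2)) (f t.1.2 t.2 *: (x - t.1.1)).
by lra.
Qed.

Section field_bound.
Context (R : realType) (A : set (plane R)) (L : seq (tri R)) (mL : ccw_mesh A L).
Context (val : tri R -> R) (N : R).
Hypothesis LN : forall (t : tri R) P, t \in L -> P \in verts t -> square N P.

Lemma rt_field_in f (t : tri R) x : t \in L -> optri t x -> rt_field f L x = rt_local f t x.
Proof.
move=> tL tx; rewrite /rt_field (big_rem t)//= indicE mem_set// scale1r big_seq big1 ?addr0//.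
move=> t' t'L; rewrite indicE memNset ?scale0r// => t'x.
have /(open_closed_eq mL tL) := mem_rem t'L => /(_ _ tx (optri_cltri t'x)) E.
by move: t'L; rewrite -E mem_rem_uniqF// (mesh_uniq_seq mL).
Qed.

Lemma rt_field_out f x : (forall t, t \in L -> ~ optri t x) -> rt_field f L x = 0.
Proof.
move=> nx; rewrite /rt_field big_seq big1// => t tL; rewrite indicE memNset ?scale0r//.
exact: nx.
Qed.

Lemma riesz_ge0 (delta : R) (u : plane R -> R) x : (forall y, 0 <= u y) -> 0 <= riesz N delta u x.
Proof.
by move=> u0; apply: Rintegral_ge0 => y _; rewrite mulr_ge0// kernel_ge0.
Qed.

Lemma flux_le_riesz (delta h : R) (x P Q : plane R) :
  0 < delta <= h -> l1norm (x - P) <= h -> l1norm (Q - P) <= h ->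
  `|flux L val P Q| <= 6 * h * riesz N delta (fun y => `|pwconst L val y|) x.
Proof.
move=> dh xP QP; have /andP[d0 dlh] := dh.
have iT := integrable_pwconst_mul val LN (@measurable_subtended _ P Q) (fun y => subtended_le _ _).
have E : flux L val P Q = \int[leb2 R]_(y in square N) (pwconst L val y * subtended (P - y) (Q - y)).
  rewrite /flux [RHS]Rintegral_mkcond; apply: eq_Rintegral => y _; rewrite patchE.
  by case: ifPn => // /negP; rewrite inE => /(pwconst_out val LN) ->; rewrite mul0r.
have mS := @measurable_square R N.
have iS : (leb2 R).-integrable (square N)
    (EFin \o (fun y => pwconst L val y * subtended (P - y) (Q - y))).
  by apply: (integrableS measurableT mS _ iT).
have mk := @measurable_kernel_sub R delta x.
have ik : (leb2 R).-integrable (square N) (EFin \o (fun y => `|pwconst L val y| * kernel delta (x - y))).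
  apply: (@bounded_integrable _ N ((\sum_(t <- L) `|val t|) * delta^-1)) => //.
    apply: measurable_funTS; apply: measurable_funM => //.
    by apply: measurableT_comp => //; exact: measurable_pwconst.
  move=> y _; rewrite normrM normr_id ler_pM// ?pwconst_le//.
  by rewrite ger0_norm ?kernel_ge0// kernel_le.
rewrite E (le_trans (le_normr_Rintegral mS iS))// /riesz -RintegralZl//.
apply: le_Rintegral => //.
- exact: integrable_norm.
- apply: (eq_integrable mS _ _ _ (integrableZl mS (6 * h) ik)).
  by move=> y _ /=; rewrite -EFinM.
move=> y _; rewrite normrM mulrCA ler_wpM2l//.
exact: (subtended_le_kernel _ dh xP QP).
Qed.

(** The fluxes are at most 6 perimeter times the potential, by [flux_le_riesz],
    and 648 = 6 * 108. *)
Lemma rt_field_le (delta sigma : R) (x : plane R) : 0 < delta -> 0 < sigma ->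
  (forall t, t \in L -> delta <= perimeter t) ->
  (forall t, t \in L -> diam (cltri t) <= sigma * indiam (cltri t)) ->
  l1norm (rt_field (flux L val) L x) <=
  648 * sigma * riesz N delta (fun y => `|pwconst L val y|) x.
Proof.
move=> d0 s0 dL reg.
have F t P Q := @flux_le_riesz delta (perimeter t) x P Q.
have r0 : 0 <= riesz N delta (fun y => `|pwconst L val y|) x by apply: riesz_ge0.
move: r0 F; set r := riesz _ _ _ _; move=> r0 F; clearbody r.
have [[t [tL tx]]|nx] := pselect (exists t, t \in L /\ optri t x); last first.
  have -> : rt_field (flux L val) L x = 0.
    by apply: rt_field_out => t tL tx; apply: nx; exists t.
  by rewrite l1norm0; apply: mulr_ge0 r0; apply: mulr_ge0 (ltW s0); exact: ler0n.
have ct := mesh_ccw mL tL; have ctx := optri_cltri tx.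
have dh : 0 < delta <= perimeter t by rewrite d0 dL.
have [e1 e2 e3] := edge_le_perimeter t.
have v P := @vert_le_perimeter _ t x P ct ctx.
have F' P Q : l1norm (x - P) <= perimeter t -> l1norm (Q - P) <= perimeter t ->
    `|flux L val P Q| <= perimeter t * (6 * r).
  by move=> xP QP; have := F t P Q dh xP QP; rewrite mulrA [perimeter t * 6]mulrC.
rewrite (rt_field_in _ tL tx).
have -> : 648 * sigma * r = 108 * sigma * (6 * r) by ring.
have r6 : 0 <= 6 * r by apply: mulr_ge0.
apply: (rt_local_le s0 ct (reg _ tL) ctx r6); apply: F' => //; apply: v; rewrite !inE eqxx ?orbT//.
Qed.

End field_bound.

(** * Lebesgue norms and uniqueness of the weak divergence *)

Lemma LpnormE (R : realType) (A : set (plane R)) (r : R) (f : plane R -> R) : 0 < r ->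
  Lpnorm A r f = ((\int[leb2 R]_(x in A) (`|f x| `^ r)%:E) `^ r^-1)%E.
Proof.
move=> r0; rewrite /Lpnorm unlock; congr (_ `^ _)%E; rewrite [RHS]integral_mkcond.
apply: eq_integral => x _ /=; rewrite !patchE; case: ifP => _ //.
by rewrite normr0 powR0// gt_eqF.
Qed.

Lemma powR2 (R : realType) (a : R) : `|a| `^ 2 = a ^+ 2.
Proof. by rewrite powR_mulrn// real_normK// num_real. Qed.

Section L2_theory.
Context (R : realType) (A : set (plane R)) (N : R).
Hypothesis mA : measurable (A : set (mplane R)).
Hypothesis AN : A `<=` square N.

Lemma L2_sqr_integrable (f : plane R -> R) : L2 A f ->
  (leb2 R).-integrable A (EFin \o (fun x => f x ^+ 2)).
Proof.
move=> [mf]; rewrite LpnormE// => /lty_poweRy h; apply/integrableP; split.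
  by apply/measurable_EFinP; exact: measurable_funX.
rewrite (eq_integral (fun x : mplane R => (`|f x| `^ 2)%:E)).
  by apply: h; rewrite invr_eq0.
by move=> x _ /=; rewrite powR2 ger0_norm// sqr_ge0.
Qed.

Lemma L2_integrable (f : plane R -> R) : L2 A f -> (leb2 R).-integrable A (EFin \o f).
Proof.
move=> Lf; have i2 := L2_sqr_integrable Lf; case: Lf => mf _.
have i1 : (leb2 R).-integrable A (EFin \o (fun _ => 1)).
  by apply: (@bounded_integrable _ N 1) => // x _; rewrite normr1.
apply: (le_integrable mA _ _ (integrableD mA i1 i2)); first exact/measurable_EFinP.
move=> x _ /=; rewrite lee_fin [leRHS]ger0_norm ?addr_ge0 ?sqr_ge0//.
have : 0 <= (`|f x| - 1) ^+ 2 by exact: sqr_ge0.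
by rewrite -[f x ^+ 2]real_normK ?num_real//; have := normr_ge0 (f x); nra.
Qed.

Lemma L2_bounded (M : R) (f : plane R -> R) :
  measurable_fun A (f : mplane R -> R) -> (forall x, A x -> `|f x| <= M) -> L2 A f.
Proof.
move=> mf fM; split=> //; rewrite LpnormE//; apply: poweR_lty.
rewrite (eq_integral (fun x : mplane R => (f x ^+ 2)%:E)); last by move=> x _; rewrite powR2.
have : (leb2 R).-integrable A (EFin \o (fun x => f x ^+ 2)).
  apply: (@bounded_integrable _ N (M ^+ 2)) => //; first exact: measurable_funX.
  by move=> x Ax; rewrite normrX lerXn2r ?nnegrE// ?fM// (le_trans _ (fM _ Ax)).
exact: integrable_lty.
Qed.

Lemma Lpnorm2E (f : plane R -> R) : L2 A f ->
  Lpnorm A 2 f = ((\int[leb2 R]_(x in A) (f x ^+ 2)) `^ 2^-1)%:E.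
Proof.
move=> Lf; rewrite LpnormE// -poweR_EFin /Rintegral fineK.
  by congr (_ `^ _)%E; apply: eq_integral => x _; rewrite powR2.
exact: integrable_fin_num (L2_sqr_integrable Lf).
Qed.

End L2_theory.

Lemma ae_eq_Rintegral d (T : measurableType d) (R : realType) (mu : {measure set T -> \bar R})
    (D : set T) (f g : T -> R) : measurable D ->
  measurable_fun D f -> measurable_fun D g -> {ae mu, forall x, D x -> f x = g x} ->
  \int[mu]_(x in D) f x = \int[mu]_(x in D) g x.
Proof.
move=> mD mf mg fg; rewrite /Rintegral; congr fine; apply: ae_eq_integral => //.
- exact/measurable_EFinP.
- exact/measurable_EFinP.
by apply: filterS fg => x fg /fg /= ->.
Qed.

Section weak_divergence_theory.
Context (R : realType) (A : set (plane R)) (N : R).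
Hypothesis oA : open A.
Hypothesis AN : A `<=` square N.
Let mA := open_plane_measurable oA.

Lemma weak_div_unique (tau : plane R -> plane R) (g h : plane R -> R) :
  L2 A g -> L2 A h -> weak_div A tau g -> weak_div A tau h ->
  {ae leb2 R, forall x, A x -> g x = h x}.
Proof.
move=> Lg Lh wg wh.
have ig := L2_integrable mA AN Lg; have ih := L2_integrable mA AN Lh.
have i (f : plane R -> R) phi : (leb2 R).-integrable A (EFin \o f) -> test_function A phi ->
    (leb2 R).-integrable A (EFin \o (fun x => f x * phi x)).
  move=> iF tphi; have [cphi _ _ _ _ _ _] := test_function_C1 AN tphi.
  have [M phiM] := continuous_square_bounded N cphi.
  apply: (le_integrable mA _ _ (integrableZl mA M iF)).
    apply/measurable_EFinP; apply: measurable_funM.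
      by have /integrableP[/measurable_EFinP] := iF.
    by apply: measurable_funTS; exact: continuous_plane_measurable.
  move=> x Ax /=; rewrite lee_fin !normrM mulrC ler_wpM2r// (le_trans (phiM _ (AN Ax)))//.
  exact: ler_norm.
have : {ae leb2 R, forall x, A x -> g x - h x = 0}.
  apply: du_bois_reymond => //; first exact: (integrableB mA ig ih).
  move=> phi tphi.
  transitivity (\int[leb2 R]_(x in A) (g x * phi x) - \int[leb2 R]_(x in A) (h x * phi x)).
    by rewrite -RintegralB ?i//; apply: eq_Rintegral => x _; rewrite mulrBl.
  by apply/eqP; rewrite subr_eq0 -eqr_opp -(wg _ tphi) -(wh _ tphi).
by apply: (@filterS _ _ (ae_filter_ringOfSetsType (leb2 R))) => x H /H /eqP; rewrite subr_eq0 => /eqP.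
Qed.

Lemma div_L2 (tau : plane R -> plane R) (g : plane R -> R) : L2 A g -> weak_div A tau g ->
  L2 A (div A tau) /\ weak_div A tau (div A tau).
Proof. by move=> Lg wg; apply: (@getPex _ [set g | L2 A g /\ weak_div A tau g]); exists g. Qed.

(** The chosen divergence is one of the weak divergences. *)
Lemma div_ae (tau : plane R -> plane R) (g : plane R -> R) : L2 A g -> weak_div A tau g ->
  {ae leb2 R, forall x, A x -> div A tau x = g x}.
Proof.
by move=> Lg wg; have [Ld wd] := div_L2 Lg wg; apply: weak_div_unique wd wg.
Qed.

(** A field vanishing almost everywhere has the weak divergence 0. *)
Lemma ae_zero_div (tau : plane R -> plane R) (g : plane R -> R) :
  measurable_fun A (fun x : mplane R => (tau x).1) ->
  measurable_fun A (fun x : mplane R => (tau x).2) ->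
  L2 A g -> weak_div A tau g -> ae_zero A tau -> {ae leb2 R, forall x, A x -> g x = 0}.
Proof.
move=> m1 m2 Lg wg tau0.
have [h1 h2] : L2 A (cst 0 : plane R -> R) /\ weak_div A tau (cst 0).
  split; first by apply: (L2_bounded mA AN (M := 0)) => // x _; rewrite normr0.
  move=> phi tphi; have [_ _ _ c1 c2 _ _] := test_function_C1 AN tphi.
  have -> : \int[leb2 R]_(x in A) (cst 0 x * phi x) = 0.
    under eq_Rintegral do rewrite mul0r.
    by rewrite Rintegral_cst// mul0r.
  transitivity (\int[leb2 R]_(x in A) (cst 0 x : R)); last by rewrite Rintegral_cst// mul0r oppr0.
  apply: ae_eq_Rintegral => //.
    by apply: measurable_funD; apply: measurable_funM => //; apply: measurable_funTS;
      exact: continuous_plane_measurable.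
  by move: tau0; apply: (@filterS _ _ (ae_filter_ringOfSetsType (leb2 R))) => x H /H ->; rewrite /dot/= !mul0r addr0.
exact: weak_div_unique Lg h1 wg h2.
Qed.

End weak_divergence_theory.

Lemma measurable_riesz (R : realType) (N delta : R) (u : plane R -> R) :
  measurable_fun setT (u : mplane R -> R) -> (forall y, 0 <= u y) ->
  measurable_fun setT (riesz N delta u : mplane R -> R).
Proof.
move=> mu u0; apply: (measurableT_comp (fine_measurable measurableT)).
exact: measurable_kernel_integral.
Qed.

Lemma measurable_enorm (R : realType) (A : set (mplane R)) (tau : plane R -> plane R) :
  measurable_fun A (fun x : mplane R => (tau x).1) ->
  measurable_fun A (fun x : mplane R => (tau x).2) ->
  measurable_fun A (fun x : mplane R => enorm (tau x)).
Proof.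
move=> m1 m2.
have md : measurable_fun A (fun x : mplane R => dot (tau x) (tau x)).
  by apply: measurable_funD; apply: measurable_funM.
apply: (eq_measurable_fun (fun x : mplane R => dot (tau x) (tau x) `^ 2^-1)).
  by move=> x _; rewrite powR12_sqrt// addr_ge0// -expr2 sqr_ge0.
exact: (measurableT_comp (measurable_powR _) md).
Qed.

Lemma measurable_rt_field (R : realType) (f : plane R -> plane R -> R) (L : seq (tri R)) :
  measurable_fun setT (fun x : mplane R => (rt_field f L x).1) /\
  measurable_fun setT (fun x : mplane R => (rt_field f L x).2).
Proof.
rewrite /rt_field; elim: L => [|t L [IH1 IH2]].
  by split; under eq_fun do rewrite big_nil; exact: measurable_cst.
have mi : measurable_fun setT (\1_(optri t) : mplane R -> R).
  by apply: measurable_indic; exact: measurable_optri.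
split; under eq_fun do rewrite big_cons; apply: measurable_funD => //; apply: measurable_funM => //;
  by apply: measurable_funD => //; apply: measurable_funM.
Qed.

(** * The field on a triangulation *)

Lemma ae_forall_seq (R : realType) (I : eqType) (s : seq I) (P : I -> plane R -> Prop) :
  (forall i, i \in s -> {ae leb2 R, forall x, P i x}) ->
  {ae leb2 R, forall x, forall i, i \in s -> P i x}.
Proof.
elim: s => [|i s IH] H; first exact: aeW.
have /IH : forall j, j \in s -> {ae leb2 R, forall x, P j x}.
  by move=> j js; apply: H; rewrite inE js orbT.
move: (H i (mem_head _ _)); apply: (@filterS2 _ _ (ae_filter_ringOfSetsType (leb2 R))) => x Pi Ps j.
by rewrite inE => /predU1P[->|/Ps].
Qed.

Lemma Lpnorm_ae (R : realType) (A : set (plane R)) (r : R) (f g : plane R -> R) : 0 < r ->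
  measurable (A : set (mplane R)) ->
  measurable_fun A (f : mplane R -> R) -> measurable_fun A (g : mplane R -> R) ->
  {ae leb2 R, forall x, A x -> f x = g x} -> Lpnorm A r f = Lpnorm A r g.
Proof.
move=> r0 mA mf mg fg; rewrite (LpnormE A f r0) (LpnormE A g r0).
have m (h : plane R -> R) : measurable_fun A (h : mplane R -> R) ->
    measurable_fun A (fun x : mplane R => (`|h x| `^ r)%:E).
  move=> mh; apply/measurable_EFinP.
  by apply: (measurableT_comp (measurable_powR r)); exact: measurableT_comp.
rewrite (ae_eq_integral _ _ mA (m _ mf) (m _ mg))//.
by move: fg; apply: (@filterS _ _ (ae_filter_ringOfSetsType (leb2 R))) => x H /H ->.
Qed.

Section mesh_fields.
Context (R : realType) (A : set (plane R)) (T : seq (triangle R)) (N : R).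
Hypothesis oA : open A.
Hypothesis lA : interior (closure A) `<=` A.
Hypothesis AN : closure A `<=` square N.
Hypothesis tT : triangulation A T.

Let L := mesh_reps T.
Let mL : ccw_mesh A L := mesh_reps_mesh tT.
Let mA := open_plane_measurable oA.
Let AS : A `<=` square N := subset_trans (@subset_closure _ A) AN.

Lemma mesh_cltri_closure t : t \in L -> cltri t `<=` closure A.
Proof.
move=> /mesh_reps_sub[K KT ->]; rewrite -hull_cltri; last exact: tri_nondegenerate tT _ KT.
by rewrite -(tri_cover tT) => x hx; exists K.
Qed.

Lemma mesh_verts_square (t : tri R) P : t \in L -> P \in verts t -> square N P.
Proof.
move=> tL; have [h1 h2 h3] := vertices_closed_triangle (mesh_ccw mL tL).
by rewrite !inE => /or3P[] /eqP ->; apply: AN; apply: (mesh_cltri_closure tL).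
Qed.
Let LN := mesh_verts_square.

Lemma interior_cltri t : t \in L -> interior (cltri t) = optri t.
Proof. by move=> tL; apply: interior_closed_triangle; exact: (mesh_ccw mL tL). Qed.

Lemma mesh_optri_sub (t : tri R) : t \in L -> optri t `<=` A.
Proof.
move=> tL x; rewrite -interior_cltri// => xt; apply: lA; move: x xt.
by apply: interiorS; exact: mesh_cltri_closure.
Qed.
Let LA := mesh_optri_sub.

(** The triangles cover the closure of [A], and a point of a triangle that is not on
    the line of an edge is an interior point. *)
Lemma mesh_ae : {ae leb2 R, forall x, A x -> exists2 t, t \in L & optri t x}.
Proof.
have : {ae leb2 R, forall x, forall t, t \in L -> cltri t x -> optri t x}.
  apply: (@ae_forall_seq R _ L (fun t x => cltri t x -> optri t x)) => t tL.
  have := ccw_uniq (mesh_ccw mL tL); rewrite /= !inE negb_or andbT => /andP[/andP[PQ PW] QW].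
  have WP : t.2 != t.1.1 by rewrite eq_sym.
  move: (crs_neq0_ae PQ) (crs_neq0_ae QW) (crs_neq0_ae WP).
  apply: (@filterS3 _ _ (ae_filter_ringOfSetsType (leb2 R))) => y c1 c2 c3 [h1 h2 h3].
  by split; rewrite lt_neqAle eq_sym; apply/andP.
apply: (@filterS _ _ (ae_filter_ringOfSetsType (leb2 R))) => x H Ax.
have [t tL tx] := mesh_cover mL (subset_closure Ax).
by exists t => //; exact: H.
Qed.

Lemma P0_pwconst (v : plane R -> R) : P0 A T v ->
  exists val, {ae leb2 R, forall x, A x -> v x = pwconst L val x}.
Proof.
move=> [_ vT]; exists (fun t => get [set c | forall x, optri t x -> v x = c]).
move: mesh_ae; apply: (@filterS _ _ (ae_filter_ringOfSetsType (leb2 R))) => x H /H[t tL tx].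
rewrite (pwconst_in mL _ tL tx).
have : exists c, [set c | forall x, optri t x -> v x = c] c.
  move: (tL) => /mesh_reps_sub[K KT tE]; have [c Hc] := vT K KT; exists c => y yt.
  apply: Hc; rewrite hull_cltri; last exact: tri_nondegenerate tT _ KT.
  by rewrite -tE interior_cltri.
by move=> /getPex; apply.
Qed.

Section field.
Context (val : tri R -> R).
Local Notation pw := (pwconst L val).
Local Notation tau := (rt_field (flux L val) L).

Lemma pwconst_L2 : L2 A pw.
Proof.
apply: (L2_bounded mA AS (M := \sum_(t <- L) `|val t|)).
  by apply: measurable_funTS; exact: measurable_pwconst.
by move=> x _; exact: pwconst_le.
Qed.

Lemma rt_field_weak_div : weak_div A tau pw.
Proof. exact: (weak_div_rt_field mL val oA AS LN LA). Qed.

Lemma rt_field_RT0 (B : R) : (forall x, l1norm (tau x) <= B) -> RT0 A T tau.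
Proof.
move=> tB; have [m1 m2] := measurable_rt_field (flux L val) L.
split; first split.
- apply: (L2_bounded mA AS (M := B)); first exact: measurable_funTS.
  by move=> x _; rewrite (le_trans _ (tB x))// lerDl.
- apply: (L2_bounded mA AS (M := B)); first exact: measurable_funTS.
  by move=> x _; rewrite (le_trans _ (tB x))// lerDr.
- by exists pw; [exact: pwconst_L2|exact: rt_field_weak_div].
move=> K KT; have [t tL tK] := mesh_reps_cover (tri_nondegenerate tT) KT.
exists (rt_shift (flux L val) t), (rt_slope (flux L val) t) => x.
by rewrite -tK interior_cltri// => tx; rewrite (rt_field_in mL _ tL tx).
Qed.

Lemma rt_field_ae_zero : ae_zero A tau -> {ae leb2 R, forall x, A x -> pw x = 0}.
Proof.
have [m1 m2] := measurable_rt_field (flux L val) L.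
apply: (ae_zero_div oA AS _ _ pwconst_L2 rt_field_weak_div); exact: measurable_funTS.
Qed.

Lemma rt_field_inner (v : plane R -> R) : measurable_fun A (v : mplane R -> R) ->
  inner A (div A tau) v = \int[leb2 R]_(x in A) (pw x * v x).
Proof.
move=> mv; have [[md _] _] := div_L2 pwconst_L2 rt_field_weak_div.
have mp : measurable_fun A (pw : mplane R -> R).
  by apply: measurable_funTS; exact: measurable_pwconst.
apply: ae_eq_Rintegral => //; [exact: measurable_funM|exact: measurable_funM|].
move: (div_ae oA AS pwconst_L2 rt_field_weak_div).
by apply: (@filterS _ _ (ae_filter_ringOfSetsType (leb2 R))) => x H /H ->.
Qed.

Lemma rt_field_div_norm : Lpnorm A 2 (div A tau) = Lpnorm A 2 pw.
Proof.
have [[md _] _] := div_L2 pwconst_L2 rt_field_weak_div.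
apply: Lpnorm_ae => //; first by apply: measurable_funTS; exact: measurable_pwconst.
exact: (div_ae oA AS pwconst_L2 rt_field_weak_div).
Qed.

(** The potential is an integral over the square, while the norms are taken on
    [A]; the function vanishes in between. *)
Lemma pwconst_square_integral :
  \int[leb2 R]_(x in square N) (`|pw x| ^+ 2) = \int[leb2 R]_(x in A) (pw x ^+ 2).
Proof.
rewrite [LHS]Rintegral_mkcond [RHS]Rintegral_mkcond; apply: eq_Rintegral => x _.
rewrite !patchE real_normK ?num_real//.
have [[t tL tx]|nx] := pselect (exists2 t, t \in L & optri t x).
  by rewrite (mem_set (LA tL tx)) (mem_set (AS (LA tL tx))).
rewrite (_ : pw x = 0) ?expr0n ?if_same//.
rewrite /pwconst big_seq big1// => t tL; rewrite indicE memNset ?mulr0// => tx.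
by apply: nx; exists t.
Qed.

Lemma rt_field_Lpnorm (delta sigma C q : R) : 0 < delta <= 1 -> 0 < sigma -> 0 < C -> 2 < q ->
  (forall t, t \in L -> delta <= perimeter t) ->
  (forall t, t \in L -> diam (cltri t) <= sigma * indiam (cltri t)) ->
  let V := \int[leb2 R]_(x in A) (pw x ^+ 2) in
  (\int[leb2 R]_(x in square N) ((riesz N delta (fun y => `|pw y|%R) x) `^ q)%:E <=
      (C * V `^ (q / 2))%:E)%E -> 0 < V ->
  (Lpnorm A q (fun x => enorm (tau x)) <= (648 * sigma * C `^ q^-1 * V `^ 2^-1)%:E)%E.
Proof.
move=> /andP[d0 d1] s0 C0 q2 dL reg V HC V0; have q0 : 0 < q by apply: lt_trans q2.
have bd x := @rt_field_le R A L mL val N LN delta sigma x d0 s0 dL reg.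
move: bd; set k := 648 * sigma; set rz := riesz _ _ _ => bd.
have k0 : 0 <= k by apply: mulr_ge0 (ltW s0); exact: ler0n.
clearbody k.
have rz0 x : 0 <= rz x by exact: riesz_ge0.
have [m1 m2] := measurable_rt_field (flux L val) L.
have mS := @measurable_square R N.
have mt : measurable_fun (square N) (fun x : mplane R => (`|enorm (tau x)| `^ q)%:E).
  apply/measurable_EFinP; apply: (measurableT_comp (measurable_powR q)).
  apply: (measurableT_comp (@normr_measurable R setT)).
  by apply: measurable_enorm; exact: measurable_funTS.
have mr : measurable_fun (square N) (fun x : mplane R => (rz x `^ q)%:E).
  apply/measurable_EFinP; apply: (measurableT_comp (measurable_powR q)).
  apply: measurable_funTS; apply: measurable_riesz => //.
  by apply: measurableT_comp => //; exact: measurable_pwconst.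
rewrite LpnormE//.
have -> : k * C `^ q^-1 * V `^ 2^-1 = (k `^ q * (C * V `^ (q / 2))) `^ q^-1.
  rewrite !powRM ?mulr_ge0 ?powR_ge0 ?(ltW C0)// -!powRrM divff ?gt_eqF// powRr1//.
  by rewrite mulrA; congr (_ * _ `^ _); field; rewrite gt_eqF.
rewrite -poweR_EFin; apply: gt0_ler_poweR.
- by rewrite invr_ge0 ltW.
- by rewrite in_itv/= leey andbT; apply: integral_ge0 => x _; rewrite lee_fin powR_ge0.
- by rewrite in_itv/= leey andbT lee_fin mulr_ge0 ?powR_ge0// mulr_ge0 ?powR_ge0 ?ltW.
apply: (@le_trans _ _ (\int[leb2 R]_(x in square N) (k `^ q * rz x `^ q)%:E)%E); last first.
  under eq_integral do rewrite EFinM.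
  rewrite ge0_integralZl//; last 2 first.
  - by move=> x _; rewrite lee_fin powR_ge0.
  - by rewrite lee_fin powR_ge0.
  by rewrite EFinM lee_wpmul2l// lee_fin powR_ge0.
apply: (@le_trans _ _ (\int[leb2 R]_(x in square N) (`|enorm (tau x)| `^ q)%:E)%E).
  by apply: ge0_subset_integral => // x _; rewrite lee_fin powR_ge0.
have mkr : measurable_fun (square N) (fun x : mplane R => (k `^ q * rz x `^ q)%:E).
  by apply/measurable_EFinP; apply: measurable_funM => //; exact/measurable_EFinP.
have t0 (x : mplane R) : square N x -> (0 <= (`|enorm (tau x)| `^ q)%:E)%E.
  by move=> _; rewrite lee_fin powR_ge0.
apply: (ge0_le_integral _ mS t0 mt mkr) => x _.
rewrite lee_fin -powRM//; apply: ge0_ler_powR.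
- exact: ltW.
- by rewrite nnegrE.
- by rewrite nnegrE mulr_ge0.
by rewrite ger0_norm ?sqrtr_ge0// (le_trans (enorm_le_l1norm _)).
Qed.

End field.
End mesh_fields.

(** * The inf-sup inequality *)

Lemma fine_bounds (R : realType) (x : \bar R) (b : R) :
  (0 <= x)%E -> (x <= b%:E)%E -> 0 <= fine x <= b.
Proof. by case: x => [r| |]//=; rewrite !lee_fin => -> ->. Qed.

Lemma bounded_closure_square (R : realType) (A : set (plane R)) : bounded_set A ->
  exists2 N : R, 0 < N & closure A `<=` square N.
Proof.
move=> [M [_ HM]]; exists (Num.max M 0 + 1); first by rewrite ltr_pwDr// le_max lexx orbT.
have cl : closed (square (Num.max M 0 + 1) : set (plane R)).
  apply: compact_closed; first exact: norm_hausdorff.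
  by apply: compact_setX; exact: segment_compact.
apply: (subset_trans _ cl); apply: closureS => x Ax.
have : `|x| <= Num.max M 0 + 1.
  by apply: HM => //; rewrite ltr_pwDr// le_max lexx.
by rewrite prod_normE ge_max !ler_norml => /andP[? ?]; split; rewrite /= in_itv.
Qed.

Section mesh_infsup.
Context (R : realType) (A : set (plane R)) (N q sigma C : R).
Hypothesis oA : open A.
Hypothesis A0 : A !=set0.
Hypothesis lA : interior (closure A) `<=` A.
Hypothesis AN : closure A `<=` square N.
Hypotheses (q2 : 2 < q) (s0 : 0 < sigma) (C0 : 0 < C).
Hypothesis HC : forall (delta B : R) (u : plane R -> R), 0 < delta <= 1 ->
  measurable_fun setT (u : mplane R -> R) -> (forall y, 0 <= u y <= B) ->
  0 < \int[leb2 R]_(y in square N) (u y ^+ 2) ->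
  (\int[leb2 R]_(x in square N) ((riesz N delta u x) `^ q)%:E <=
    (C * (\int[leb2 R]_(y in square N) (u y ^+ 2)) `^ (q / 2))%:E)%E.
Context (T : seq (triangle R)) (tT : triangulation A T).
Hypothesis reg : forall K, K \in T -> diam (hull K) <= sigma * indiam (hull K).

Let L := mesh_reps T.
Let mL : ccw_mesh A L := mesh_reps_mesh tT.
Let mA := open_plane_measurable oA.
Let AS : A `<=` square N := subset_trans (@subset_closure _ A) AN.
Let LN := mesh_verts_square AN tT.

Lemma mesh_regular t : t \in L -> diam (cltri t) <= sigma * indiam (cltri t).
Proof.
move=> /mesh_reps_sub[K KT ->]; rewrite -hull_cltri; last exact: tri_nondegenerate tT _ KT.
exact: reg.
Qed.

Lemma rt_field_bounded val : exists B, forall x, l1norm (rt_field (flux L val) L x) <= B.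
Proof.
have [d /andP[d0 d1] dL] := mesh_size (fun t => mesh_ccw mL (t := t)).
exists (648 * sigma * \int[leb2 R]_(y in square N) ((\sum_(t <- L) `|val t|) * d^-1)) => x.
apply: (le_trans (rt_field_le mL val LN x d0 s0 dL mesh_regular)).
apply: ler_wpM2l; first by apply: mulr_ge0 (ltW s0); exact: ler0n.
have mS := @measurable_square R N.
have bd y : `|pwconst L val y| * kernel d (x - y) <= (\sum_(t <- L) `|val t|) * d^-1.
  by rewrite ler_pM// ?pwconst_le ?kernel_ge0 ?kernel_le.
apply: le_Rintegral => //.
- apply: (@bounded_integrable _ N ((\sum_(t <- L) `|val t|) * d^-1)) => //.
    apply: measurable_funTS; apply: measurable_funM; last exact: measurable_kernel_sub.
    by apply: measurableT_comp => //; exact: measurable_pwconst.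
  by move=> y _; rewrite ger0_norm ?bd// mulr_ge0// kernel_ge0.
- by apply: (@bounded_integrable _ N `|(\sum_(t <- L) `|val t|) * d^-1|).
Qed.

Lemma rt_field_admissible val : ~ {ae leb2 R, forall x, A x -> pwconst L val x = 0} ->
  RT0 A T (rt_field (flux L val) L) /\ ~ ae_zero A (rt_field (flux L val) L).
Proof.
move=> nz; have [B HB] := rt_field_bounded val; split; first exact: (rt_field_RT0 oA lA AN tT HB).
by move=> /(rt_field_ae_zero oA lA AN tT).
Qed.

Lemma pwconst1_neq0 : ~ {ae leb2 R, forall x, A x -> pwconst L (cst 1) x = 0}.
Proof.
have [x Ax] := A0; have [t tL _] := mesh_cover mL (subset_closure Ax).
move=> [M [mM M0 HM]]; have ct := mesh_ccw mL tL.
have sub : optri t `<=` M.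
  move=> y yt; apply: HM => /(_ (mesh_optri_sub lA tT tL yt)).
  by rewrite (pwconst_in mL _ tL yt) => /eqP; rewrite oner_eq0.
have z : leb2 R (optri t) = 0%E.
  by apply: (subset_measure0 _ mM sub M0); exact: measurable_optri.
have := open_triangle_area ct; rewrite -/(optri t) z /= => /esym/eqP.
by rewrite mulf_eq0 invr_eq0 pnatr_eq0 orbF gt_eqF.
Qed.

(** The field with divergence [v] is tested, unless [v] vanishes almost everywhere:
    then its field is zero, and the field with divergence 1, which is not, gives the
    quotient 0. *)
Lemma mesh_infsup (v : plane R -> R) : P0 A T v ->
  exists tau, [/\ RT0 A T tau, ~ ae_zero A tau &
    ((648 * sigma * C `^ q^-1 + 1)^-1%:E * Lpnorm A 2 v <= (infsup_quotient A q v tau)%:E)%E].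
Proof.
move=> Pv; have [mv _] := Pv; have [val vval] := P0_pwconst tT Pv.
have Lp := @pwconst_L2 R A T N oA AN val; have [mp _] := Lp.
have q0 : 0 < q by apply: lt_trans q2.
have K0 : 0 <= 648 * sigma * C `^ q^-1.
  by apply: mulr_ge0 (powR_ge0 _ _); apply: mulr_ge0 (ltW s0); exact: ler0n.
rewrite (Lpnorm_ae _ mA mv mp vval)// (Lpnorm2E mA Lp).
have E := pwconst_square_integral lA AN tT val.
have := @rt_field_Lpnorm R A T N oA AN tT val.
move: E; set V := \int[leb2 R]_(x in A) (pwconst _ val x ^+ 2) => E.
have V0 : 0 <= V by apply: Rintegral_ge0 => x _; exact: sqr_ge0.
move: V0; rewrite le_eqVlt => /predU1P[V0 _|V0 bound].
  exists (rt_field (flux L (cst 1)) L).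
  have [r1 r2] := rt_field_admissible pwconst1_neq0; split => //.
  rewrite -V0 powR0 ?invr_eq0 ?pnatr_eq0// mule0 lee_fin.
  rewrite /infsup_quotient (rt_field_inner oA lA AN tT)// mulr_ge0// ?invr_ge0; last first.
    by rewrite addr_ge0// fine_ge0// Lnorm_ge0.
  have v0 : {ae leb2 R, forall x, A x -> v x = 0}.
    have ip := L2_sqr_integrable Lp.
    have : (\int[leb2 R]_(x in A) `|(pwconst L val x ^+ 2)%:E| = 0)%E.
      have -> : (\int[leb2 R]_(x in A) `|(pwconst L val x ^+ 2)%:E| =
          \int[leb2 R]_(x in A) (pwconst L val x ^+ 2)%:E)%E.
        by apply: eq_integral => x _; rewrite /= ger0_norm// sqr_ge0.
      by rewrite -(fineK (integrable_fin_num mA ip)); congr EFin.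
    have mx : measurable_fun A (fun x : mplane R => (pwconst L val x ^+ 2)%:E).
      by apply/measurable_EFinP; exact: measurable_funX.
    move=> /(ae_eq_integral_abs (leb2 R) mA mx); move: vval.
    apply: (@filterS2 _ _ (ae_filter_ringOfSetsType (leb2 R))) => x H1 H2 Ax.
    by move: (H2 Ax) => /= [/eqP]; rewrite sqrf_eq0 H1// => /eqP.
  rewrite (ae_eq_Rintegral (g := cst 0) mA) ?Rintegral_cst ?mul0r//.
    by apply: measurable_funM => //; apply: measurable_funTS; exact: measurable_pwconst.
  by move: v0; apply: (@filterS _ _ (ae_filter_ringOfSetsType (leb2 R))) => x H /H ->; rewrite mulr0.
have [d d01 dL] := mesh_size (fun t => mesh_ccw mL (t := t)).
have HR := HC d01 (u := fun y => `|pwconst L val y|) (B := \sum_(t <- L) `|val t|).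
have {}bound := bound d sigma C q d01 s0 C0 q2 dL mesh_regular.
exists (rt_field (flux L val) L).
have [|r1 r2] := @rt_field_admissible val.
  move=> p0; have : V = 0.
    rewrite /V (ae_eq_Rintegral (g := cst 0) mA) ?Rintegral_cst ?mul0r//; first exact: measurable_funX.
    by move: p0; apply: (@filterS _ _ (ae_filter_ringOfSetsType (leb2 R))) => x H /H ->; rewrite expr0n.
  by move=> Vz; rewrite Vz ltxx in V0.
split=> //; rewrite lee_fin /infsup_quotient (rt_field_inner oA lA AN tT)//.
have -> : \int[leb2 R]_(x in A) (pwconst (mesh_reps T) val x * v x) = V.
  apply: ae_eq_Rintegral => //; [exact: measurable_funM|exact: measurable_funX|].
  by move: vval; apply: (@filterS _ _ (ae_filter_ringOfSetsType (leb2 R))) => x H /H ->; rewrite expr2.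
rewrite (rt_field_div_norm oA lA AN tT) (Lpnorm2E mA Lp) -/V /=.
have {}HR : (\int[leb2 R]_(x in square N) ((riesz N d (fun y => `|pwconst L val y|%R) x) `^ q)%:E <=
    (C * V `^ (q / 2))%:E)%E.
  rewrite -E; apply: HR; rewrite ?E//.
    by apply: measurableT_comp => //; exact: measurable_pwconst.
  by move=> y; rewrite normr_ge0 pwconst_le.
have := bound HR V0; move/(fine_bounds (Lnorm_ge0 _ _ _)) => /andP[n0 n1].
have s2 : V `^ 2^-1 ^+ 2 = V.
  by rewrite -powR_mulrn ?powR_ge0// -powRrM mulVf// powRr1// ltW.
have s1 : 0 < V `^ 2^-1 by exact: powR_gt0.
move: n0 n1; set n := fine _; clearbody n => n0 n1.
move: s1 s2 n1 K0; set s := V `^ _; set k := _ * C `^ _; clearbody s k => s1 s2 n1 K0.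
rewrite -[X in _ <= X / _]s2 ler_pdivlMr ?ltr_wpDl// -mulrA ler_pdivrMl ?ltr_wpDl//.
have -> : (k + 1) * s ^+ 2 = s * (k * s + s) by ring.
by rewrite ler_pM2l// lerD2r.
Qed.

End mesh_infsup.

Theorem corollary6p2 (R : realType) (Omega : set (plane R))
    (F : set (seq (triangle R))) (p : R)
    (hOmega : bounded_lipschitz_domain Omega)
    (hOmega_sc : simply_connected Omega)
    (hF : forall T, F T -> triangulation Omega T)
    (hF_reg : shape_regular F)
    (hp1 : 1 < p) (hp2 : p < 2) :
  exists2 beta : R, 0 < beta &
    forall (T : seq (triangle R)) (v : plane R -> R),
      F T -> P0 Omega T v ->
      (beta%:E * Lpnorm Omega 2 v <=
        ereal_sup [set (infsup_quotient Omega (p / (p - 1)) v tau)%:E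
                  | tau in [set tau | RT0 Omega T tau /\ ~ ae_zero Omega tau]])%E.
Proof.
case: hOmega => O0 oO _ bO lO; case: hF_reg => sigma s0 reg.
have [N N0 ON] := bounded_closure_square bO.
have q2 : 2 < p / (p - 1) by rewrite ltr_pdivlMr; lra.
have [C C0 HC] := riesz_bound N0 q2.
exists (648 * sigma * C `^ (p / (p - 1))^-1 + 1)^-1.
  rewrite invr_gt0; apply: ltr_wpDl ltr01.
  by apply: mulr_ge0 (powR_ge0 _ _); apply: mulr_ge0 (ltW s0); exact: ler0n.
move=> T v FT Pv.
have [tau [t1 t2 le]] := mesh_infsup oO O0 (interior_closure_lipschitz oO lO) ON q2 s0 C0 HC
  (hF _ FT) (reg _ ^~ FT) Pv.
by apply: (le_trans le); apply: ereal_sup_ubound; exists tau.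
Qed.
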